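(* Let $G$ be a Lie subgroup of $GL(n,\mathbb{R})$ and let $P$ be a $G$-structure on an $n$-dimensional smooth manifold $M$. Then $P$ is integrable if and only if around each point in $M$ there are an open neighbourhood $U$ and a locally flat $G$-connection $\nabla$ on $U$ (i.e. $\nabla$ is torsionless and has zero curvature).
   Context: A $G$-structure $P$ on $M$ is a reduction of the linear frame bundle $\mathcal{F}M$ to $G$; frames belonging to $P$ are called adapted. $P$ is integrable if around each point there exist local coordinates $(x^i)$ such that the local frame $(\partial/\partial x^1,\dots,\partial/\partial x^n)$ is a section of $P$. A linear connection on an open set $U$ is a $G$-connection (for $P|_U$) if its parallel transport maps adapted frames into adapted frames. *)

(* Defs.v *)
From HB Require Import structures.
From mathcomp Require Export all_boot all_order all_algebra.
From mathcomp Require Export all_classical all_reals all_analysis.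
Export numFieldNormedType.Exports.

Set Implicit Arguments.
Unset Strict Implicit.
Unset Printing Implicit Defensive.

Import Order.TTheory GRing.Theory Num.Theory.
Local Open Scope classical_set_scope.
Local Open Scope ring_scope.

(* The domains used below are open subsets of finite-dimensional spaces; there,
   f is C^(k+1) iff it is differentiable and all its directional derivatives
   are C^k. *)
Fixpoint Ck (R : realType) (V W : normedModType R) (k : nat) (A : set V)
    (f : V -> W) : Prop :=
  match k with
  | 0 => forall x, A x -> {for x, continuous f}
  | k'.+1 => (forall x, A x -> differentiable f x) /\
             (forall v, Ck k' A (fun x => 'D_v f x))
  end.

Definition smooth_on (R : realType) (V W : normedModType R) (A : set V)
    (f : V -> W) : Prop :=
  forall k, Ck k A f.

Definition smooth_at (R : realType) (V W : normedModType R) (f : V -> W)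
    (x : V) : Prop :=
  exists2 A, open_nbhs x A & smooth_on A f.

Definition jac (R : realType) (m n : nat) (f : 'cV[R]_n -> 'cV[R]_m)
    (x : 'cV[R]_n) : 'M[R]_(m, n) :=
  \matrix_(i, j) ('D_(delta_mx j 0) f x) i 0.

(* A homeomorphism from the open set [dom] onto an open subset of R^n; both maps
   are total, with irrelevant values outside these sets. *)
Record chart (R : realType) (n : nat) (T : topologicalType) := Chart {
  dom : set T;
  to_coord : T -> 'cV[R]_n;
  of_coord : 'cV[R]_n -> T;
  dom_open : open dom;
  cod_open : open (to_coord @` dom);
  to_coordK : forall p, dom p -> of_coord (to_coord p) = p;
  to_coord_continuous : forall p, dom p -> {for p, continuous to_coord};
  of_coord_continuous :
    forall y, (to_coord @` dom) y -> {for y, continuous of_coord}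
}.

Definition transition (R : realType) (n : nat) (T : topologicalType)
    (phi psi : chart R n T) : 'cV[R]_n -> 'cV[R]_n :=
  to_coord psi \o of_coord phi.

Definition compatible (R : realType) (n : nat) (T : topologicalType)
    (phi psi : chart R n T) : Prop :=
  smooth_on (to_coord phi @` (dom phi `&` dom psi)) (transition phi psi) /\
  smooth_on (to_coord psi @` (dom phi `&` dom psi)) (transition psi phi).

(* The atlas is given with a choice of one of its charts around each point; the
   smooth structure is the maximal atlas it generates, see [smooth_chart]. *)
Record manifold (R : realType) (n : nat) := Manifold {
  mfd_carrier :> topologicalType;
  mfd_hausdorff : hausdorff_space mfd_carrier;
  mfd_second_countable : @second_countable mfd_carrier;
  chart_at : mfd_carrier -> chart R n mfd_carrier;
  chart_at_dom : forall p, dom (chart_at p) p;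
  chart_at_compatible : forall p q, compatible (chart_at p) (chart_at q)
}.
Arguments chart_at {R n m} p.

Definition smooth_chart (R : realType) (n : nat) (M : manifold R n)
    (phi : chart R n M) : Prop :=
  forall p : M, compatible phi (chart_at p).

Definition coord_at (R : realType) (n : nat) (M : manifold R n) (p : M) :
    'cV[R]_n :=
  to_coord (chart_at p) p.

Definition smooth_into_at (R : realType) (V : normedModType R) (n : nat)
    (N : manifold R n) (f : V -> N) (x : V) : Prop :=
  {for x, continuous f} /\ smooth_at (to_coord (chart_at (f x)) \o f) x.

Definition smooth_map_at (R : realType) (m n : nat) (M : manifold R m)
    (N : manifold R n) (f : M -> N) (p : M) : Prop :=
  smooth_into_at (f \o of_coord (chart_at p)) (coord_at p).

Definition smooth_fun_at (R : realType) (n : nat) (M : manifold R n)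
    (W : normedModType R) (f : M -> W) (p : M) : Prop :=
  smooth_at (f \o of_coord (chart_at p)) (coord_at p).

(* A Lie group with an injective immersion into GL(n, R) which is a group
   morphism; the subgroup is the image of [incl], not necessarily closed.  The
   group axioms follow from the injectivity of [incl]. *)
Record lie_subgroup (R : realType) (n : nat) := LieSubgroup {
  lie_dim : nat;
  lie_mfd :> manifold R lie_dim;
  incl : lie_mfd -> 'M[R]_n;
  incl_unit : forall g, incl g \in unitmx;
  incl_inj : injective incl;
  incl_smooth : forall g, smooth_fun_at incl g;
  incl_immersion :
    forall g, injective ('d (incl \o of_coord (chart_at g)) (coord_at g));
  lie_one : lie_mfd;
  lie_mul : lie_mfd -> lie_mfd -> lie_mfd;
  lie_inv : lie_mfd -> lie_mfd;
  incl_one : incl lie_one = 1%:M;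
  incl_mul : forall g h, incl (lie_mul g h) = incl g *m incl h;
  incl_inv : forall g, incl (lie_inv g) = invmx (incl g);
  lie_mul_smooth : forall g h,
    smooth_into_at (fun u : 'cV[R]_lie_dim * 'cV[R]_lie_dim =>
        lie_mul (of_coord (chart_at g) u.1) (of_coord (chart_at h) u.2))
      (coord_at g, coord_at h);
  lie_inv_smooth : forall g, smooth_map_at lie_inv g
}.

(* A tangent vector at p is represented by the column of its components in
   [chart_at p], so that 'cV[R]_n stands for T_p M.  A vector field is then a
   function M -> 'cV[R]_n, whose values at different points are components in
   different charts.  A frame at p is an invertible matrix, its columns being
   the vectors of the frame; GL(n, R) acts on frames on the right by *m. *)

(* turns components in [chart_at p] into components in phi *)
Definition tcoord (R : realType) (n : nat) (M : manifold R n)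
    (phi : chart R n M) (p : M) : 'M[R]_n :=
  jac (transition (chart_at p) phi) (coord_at p).

(* A field of m-tuples of tangent vectors, read in the chart phi; m = 1 gives
   vector fields and m = n frames. *)
Definition read_in (R : realType) (n m : nat) (M : manifold R n)
    (phi : chart R n M) (X : M -> 'M[R]_(n, m)) (y : 'cV[R]_n) :
    'M[R]_(n, m) :=
  tcoord phi (of_coord phi y) *m X (of_coord phi y).

Definition smooth_field_at (R : realType) (n m : nat) (M : manifold R n)
    (X : M -> 'M[R]_(n, m)) (p : M) : Prop :=
  smooth_at (read_in (chart_at p) X) (coord_at p).

Definition smooth_field_on (R : realType) (n m : nat) (M : manifold R n)
    (W : set M) (X : M -> 'M[R]_(n, m)) : Prop :=
  forall p, W p -> smooth_field_at X p.

(* the coordinate frame (d/dx^1, ..., d/dx^n) of the chart phi *)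
Definition coord_frame (R : realType) (n : nat) (M : manifold R n)
    (phi : chart R n M) (q : M) : 'M[R]_n :=
  jac (transition phi (chart_at q)) (to_coord phi q).

Definition coord_field (R : realType) (n : nat) (M : manifold R n)
    (phi : chart R n M) (j : 'I_n) (q : M) : 'cV[R]_n :=
  col j (coord_frame phi q).

Definition dir_deriv (R : realType) (n : nat) (M : manifold R n) (p : M)
    (v : 'cV[R]_n) (f : M -> R) : R :=
  'D_v (f \o of_coord (chart_at p) : 'cV[R]_n -> R^o) (coord_at p).

Definition lie_bracket (R : realType) (n : nat) (M : manifold R n)
    (X Y : M -> 'cV[R]_n) (p : M) : 'cV[R]_n :=
  'D_(X p) (read_in (chart_at p) Y) (coord_at p) -
  'D_(Y p) (read_in (chart_at p) X) (coord_at p).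

(* P p is the set of adapted frames at p.  The local sections [sec p], defined
   on the open sets [U p], are the local trivialisations of the principal
   G-bundle P; the last clause says that their transition functions are smooth
   maps into the Lie group G. *)
Definition G_structure (R : realType) (n : nat) (G : lie_subgroup R n)
    (M : manifold R n) (P : M -> set 'M[R]_n) : Prop :=
  [/\ forall p F, P p F -> F \in unitmx,
      forall p F (g : G), P p F -> P p (F *m incl g),
      forall p F F', P p F -> P p F' -> exists g : G, F' = F *m incl g &
      exists (U : M -> set M) (sec : M -> M -> 'M[R]_n),
        [/\ forall p, open (U p) /\ U p p,
            forall p, smooth_field_on (U p) (sec p),
            forall p q, U p q -> P q (sec p q) &
            forall p q, exists2 g : M -> G,
              forall x, (U p `&` U q) x -> sec q x = sec p x *m incl (g x) &
              forall x, (U p `&` U q) x -> smooth_map_at g x]].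

Definition integrable_G_structure (R : realType) (n : nat) (M : manifold R n)
    (P : M -> set 'M[R]_n) : Prop :=
  forall p : M, exists phi : chart R n M,
    [/\ smooth_chart phi, dom phi p &
        forall q, dom phi q -> P q (coord_frame phi q)].

(* A covariant derivative on U: [nabla p v Y] is the derivative at p along
   v in T_p M of a vector field Y defined and smooth near p.  As it is local, it
   is a function of local vector fields; vector fields are total functions here,
   and their values far from p play no role. *)
Record linear_connection (R : realType) (n : nat) (M : manifold R n)
    (U : set M) := LinearConnection {
  nabla :> M -> 'cV[R]_n -> (M -> 'cV[R]_n) -> 'cV[R]_n;
  nabla_local : forall p v (Y Z : M -> 'cV[R]_n), U p ->
    smooth_field_at Y p -> smooth_field_at Z p ->
    (\forall q \near p, Y q = Z q) -> nabla p v Y = nabla p v Z;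
  nabla_linear : forall p (a : R) u v (Y : M -> 'cV[R]_n), U p ->
    smooth_field_at Y p ->
    nabla p (a *: u + v) Y = a *: nabla p u Y + nabla p v Y;
  nabla_add : forall p v (Y Z : M -> 'cV[R]_n), U p ->
    smooth_field_at Y p -> smooth_field_at Z p ->
    nabla p v (fun q => Y q + Z q) = nabla p v Y + nabla p v Z;
  nabla_leibniz : forall p v (f : M -> R) (Y : M -> 'cV[R]_n), U p ->
    smooth_fun_at (f : M -> R^o) p -> smooth_field_at Y p ->
    nabla p v (fun q => f q *: Y q) = dir_deriv p v f *: Y p + f p *: nabla p v Y;
  nabla_smooth : forall (W : set M) (X Y : M -> 'cV[R]_n), open W -> W `<=` U ->
    smooth_field_on W X -> smooth_field_on W Y ->
    smooth_field_on W (fun q => nabla q (X q) Y)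
}.

Definition cov (R : realType) (n : nat) (M : manifold R n) (U : set M)
    (D : linear_connection U) (X Y : M -> 'cV[R]_n) (q : M) : 'cV[R]_n :=
  D q (X q) Y.

Definition torsion (R : realType) (n : nat) (M : manifold R n) (U : set M)
    (D : linear_connection U) (X Y : M -> 'cV[R]_n) (q : M) : 'cV[R]_n :=
  cov D X Y q - cov D Y X q - lie_bracket X Y q.

Definition curvature (R : realType) (n : nat) (M : manifold R n) (U : set M)
    (D : linear_connection U) (X Y Z : M -> 'cV[R]_n) (q : M) : 'cV[R]_n :=
  cov D X (cov D Y Z) q - cov D Y (cov D X Z) q - cov D (lie_bracket X Y) Z q.

Definition locally_flat (R : realType) (n : nat) (M : manifold R n) (U : set M)
    (D : linear_connection U) : Prop :=
  (forall (W : set M) (X Y : M -> 'cV[R]_n), open W -> W `<=` U ->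
     smooth_field_on W X -> smooth_field_on W Y ->
     forall p, W p -> torsion D X Y p = 0) /\
  (forall (W : set M) (X Y Z : M -> 'cV[R]_n), open W -> W `<=` U ->
     smooth_field_on W X -> smooth_field_on W Y -> smooth_field_on W Z ->
     forall p, W p -> curvature D X Y Z p = 0).

(* A curve on [a, b] is a function on R, smooth on a neighbourhood of [a, b].
   Parallel transport along piecewise smooth curves is a composite of
   transports along such curves. *)
Definition curve_in (R : realType) (n : nat) (M : manifold R n) (U : set M)
    (a b : R) (c : R -> M) : Prop :=
  forall t, a <= t <= b -> U (c t) /\ smooth_into_at (c : R^o -> M) t.

Definition velocity (R : realType) (n : nat) (M : manifold R n) (c : R -> M)
    (t : R) : 'cV[R]_n :=
  derive1 (to_coord (chart_at (c t)) \o c) t.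

Definition read_along (R : realType) (n : nat) (M : manifold R n)
    (phi : chart R n M) (c : R -> M) (V : R -> 'cV[R]_n) (s : R) : 'cV[R]_n :=
  tcoord phi (c s) *m V s.

(* Covariant derivative of V along c: V = \sum_j V^j d/dx^j gives
   DV/dt = \sum_j (dV^j/dt) d/dx^j + \sum_j V^j nabla_(c') (d/dx^j),
   computed in the chart chosen at c t. *)
Definition cov_along (R : realType) (n : nat) (M : manifold R n) (U : set M)
    (D : linear_connection U) (c : R -> M) (V : R -> 'cV[R]_n) (t : R) :
    'cV[R]_n :=
  derive1 (read_along (chart_at (c t)) c V) t +
  \sum_j V t j 0 *: D (c t) (velocity c t) (coord_field (chart_at (c t)) j).

Definition parallel_along (R : realType) (n : nat) (M : manifold R n)
    (U : set M) (D : linear_connection U) (a b : R) (c : R -> M)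
    (V : R -> 'cV[R]_n) : Prop :=
  forall t, a <= t <= b ->
    derivable (read_along (chart_at (c t)) c V : R^o -> 'cV[R]_n) t 1 /\
    cov_along D c V t = 0.

(* the graph of the parallel transport T_(c a) M -> T_(c b) M along c *)
Definition parallel_transport (R : realType) (n : nat) (M : manifold R n)
    (U : set M) (D : linear_connection U) (a b : R) (c : R -> M)
    (v w : 'cV[R]_n) : Prop :=
  exists V : R -> 'cV[R]_n, [/\ parallel_along D a b c V, V a = v & V b = w].

Definition G_connection (R : realType) (n : nat) (M : manifold R n)
    (P : M -> set 'M[R]_n) (U : set M) (D : linear_connection U) : Prop :=
  forall (a b : R) (c : R -> M), a <= b -> curve_in U a b c ->
  forall F F' : 'M[R]_n,
    (forall j, parallel_transport D a b c (col j F) (col j F')) ->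
    P (c a) F -> P (c b) F'.

(* Main.v *)
(** If [P] is integrable, an adapted chart carries the flat connection whose
    parallel fields are those with constant components; parallel transport
    preserves the components of a frame in the coordinate frame, hence [P].

    Conversely, in a chart around [p] a flat torsionless connection has
    Christoffel matrices [Gamma(v)] with [Gamma(v) w = Gamma(w) v] and zero
    curvature.  These two conditions are the flatness of the overdetermined linear
    system [D_v theta = theta Gamma(v)], [D_v h = theta v] in the unknown
    [Z = (theta | h)], which therefore has a solution with [theta(p)] the inverse
    of an adapted frame.  As [jac h = theta], [h] is a local diffeomorphism, and
    the coordinate frame [theta^-1] of the new chart is parallel and adapted at
    [p]; it is adapted everywhere by parallel transport along segments. *)
From HB Require Import structures.
Require Import Defs.
From mathcomp Require Import ring lra.

Set Implicit Arguments.
Unset Strict Implicit.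
Unset Printing Implicit Defensive.

Import Order.TTheory GRing.Theory Num.Theory.
Local Open Scope classical_set_scope.
Local Open Scope ring_scope.

(** * Calculus of C^k maps *)

(** The system for theta and h is integrated along straight rays from the centre, so that only
    ordinary differential equations in one variable are solved; flatness enters as a quadratic
    estimate between neighbouring rays, and smoothness follows by feeding the equation back into
    itself. The ball is shrunk until the coefficients are bounded by 1/2 on [0,1]: Picard iteration
    then contracts on the whole interval, and Gronwall's inequality reduces to an argument at a
    maximum, with no exponentials. Keeping h beside theta in one unknown spares a separate Poincare
    lemma for the closed form theta. No parallel transport is ever constructed on [M]: one direction
    starts from given parallel fields, and the other exhibits coordinate fields as parallel.
    Components of tangent vectors refer to a chart that varies with the point, so each derivative is
    first moved to a fixed chart, at the price of terms in the derivatives of transition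
    Jacobians. *)

Section NearEq.
Context {R : realType} {V W : normedModType R}.
Implicit Types (f g : V -> W) (A B : set V) (x v : V).

(** The little-o of the definition, unfolded. Continuity of [L] is a separate hypothesis because [V]
    is an arbitrary normed space. *)
Lemma differentiable_eps f x (L : {linear V -> W}) : continuous L ->
  (forall e, 0 < e -> \forall h \near (0 : V),
     `|f (h + x) - f x - L h| <= e * `|h|) ->
  differentiable f x /\ 'd f x = L :> (V -> W).
Proof.
move=> cL H.
have E : f \o shift x = cst (f x) + L +o_ (0 : V) id.
  apply/eqaddoP => e e0; near=> h.
  have -> : (f \o shift x - (cst (f x) + L)) h = f (h + x) - f x - L h.
    by rewrite !fctE /= opprD addrA.
  by near: h; exact: H.
have dE := diff_unique cL E; split => //.
by apply/diff_locallyP; rewrite dE.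
Unshelve. all: by end_near. Qed.

Lemma differentiable_epsP f x : differentiable f x ->
  forall e, 0 < e -> \forall h \near (0 : V),
     `|f (h + x) - f x - 'd f x h| <= e * `|h|.
Proof.
move=> /diff_locallyP [_ /eqaddoP H] e e0; near=> h.
have -> : f (h + x) - f x - 'd f x h = (f \o shift x - (cst (f x) + 'd f x)) h.
  by rewrite !fctE /= opprD addrA.
by near: h; exact: H.
Unshelve. all: by end_near. Qed.

Lemma near_eq_differentiable f g x : (\near x, f x = g x) ->
  differentiable f x -> differentiable g x.
Proof.
move=> fg df.
have [] // := @differentiable_eps g x ('d f x) (diff_continuous df) _.
move=> e e0; near=> h.
rewrite -(nbhs_singleton fg) -(_ : f (h + x) = g (h + x)).
  by near: h; exact: differentiable_epsP.
by near: h; move: fg; rewrite (near_shift 0 x) subr0.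
Unshelve. all: by end_near. Qed.

Lemma open_near A x : open A -> A x -> \near x, A x.
Proof. by move=> oA Ax; apply: open_nbhs_nbhs; split. Qed.

(** Derivatives at a point of [A] depend on the values around it; openness turns agreement on [A]
    into agreement near each of its points. *)
Lemma Ck_eq k A f g : open A -> (forall x, A x -> f x = g x) ->
  Ck k A f -> Ck k A g.
Proof.
move=> oA; elim: k f g => [|k IH] f g fg /=.
  move=> cf x Ax; rewrite /prop_for /continuous_at -(fg x Ax).
  apply: cvg_trans (cf x Ax); apply: near_eq_cvg.
  by apply: filterS (open_near oA Ax) => y /fg.
move=> [df Df]; split=> [x Ax|v].
  apply: near_eq_differentiable (df x Ax).
  by apply: filterS (open_near oA Ax) => y /fg.
apply: IH (Df v) => x Ax; apply: near_eq_derive.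
by apply: filterS (open_near oA Ax) => y /fg.
Qed.

Lemma Ck_sub k A B f : B `<=` A -> Ck k A f -> Ck k B f.
Proof.
move=> BA; elim: k f => [|k IH] f /= => [cf x /BA /cf //|[df Df]].
by split=> [x /BA /df //|v]; exact: IH.
Qed.

Lemma Ck_pred k A f : Ck k.+1 A f -> Ck k A f.
Proof.
elim: k f => [|k IH] f.
  by move=> [df _] x /df /differentiable_continuous.
by move=> [df Df]; split => // v; exact/IH/Df.
Qed.

Lemma Ck_cst k A (c : W) : Ck k A (fun=> c : W).
Proof.
elim: k c => [|k IH] c; first by move=> x _; exact: cst_continuous.
split=> [x _|v]; first exact: differentiable_cst.
have -> : (fun x : V => 'D_v (fun=> c) x) = (fun=> 0 : W).
  by apply/funext => x; exact: derive_cst.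
exact: IH.
Qed.

Lemma Ck_add k A f g : open A -> Ck k A f -> Ck k A g ->
  Ck k A (fun x => f x + g x).
Proof.
move=> oA; elim: k f g => [|k IH] f g /=.
  by move=> cf cg x Ax; apply: continuousD; [exact: cf|exact: cg].
move=> [df Df] [dg Dg]; split=> [x Ax|v].
  by apply: differentiableD; [exact: df|exact: dg].
apply: Ck_eq (IH _ _ (Df v) (Dg v)) => // x Ax.
by rewrite -deriveD//; apply: diff_derivable; [exact: df|exact: dg].
Qed.

Lemma Ck_sum k A (I : Type) (r : seq I) (P : pred I) (F : I -> V -> W) :
  open A -> (forall i, P i -> Ck k A (F i)) ->
  Ck k A (fun x => \sum_(i <- r | P i) F i x).
Proof.
move=> oA H; elim: r => [|i r IH].
  rewrite (_ : (fun x => _) = fun=> 0 : W); first exact: Ck_cst.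
  by apply/funext => x; rewrite big_nil.
rewrite (_ : (fun x => _) = fun x => (if P i then F i x else (0 : W)) + \sum_(j <- r | P j) F j x).
  by apply: Ck_add => //; case: (boolP (P i)) => [/H //|_]; exact: Ck_cst.
by apply/funext => x; rewrite big_cons; case: ifP => // _; rewrite add0r.
Qed.

Lemma smooth_on_eq A f g : open A -> (forall x, A x -> f x = g x) ->
  smooth_on A f -> smooth_on A g.
Proof. by move=> oA fg sf k; exact: Ck_eq (sf k). Qed.

Lemma smooth_on_sub A B f : B `<=` A -> smooth_on A f -> smooth_on B f.
Proof. by move=> BA sf k; exact: Ck_sub (sf k). Qed.

Lemma smooth_on_cst A (c : W) : smooth_on A (fun=> c : W).
Proof. by move=> k; exact: Ck_cst. Qed.

Lemma smooth_on_add A f g : open A -> smooth_on A f -> smooth_on A g ->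
  smooth_on A (fun x => f x + g x).
Proof. by move=> oA sf sg k; apply: Ck_add. Qed.

Lemma smooth_on_differentiable A f x : smooth_on A f -> A x ->
  differentiable f x.
Proof. by move=> sf Ax; have [df _] := sf 1%N; exact: df. Qed.

Lemma smooth_on_continuous A f x : smooth_on A f -> A x ->
  {for x, continuous f}.
Proof. by move=> sf Ax; exact: sf 0%N x Ax. Qed.

Lemma smooth_on_derive A f v : smooth_on A f -> smooth_on A ('D_v f).
Proof. by move=> sf k; have [_] := sf k.+1; apply. Qed.

End NearEq.

(** * Scalar C^k functions: products and inverses *)

Section Scalar.
Context {R : realType} {V : normedModType R}.
Implicit Types (f g : V -> R^o) (A : set V).

Lemma Ck_mul k A f g : open A -> Ck k A f -> Ck k A g ->
  Ck k A (fun x => f x * g x : R^o).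
Proof.
move=> oA; elim: k f g => [|k IH] f g.
  by move=> cf cg x Ax; apply: continuousM; [exact: cf|exact: cg].
move=> Hf Hg; have [df Df] := Hf; have [dg Dg] := Hg; split=> [x Ax|v].
  by apply: (@differentiableM _ _ f g); [exact: df|exact: dg].
have H1 := IH _ _ (Ck_pred Hf) (Dg v).
have H2 := IH _ _ (Ck_pred Hg) (Df v).
apply: Ck_eq (Ck_add oA H1 H2) => // x Ax.
by rewrite (@deriveM _ _ f g)//; apply: diff_derivable; [exact: df|exact: dg].
Qed.

Lemma Ck_prod k A (I : Type) (r : seq I) (P : pred I) (F : I -> V -> R^o) :
  open A -> (forall i, P i -> Ck k A (F i)) ->
  Ck k A (fun x => \prod_(i <- r | P i) F i x : R^o).
Proof.
move=> oA H; elim: r => [|i r IH].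
  rewrite (_ : (fun x => _) = fun=> 1 : R^o); first exact: Ck_cst.
  by apply/funext => x; rewrite big_nil.
rewrite (_ : (fun x => _) = fun x => (if P i then F i x else (1 : R^o)) * \prod_(j <- r | P j) F j x).
  by apply: Ck_mul => //; case: (boolP (P i)) => [/H //|_]; exact: Ck_cst.
by apply/funext => x; rewrite big_cons; case: ifP => // _; rewrite mul1r.
Qed.

(** The derivative -f^-2 Df involves 1/f only to order k, where the induction hypothesis applies. *)
Lemma Ck_inv k A f : open A -> (forall x, A x -> f x != 0) -> Ck k A f ->
  Ck k A (fun x => (f x)^-1 : R^o).
Proof.
move=> oA f0; elim: k => [|k IH].
  by move=> cf x Ax; apply: continuousV; [exact: f0|exact: cf].
move=> Hf; have [df Df] := Hf; split=> [x Ax|v].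
  by apply: (@differentiableV _ _ f); [exact: df|exact: f0].
have H1 := IH (Ck_pred Hf).
have H2 := Ck_mul oA (Ck_cst k A (-1 : R^o)) (Ck_mul oA (Ck_mul oA H1 H1) (Df v)).
apply: Ck_eq H2 => // x Ax.
rewrite (@deriveV _ _ f) ?f0//; last by apply: diff_derivable; exact: df.
by rewrite mulN1r scaleNr -exprVn expr2.
Qed.

End Scalar.

(** * Matrix-valued C^k maps, entry by entry *)

Section Matrix.
Context {R : realType} {V : normedModType R}.
Implicit Types A : set V.

Lemma differentiable_mx m n (F : V -> 'M[R]_(m, n)) x :
  (forall i j, differentiable (fun y => F y i j : R^o) x) -> differentiable F x.
Proof.
move=> H.
have -> : F = \sum_i \sum_j (fun y => (F y i j : R) *: delta_mx i j).
  apply/funext => y; rewrite [LHS]matrix_sum_delta fct_sumE.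
  by apply: eq_bigr => i _; rewrite fct_sumE.
apply: differentiable_sum => i; apply: differentiable_sum => j.
exact: differentiableZl (H i j).
Qed.

Lemma differentiable_entry m n (F : V -> 'M[R]_(m, n)) x i j :
  differentiable F x -> differentiable (fun y => F y i j : R^o) x.
Proof.
move=> dF; apply: (@differentiable_comp _ _ _ _ F (fun M : 'M[R]_(m, n) => M i j : R^o)) => //.
exact: differentiable_coord.
Qed.

Lemma derive_entry m n (F : V -> 'M[R]_(m, n)) x v i j : derivable F x v ->
  ('D_v F x) i j = 'D_v (fun y => F y i j : R^o) x.
Proof. by move=> dF; rewrite derive_mx// mxE. Qed.

Lemma continuous_mx (T : topologicalType) m n (F : T -> 'M[R]_(m, n)) x :
  (forall i j, {for x, continuous (fun y => F y i j : R^o)}) ->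
  {for x, continuous F}.
Proof.
move=> H; apply/cvgrPdist_le => /= e e0; near=> y.
rewrite /Num.Def.normr/= mx_normrE (bigmax_le _ (ltW e0))//= => -[i j] _.
rewrite !mxE/=; move: i j; near: y.
apply: filter_forall => i; apply: filter_forall => j /=.
by have /cvgrPdist_le := H i j; exact.
Unshelve. all: by end_near. Qed.

Lemma continuous_entry (T : topologicalType) m n (F : T -> 'M[R]_(m, n)) x i j :
  {for x, continuous F} -> {for x, continuous (fun y => F y i j : R^o)}.
Proof.
move=> cF; apply: (@continuous_comp _ _ _ F (fun M : 'M[R]_(m, n) => M i j : R^o)) => //; exact: coord_continuous.
Qed.

Lemma Ck_mx k m n A (F : V -> 'M[R]_(m, n)) : open A ->
  (forall i j, Ck k A (fun x => F x i j : R^o)) -> Ck k A F.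
Proof.
move=> oA; elim: k F => [|k IH] F H.
  by move=> x Ax; apply: continuous_mx => i j; exact: H.
have dF x : A x -> differentiable F x.
  by move=> Ax; apply: differentiable_mx => i j; have [df _] := H i j; exact: df.
split=> // v; apply: IH => i j; have [_ Df] := H i j.
apply: Ck_eq (Df v) => // x Ax.
by rewrite derive_entry//; apply: diff_derivable; exact: dF.
Qed.

Lemma Ck_entry k m n A (F : V -> 'M[R]_(m, n)) i j : open A ->
  Ck k A F -> Ck k A (fun x => F x i j : R^o).
Proof.
move=> oA; elim: k F => [|k IH] F.
  by move=> cF x Ax; apply: continuous_entry; exact: cF.
move=> [dF DF]; split=> [x Ax|v]; first by apply: differentiable_entry; exact: dF.
apply: Ck_eq (IH _ (DF v)) => // x Ax.
by rewrite derive_entry//; apply: diff_derivable; exact: dF.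
Qed.

Lemma Ck_mulmx k m n p A (F : V -> 'M[R]_(m, n)) (G : V -> 'M[R]_(n, p)) :
  open A -> Ck k A F -> Ck k A G -> Ck k A (fun x => F x *m G x).
Proof.
move=> oA HF HG; apply: Ck_mx => // i j.
rewrite (_ : (fun x => _) = fun x => \sum_l (F x i l * G x l j : R^o)).
  by apply: Ck_sum => // l _; apply: Ck_mul => //; exact: Ck_entry.
by apply/funext => x; rewrite mxE.
Qed.

Lemma smooth_on_mulmx m n p A (F : V -> 'M[R]_(m, n)) (G : V -> 'M[R]_(n, p)) :
  open A -> smooth_on A F -> smooth_on A G -> smooth_on A (fun x => F x *m G x).
Proof. by move=> oA sF sG k; apply: Ck_mulmx. Qed.

Lemma derive_mulmx m n p (F : V -> 'M[R]_(m, n)) (G : V -> 'M[R]_(n, p)) x v :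
  differentiable F x -> differentiable G x ->
  'D_v (fun y => F y *m G y) x = 'D_v F x *m G x + F x *m 'D_v G x.
Proof.
move=> dF dG; have dFe i j := @differentiable_entry _ _ F x i j dF.
have dGe i j := @differentiable_entry _ _ G x i j dG.
have dM i j l : differentiable (fun y => F y i l * G y l j : R^o) x.
  by apply: (@differentiableM _ _ (fun y => F y i l : R) (fun y => G y l j : R)).
have E i j : (fun y => (F y *m G y) i j : R^o) =
    \sum_(l < n) (fun y => F y i l * G y l j : R^o).
  by apply/funext => y; rewrite mxE fct_sumE.
have dFG : differentiable (fun y => F y *m G y) x.
  by apply: differentiable_mx => i j; rewrite E; apply: differentiable_sum => l.
apply/matrixP => i j; rewrite derive_entry; last exact: diff_derivable.
rewrite E derive_sum; last by move=> l; exact: diff_derivable.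
rewrite !mxE -big_split; apply: eq_bigr => l _ /=.
rewrite (@deriveM _ _ (fun y => F y i l : R) (fun y => G y l j : R)); try exact: diff_derivable.
rewrite !derive_entry; try exact: diff_derivable.
by rewrite addrC; congr (_ + _); exact: mulrC.
Qed.

Lemma differentiable_mulmx m n p (F : V -> 'M[R]_(m, n)) (G : V -> 'M[R]_(n, p)) x :
  differentiable F x -> differentiable G x ->
  differentiable (fun y => F y *m G y) x.
Proof.
move=> dF dG; apply: differentiable_mx => i j.
rewrite (_ : (fun y => _) = \sum_(l < n) (fun y => F y i l * G y l j : R^o)).
  apply: differentiable_sum => l.
  by apply: (@differentiableM _ _ (fun y => F y i l : R) (fun y => G y l j : R));
    exact: differentiable_entry.
by apply/funext => y; rewrite mxE fct_sumE.
Qed.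

Lemma Ck_det k n A (F : V -> 'M[R]_n) : open A -> Ck k A F ->
  Ck k A (fun x => \det (F x) : R^o).
Proof.
move=> oA HF; apply: Ck_sum => // s _; apply: Ck_mul => //; first exact: Ck_cst.
by apply: Ck_prod => // i _; exact: Ck_entry.
Qed.

(** Cramer's rule: the entries of the inverse are cofactors divided by the determinant. *)
Lemma Ck_invmx k n A (F : V -> 'M[R]_n) : open A ->
  (forall x, A x -> F x \in unitmx) -> Ck k A F -> Ck k A (fun x => invmx (F x)).
Proof.
move=> oA uF HF; apply: Ck_mx => // i j.
have H1 : Ck k A (fun x => (\det (F x))^-1 : R^o).
  apply: Ck_inv => //; last exact: Ck_det.
  by move=> x /uF; rewrite unitmxE unitfE.
have H2 : Ck k A (fun x => cofactor (F x) j i : R^o).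
  apply: Ck_mul => //; first exact: Ck_cst.
  apply: Ck_det => //; apply: Ck_mx => // a b.
  rewrite (_ : (fun x => _) = fun x => F x (lift j a) (lift i b)); first exact: Ck_entry.
  by apply/funext => x; rewrite !mxE.
apply: Ck_eq (Ck_mul oA H1 H2) => // x Ax.
by rewrite /invmx uF// !mxE.
Qed.

Lemma smooth_on_invmx n A (F : V -> 'M[R]_n) : open A ->
  (forall x, A x -> F x \in unitmx) -> smooth_on A F ->
  smooth_on A (fun x => invmx (F x)).
Proof. by move=> oA uF sF k; apply: Ck_invmx. Qed.

End Matrix.

(** * Chain rule and Jacobian matrices *)

Section Chain.
Context {R : realType} {V : normedModType R} {n : nat}.
Implicit Types A : set V.

Lemma cV_sum_delta (v : 'cV[R]_n) : v = \sum_i v i 0 *: delta_mx i 0.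
Proof.
rewrite [LHS]matrix_sum_delta; apply: eq_bigr => i _.
by rewrite big_ord_recl big_ord0 addr0.
Qed.

Lemma derive_delta (W : normedModType R) (g : 'cV[R]_n -> W) y v :
  differentiable g y ->
  'D_v g y = \sum_i v i 0 *: 'D_(delta_mx i 0) g y.
Proof.
move=> dg; rewrite deriveE// {1}[v]cV_sum_delta raddf_sum /=.
by apply: eq_bigr => i _; rewrite linearZ_LR deriveE.
Qed.

Lemma derive_comp (W : normedModType R) (f : V -> 'cV[R]_n) (g : 'cV[R]_n -> W) x v :
  differentiable f x -> differentiable g (f x) ->
  'D_v (g \o f) x = 'D_('D_v f x) g (f x).
Proof.
move=> df dg; rewrite !deriveE//; last exact: differentiable_comp.
by rewrite diff_comp.
Qed.

(** Induction on the order, for all outer maps at once: the derivative is the sum over i of (D_v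
    f)_i times the i-th partial derivative of [g] composed with [f], and the induction hypothesis is
    applied to these partial derivatives, with [f] demoted by one order. *)
Lemma Ck_comp_scal k A (B : set 'cV[R]_n) (f : V -> 'cV[R]_n) (g : 'cV[R]_n -> R^o) :
  open A -> (forall x, A x -> B (f x)) -> Ck k A f -> Ck k B g ->
  Ck k A (g \o f).
Proof.
move=> oA AB; elim: k g => [|k IH] g.
  move=> cf cg x Ax; apply: continuous_comp; first exact: cf.
  by apply: cg; exact: AB.
move=> Hf [dg Dg]; have [df Df] := Hf; split=> [x Ax|v].
  by apply: differentiable_comp; [exact: df|apply: dg; exact: AB].
have H : Ck k A (fun x => \sum_i (('D_v f x) i 0 * ('D_(delta_mx i 0) g \o f) x : R^o)).
  apply: Ck_sum => // i _; apply: Ck_mul => //; first by apply: Ck_entry => //; exact: Df.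
  by apply: IH; [exact: Ck_pred|exact: Dg].
apply: Ck_eq H => // x Ax.
rewrite derive_comp; [|exact: df|by apply: dg; exact: AB].
by rewrite [RHS]derive_delta//; apply: dg; exact: AB.
Qed.

Lemma Ck_comp k p q A (B : set 'cV[R]_n) (f : V -> 'cV[R]_n) (g : 'cV[R]_n -> 'M[R]_(p, q)) :
  open A -> open B -> (forall x, A x -> B (f x)) -> Ck k A f -> Ck k B g ->
  Ck k A (g \o f).
Proof.
move=> oA oB AB Hf Hg; apply: Ck_mx => // i j.
by apply: (@Ck_comp_scal k A B f (fun y => g y i j : R^o)) => //; exact: Ck_entry.
Qed.

Lemma smooth_on_comp p q A (B : set 'cV[R]_n) (f : V -> 'cV[R]_n) (g : 'cV[R]_n -> 'M[R]_(p, q)) :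
  open A -> open B -> (forall x, A x -> B (f x)) -> smooth_on A f -> smooth_on B g ->
  smooth_on A (g \o f).
Proof. by move=> oA oB AB sf sg k; apply: (Ck_comp oA oB). Qed.

End Chain.

Section Jac.
Context {R : realType}.

Lemma derive_jac m n (f : 'cV[R]_n -> 'cV[R]_m) x v :
  differentiable f x -> 'D_v f x = jac f x *m v.
Proof.
move=> df; rewrite derive_delta//; apply/colP => i; rewrite summxE mxE.
by apply: eq_bigr => j _; rewrite !mxE mulrC.
Qed.

Lemma jac_eqP m n (f : 'cV[R]_n -> 'cV[R]_m) x (M : 'M[R]_(m, n)) :
  (forall v, 'D_v f x = M *m v) -> jac f x = M.
Proof.
move=> H; apply/matrixP => i j; rewrite mxE H -(colE j M) mxE //.
Qed.

Lemma jac_comp l m n (f : 'cV[R]_n -> 'cV[R]_m) (g : 'cV[R]_m -> 'cV[R]_l) x :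
  differentiable f x -> differentiable g (f x) ->
  jac (g \o f) x = jac g (f x) *m jac f x.
Proof.
move=> df dg; apply: jac_eqP => v.
by rewrite derive_comp// !derive_jac// mulmxA.
Qed.

Lemma jac_id n (x : 'cV[R]_n) : jac id x = 1%:M.
Proof. by apply: jac_eqP => v; rewrite derive_id mul1mx. Qed.

Lemma near_eq_jac m n (f g : 'cV[R]_n -> 'cV[R]_m) x :
  (\near x, f x = g x) -> jac f x = jac g x.
Proof.
by move=> fg; apply/matrixP => i j; rewrite !mxE (near_eq_derive _ fg).
Qed.

Lemma smooth_on_jac m n (f : 'cV[R]_n -> 'cV[R]_m) A : open A ->
  smooth_on A f -> smooth_on A (jac f).
Proof.
move=> oA sf k; apply: Ck_mx => // i j.
rewrite (_ : (fun x => _) = fun x => ('D_(delta_mx j 0) f x) i 0).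
  by apply: Ck_entry => //; exact: smooth_on_derive.
by apply/funext => x; rewrite mxE.
Qed.

End Jac.

(** * Mean value inequalities and symmetry of second derivatives *)

Section MatrixNorm.
Context {R : realType}.

Lemma mx_norm_entry m n (M : 'M[R]_(m, n)) i j : `|M i j| <= `|M|.
Proof.
rewrite [leRHS]/Num.Def.normr/= mx_normrE.
exact: (le_bigmax _ (fun ij => `|M ij.1 ij.2|) (i, j)).
Qed.

Lemma mx_norm_le m n (M : 'M[R]_(m, n)) e : 0 <= e ->
  (forall i j, `|M i j| <= e) -> `|M| <= e.
Proof.
move=> e0 H; rewrite [leLHS]/Num.Def.normr/= mx_normrE.
by apply: bigmax_le => // -[i j] _; exact: H.
Qed.

Lemma mx_norm_mulmx m n p (A : 'M[R]_(m, n)) (B : 'M[R]_(n, p)) :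
  `|A *m B| <= n%:R * (`|A| * `|B|).
Proof.
apply: mx_norm_le => [|i j]; first by rewrite !mulr_ge0.
rewrite mxE (le_trans (ler_norm_sum _ _ _))//.
have -> : n%:R * (`|A| * `|B|) = \sum_(l < n) `|A| * `|B|.
  by rewrite sumr_const card_ord mulr_natl.
by apply: ler_sum => l _; rewrite normrM ler_pM// mx_norm_entry.
Qed.

Lemma near_normP (V : normedModType R) (x : V) (P : V -> Prop) :
  (\forall y \near x, P y) ->
  exists2 r : R, 0 < r & forall y, `|y - x| < r -> P y.
Proof.
move=> /nbhs_normP[r /= r0 H]; exists r => // y yx.
by apply: H; rewrite /ball_/= distrC.
Qed.

Lemma norm_near (V : normedModType R) (x : V) (r : R) : 0 < r ->
  \forall y \near x, `|y - x| < r.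
Proof.
by move=> r0; apply/nbhs_normP; exists r => // y; rewrite /ball_/= distrC.
Qed.

Lemma dist_lt_add (V : normedModType R) (a b c : V) (e : R) :
  `|a - c| < e -> `|b - c| < e -> `|a - b| < e + e.
Proof.
move=> ac bc; rewrite -(subrKA c) (le_lt_trans (ler_normD _ _))// ltrD//.
by rewrite distrC.
Qed.

Lemma open_norm_ball (V : normedModType R) (x : V) (r : R) :
  open [set y | `|y - x| < r].
Proof.
rewrite openE => y /= yx; apply/nbhs_normP; exists (r - `|y - x|) => /=.
  by rewrite subr_gt0.
move=> z; rewrite /ball_/= => yz.
rewrite (_ : z - x = (z - y) + (y - x)); last by rewrite addrA subrK.
by rewrite (le_lt_trans (ler_normD _ _))// -ltrBrDr distrC.
Qed.

Lemma closed_norm_ball (V : normedModType R) (x : V) (r : R) :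
  closed [set y | `|y - x| <= r].
Proof.
have -> : [set y | `|y - x| <= r] = (fun y => `|y - x|) @^-1` [set t | t <= r] by [].
apply: closed_comp => [y _|]; last exact: closed_le.
apply: (@continuous_comp _ _ _ (fun y => y - x) (@Num.norm _ _)); last exact: norm_continuous.
by apply: continuousB => //; exact: cst_continuous.
Qed.

Lemma segment_ball n (x0 x y : 'cV[R]_n) (r s : R) : `|x - x0| < r -> `|y - x0| < r ->
  0 <= s <= 1 -> `|x + s *: (y - x) - x0| < r.
Proof.
move=> xr yr /andP[s0 s1].
have -> : x + s *: (y - x) - x0 = (1 - s) *: (x - x0) + s *: (y - x0).
  by apply/matrixP => i j; rewrite !mxE; ring.
rewrite (le_lt_trans (ler_normD _ _))// !normrZ !ger0_norm ?subr_ge0//.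
(* At s = 0 the strict inequality comes from the first term; for s > 0 it comes from the second. *)
have [->|sn0] := eqVneq s 0; first by rewrite mul0r addr0 subr0 mul1r.
have -> : r = (1 - s) * r + s * r by rewrite -mulrDl subrK mul1r.
apply: ler_ltD; first by apply: ler_wpM2l; [rewrite subr_ge0|exact: ltW].
by rewrite ltr_pM2l// lt_def sn0.
Qed.

End MatrixNorm.

(* Joins the norm and the completeness of matrices, as required by
   [banach_fixed_point]. *)
HB.instance Definition _ (R : realType) m n := Complete.on 'M[R]_(m, n).

Section MeanValue.
Context {R : realType}.

(** The norm is the largest absolute value of an entry, so the scalar mean value theorem on each
    entry loses no constant, although the intermediate points differ. *)
Lemma mean_value_mx m n (u du : R^o -> 'M[R]_(m, n)) (a b K : R) : a <= b ->
  (forall t, a <= t <= b -> is_derive t 1 u (du t)) ->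
  (forall t, a <= t <= b -> `|du t| <= K) -> `|u b - u a| <= K * (b - a).
Proof.
move=> ab Du HK.
have K0 : 0 <= K by apply: (le_trans _ (HK a _)); rewrite ?lexx.
apply: mx_norm_le => [|i j]; first by rewrite mulr_ge0// subr_ge0.
have De (t : R) : a <= t <= b -> is_derive (t : R^o) 1 (fun s => u s i j : R^o) (du t i j).
  move=> /Du [uD <-]; split; first by move/derivable_mxP : uD; exact.
  by rewrite derive_entry.
have cu : {within `[a, b], continuous (fun s => u s i j : R^o)}.
  by apply: derivable_within_continuous => t; rewrite in_itv/= => /De [].
have De' (t : R) : t \in `]a, b[ -> is_derive (t : R^o) 1 (fun s => u s i j : R^o) (du t i j).
  by rewrite in_itv/= => /andP[/ltW ta /ltW tb]; apply: De; rewrite ta.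
have [c + E] := @MVT_segment R (fun s => u s i j) (fun t => du t i j) a b ab De' cu.
rewrite in_itv/= => cab; rewrite !mxE E normrM [`|b - a|]ger0_norm ?subr_ge0//.
by rewrite ler_wpM2r ?subr_ge0// (le_trans (mx_norm_entry _ _ _))// HK.
Qed.

Lemma is_derive_line (V W : normedModType R) (f : V -> W) x k (s : R) :
  differentiable f (x + s *: k) ->
  is_derive (s : R^o) 1 (fun s : R^o => f (x + s *: k)) ('D_k f (x + s *: k)).
Proof.
move=> df.
have dl : is_diff (s : R^o) (fun s : R^o => x + s *: k) ( *:%R^~ k).
  rewrite (_ : (fun s => _) = (cst x) + ( *:%R^~ k)); last by apply/funext.
  rewrite -[X in is_diff _ _ X]add0r; exact: is_diffD.
have d2 : differentiable (f \o (fun s : R^o => x + s *: k)) (s : R^o).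
  by apply: differentiable_comp.
apply: DeriveDef; first by apply: diff_derivable.
rewrite deriveE// diff_comp//= diff_val deriveE//= scale1r //.
Qed.

Lemma mean_value_line (V : normedModType R) m n (f : V -> 'M[R]_(m, n)) x k K :
  (forall s, 0 <= s <= 1 -> differentiable f (x + s *: k)) ->
  (forall s, 0 <= s <= 1 -> `|'D_k f (x + s *: k)| <= K) ->
  `|f (x + k) - f x| <= K.
Proof.
move=> df HK.
have := @mean_value_mx _ _ (fun s => f (x + s *: k)) _ 0 1 K ler01
  (fun s Hs => is_derive_line (df s Hs)) HK.
by rewrite scale1r scale0r addr0 subr0 mulr1.
Qed.

(* The second difference of f along v and w is s^2 times a mixed derivative at
   an intermediate point, and it is symmetric in v and w. *)
Lemma second_difference (V : normedModType R) (f : V -> R^o) (A : set V) x v w (s : R) :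
  0 < s -> Ck 2 A f ->
  (forall a b, 0 <= a <= s -> 0 <= b <= s -> A (x + a *: v + b *: w)) ->
  exists a b, [/\ 0 <= a <= s, 0 <= b <= s &
    f (x + s *: v + s *: w) - f (x + s *: v) - f (x + s *: w) + f x =
    s ^+ 2 * 'D_w ('D_v f) (x + a *: v + b *: w)].
Proof.
move=> s0 [df Df] HA; have [dDf _] := Df v.
have s0' := ltW s0.
have A0 a : 0 <= a <= s -> A (x + a *: v).
  move=> Ha; have := HA a 0 Ha; rewrite scale0r addr0; apply.
  by rewrite lexx ltW.
(* The mean value theorem is applied to [phi] in the direction [v], then to D_v f in the direction
   [w]. *)
pose phi (a : R^o) : R^o := f (x + s *: w + a *: v) - f (x + a *: v).
have Dphi (a : R) : 0 <= a <= s ->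
    is_derive (a : R^o) 1 phi ('D_v f (x + s *: w + a *: v) - 'D_v f (x + a *: v)).
  move=> Ha; apply: is_deriveB; apply: is_derive_line; apply: df.
    by rewrite addrAC; apply: HA; rewrite // lexx ltW.
  exact: A0.
have oc (a : R) : a \in `]0, s[ -> 0 <= a <= s.
  by rewrite in_itv/= => /andP[/ltW -> /ltW ->].
have cphi : {within `[0, s], continuous phi}.
  by apply: derivable_within_continuous => a; rewrite in_itv/= => /Dphi [].
have [a Ha E1] := @MVT_segment R phi _ 0 s s0' (fun a Ha => Dphi a (oc a Ha)) cphi.
rewrite in_itv/= in Ha.
pose psi (b : R^o) : R^o := 'D_v f (x + a *: v + b *: w).
have Dpsi (b : R) : 0 <= b <= s ->
    is_derive (b : R^o) 1 psi ('D_w ('D_v f) (x + a *: v + b *: w)).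
  by move=> Hb; apply: is_derive_line; apply: dDf; exact: HA.
have cpsi : {within `[0, s], continuous psi}.
  by apply: derivable_within_continuous => b; rewrite in_itv/= => /Dpsi [].
have [b Hb E2] := @MVT_segment R psi _ 0 s s0' (fun b Hb => Dpsi b (oc b Hb)) cpsi.
rewrite in_itv/= in Hb.
exists a, b; split => //.
have -> : f (x + s *: v + s *: w) - f (x + s *: v) - f (x + s *: w) + f x = phi s - phi 0.
  rewrite /phi !scale0r !addr0 (addrAC x (s *: w)) opprB !addrA.
  by rewrite addrAC.
rewrite E1; move: E2; rewrite /psi scale0r addr0 => E2.
by rewrite (addrAC x (s *: w)) E2 subr0 expr2 -mulrA [LHS]mulrC.
Qed.

(** Suppose that the mixed derivatives differ by 2e in absolute value at [x]. Near [x] each of them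
    varies by less than e, yet the two expressions of one second difference make a value of the
    first equal to a value of the second at nearby points. *)
Lemma schwarz (V : normedModType R) (f : V -> R^o) (A : set V) x v w :
  open A -> smooth_on A f -> A x -> 'D_w ('D_v f) x = 'D_v ('D_w f) x.
Proof.
move=> oA sf Ax; apply/eqP; rewrite -subr_eq0 -normr_eq0; apply/negPn/negP => N.
have e0 : 0 < `|'D_w ('D_v f) x - 'D_v ('D_w f) x| / 2.
  by rewrite divr_gt0// lt_def N normr_ge0.
set e := _ / 2 in e0.
have c1 := smooth_on_continuous (smooth_on_derive w (smooth_on_derive v sf)) Ax.
have c2 := smooth_on_continuous (smooth_on_derive v (smooth_on_derive w sf)) Ax.
move/cvgrPdist_lt : c1 => /(_ _ e0) c1; move/cvgrPdist_lt : c2 => /(_ _ e0) c2.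
have [r r0 H] := near_normP (filterI (open_near oA Ax) (filterI c1 c2)).
(* The step [s] satisfies s(|v| + |w|) < r, which keeps both parallelograms inside the ball; the
   added 1 keeps [N0] positive when v = w = 0. *)
pose N0 : R := `|v| + `|w| + 1.
have N00 : 0 < N0 by rewrite /N0 ltr_wpDl// addr_ge0.
pose s := r / 2 / N0.
have s0 : 0 < s by rewrite !divr_gt0.
have B a b : 0 <= a <= s -> 0 <= b <= s -> `|x + a *: v + b *: w - x| < r.
  move=> /andP[a0 a1] /andP[b0 b1].
  rewrite -(addrA x) (addrC x) addrK (le_lt_trans (ler_normD _ _))// !normrZ !ger0_norm//.
  have : a * `|v| + b * `|w| <= s * N0.
    rewrite /N0 !mulrDr mulr1 -[leLHS]addr0 !lerD ?ler_wpM2r//; exact: ltW.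
  move=> /le_lt_trans; apply.
  by rewrite /s divfK ?gt_eqF// ltr_pdivrMr// ltr_pMr// ltr1n.
have [a [b [Ha Hb E1]]] := second_difference (x := x) (v := v) (w := w) s0 (sf 2%N)
   (fun a b Ha Hb => (H _ (B a b Ha Hb)).1).
have B' c d (Hc : 0 <= c <= s) (Hd : 0 <= d <= s) : `|x + c *: w + d *: v - x| < r.
  by rewrite (addrAC x); apply: B.
have [a' [b' [Ha' Hb' E2]]] := second_difference (x := x) (v := w) (w := v) s0 (sf 2%N)
   (fun c d Hc Hd => (H _ (B' c d Hc Hd)).1).
have : s ^+ 2 * 'D_w ('D_v f) (x + a *: v + b *: w) =
       s ^+ 2 * 'D_v ('D_w f) (x + a' *: w + b' *: v).
  apply: (etrans (esym E1)); apply: (etrans _ E2).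
  by rewrite [x + s *: v + s *: w]addrAC; congr (_ + _); exact: addrAC.
move/mulfI => /(_ _)/wrap[|E3]; first by rewrite expf_neq0// gt_eqF.
have [_ [/= + _]] := H _ (B a b Ha Hb); rewrite E3 => h1.
have [_ [_ /= h2]] := H _ (B' a' b' Ha' Hb').
have : `|'D_w ('D_v f) x - 'D_v ('D_w f) x| < e + e.
  exact: dist_lt_add h1 h2.
by rewrite -splitr ltxx.
Qed.

Lemma schwarz_mx (V : normedModType R) m n (f : V -> 'M[R]_(m, n)) (A : set V) x v w :
  open A -> smooth_on A f -> A x -> 'D_w ('D_v f) x = 'D_v ('D_w f) x.
Proof.
move=> oA sf Ax; apply/matrixP => i j.
have E (a b : V) : ('D_b ('D_a f) x) i j = 'D_b ('D_a (fun y => f y i j : R^o)) x.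
  rewrite derive_entry; last first.
    by apply: diff_derivable; apply: smooth_on_differentiable Ax; exact: smooth_on_derive.
  apply: near_eq_derive; apply: filterS (open_near oA Ax) => y Ay.
  by rewrite derive_entry//; apply/diff_derivable/(smooth_on_differentiable sf).
apply: (etrans (E v w)); apply: (etrans _ (esym (E w v))).
by apply: (schwarz v w oA _ Ax) => k; exact: Ck_entry.
Qed.

End MeanValue.

(** * Bounds in finite dimension and the contraction principle *)

Section FiniteDim.
Context {R : realType} {n : nat}.

Lemma linear_sum_delta (W : lmodType R) (L : 'cV[R]_n -> W) : linear L ->
  forall v, L v = \sum_i v i 0 *: L (delta_mx i 0).
Proof.
move=> lL v; pose L' : {linear 'cV[R]_n -> W} := HB.pack L (GRing.isLinear.Build _ _ _ _ L lL).
rewrite -[L]/(L' : _ -> _) [in LHS](cV_sum_delta v) raddf_sum.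
by apply: eq_bigr => i _; exact: linearZ.
Qed.

Lemma linear_norm_le (W : normedModType R) (L : 'cV[R]_n -> W) K : linear L ->
  0 <= K -> (forall i, `|L (delta_mx i 0)| <= K) -> forall v, `|L v| <= n%:R * K * `|v|.
Proof.
move=> lL K0 HK v; rewrite linear_sum_delta// (le_trans (ler_norm_sum _ _ _))//.
have -> : n%:R * K * `|v| = \sum_(l < n) `|v| * K.
  by rewrite sumr_const card_ord -[RHS]mulr_natl -mulrA [K * _]mulrC.
by apply: ler_sum => l _; rewrite normrZ ler_pM// mx_norm_entry.
Qed.

Lemma linear_norm_bound (W : normedModType R) (L : 'cV[R]_n -> W) : linear L ->
  exists2 K, 0 <= K & forall v, `|L v| <= K * `|v|.
Proof.
move=> lL; pose K := \sum_i `|L (delta_mx i 0)|.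
have K0 : 0 <= K by apply: sumr_ge0.
exists (n%:R * K); first by rewrite mulr_ge0.
apply: linear_norm_le => // i; rewrite /K (bigD1 i)//= lerDl.
by apply: sumr_ge0.
Qed.

(** This is how maps given by no formula are differentiated below: the solution of a flat system and
    a local inverse. Continuity of [L] is automatic in finite dimension. *)
Lemma differentiable_quadratic (W : normedModType R) (f : 'cV[R]_n -> W) x
    (L : 'cV[R]_n -> W) (C r : R) : linear L -> 0 <= C -> 0 < r ->
  (forall k, `|k| < r -> `|f (x + k) - f x - L k| <= C * `|k| ^+ 2) ->
  differentiable f x /\ forall k, 'D_k f x = L k.
Proof.
move=> lL C0 r0 H.
pose L' : {linear 'cV[R]_n -> W} := HB.pack L (GRing.isLinear.Build _ _ _ _ L lL).
have [K K0 HK] := linear_norm_bound lL.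
have n1 : \forall h \near (0 : 'cV[R]_n), `|h| <= 1.
  by apply: filterS (norm_near (0 : 'cV[R]_n) ltr01) => h; rewrite subr0 => /ltW.
have cL : continuous L'.
  apply: bounded_linear_continuous; exists K; split; first exact: num_real.
  move=> y Ky; near=> h; apply: (le_trans (HK h)); rewrite (le_trans _ (ltW Ky))//.
  apply: ler_piMr => //; near: h.
have [|df dE] := @differentiable_eps _ _ _ f x L' cL.
  (* For |h| < e / (C + 1) one has C |h|^2 <= e |h|; adding 1 allows C = 0. *)
  move=> e e0; have C1 : 0 < C + 1 by rewrite ltr_wpDl.
  have near_lt (d : R) : 0 < d -> \forall h \near (0 : 'cV[R]_n), `|h| < d.
    by move=> d0; apply: filterS (norm_near (0 : 'cV[R]_n) d0) => h; rewrite subr0.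
  apply: filterS (filterI (near_lt _ r0) (near_lt _ (divr_gt0 e0 C1))) => h [hr he].
  rewrite [h + x]addrC; apply: (le_trans (H h hr)).
  rewrite expr2 mulrA; apply: ler_wpM2r => //.
  move: he; rewrite ltr_pdivlMr// => /ltW; apply: le_trans.
  by rewrite mulrC; apply: ler_wpM2l => //; rewrite lerDl.
by split => // k; rewrite deriveE// dE.
Unshelve. all: by end_near. Qed.

Lemma derive_linear (W : normedModType R) (f : 'cV[R]_n -> W) x :
  differentiable f x -> linear (fun v => 'D_v f x).
Proof. by move=> df a u v; rewrite !deriveE// linearP. Qed.

Lemma near_bounded (V : normedModType R) (I : finType) (W : normedModType R)
    (g : I -> V -> W) x : (forall i, {for x, continuous (g i)}) ->
  exists2 K : R, 0 <= K & \forall y \near x, forall i, `|g i y| <= K.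
Proof.
move=> cg; exists (\sum_i (`|g i x| + 1)); first by apply: sumr_ge0 => i _; rewrite addr_ge0.
apply: filter_forall => i.
have /cvgrPdist_lt/(_ _ ltr01) := cg i.
apply: filterS => y; rewrite (bigD1 i)//= => gy.
rewrite -[leLHS]addr0 lerD//; last by apply: sumr_ge0 => j _; rewrite addr_ge0.
rewrite -(subKr (g i x) (g i y)) (le_trans (ler_normB _ _))// lerD2l.
exact: ltW.
Qed.

Lemma smooth_bound p q (f : 'cV[R]_n -> 'M[R]_(p, q)) A x : open A ->
  smooth_on A f -> A x ->
  exists r K : R, [/\ 0 < r, 0 <= K & forall y, `|y - x| < r ->
    [/\ A y, `|f y| <= K, (forall v, `|'D_v f y| <= K * `|v|) &
        (forall v w, `|'D_v ('D_w f) y| <= K * `|v| * `|w|)]].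
Proof.
move=> oA sf Ax.
have [K0 K00 H0] := @near_bounded _ _ _ (fun _ : unit => f) x
  (fun=> smooth_on_continuous sf Ax).
have [K1 K10 H1] := @near_bounded _ _ _ (fun i : 'I_n => 'D_(delta_mx i 0) f) x
  (fun=> smooth_on_continuous (smooth_on_derive _ sf) Ax).
have [K2 K20 H2] := @near_bounded _ _ _
  (fun i : 'I_n * 'I_n => 'D_(delta_mx i.1 0) ('D_(delta_mx i.2 0) f)) x
  (fun=> smooth_on_continuous (smooth_on_derive _ (smooth_on_derive _ sf)) Ax).
have [r r0 H] := near_normP (filterI (open_near oA Ax) (filterI H0 (filterI H1 H2))).
have n0 : 0 <= n%:R :> R by [].
exists r, (K0 + n%:R * K1 + n%:R * (n%:R * K2)); split => //.
  by rewrite !addr_ge0 ?mulr_ge0.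
move=> y /H [Ay [h0 [h1 h2]]]; split => // [||v w].
- by rewrite (le_trans (h0 tt))// -addrA lerDl addr_ge0 ?mulr_ge0.
- move=> v; apply: le_trans (linear_norm_le (derive_linear (smooth_on_differentiable sf Ay)) K10 h1 v) _.
  by rewrite ler_wpM2r// addrAC lerDr addr_ge0 ?mulr_ge0.
- have hv i : `|'D_v ('D_(delta_mx i 0) f) y| <= n%:R * K2 * `|v|.
    apply: linear_norm_le => // [|j]; last exact: h2 (j, i).
    apply: derive_linear; apply: smooth_on_differentiable Ay.
    exact: smooth_on_derive.
  (* The symmetry of second derivatives moves [w] to the outer derivative, where linearity is that
     of a differential. *)
  have lin2 : linear (fun w => 'D_v ('D_w f) y).
    rewrite (_ : (fun w => _) = fun w => 'D_w ('D_v f) y); last first.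
      by apply/funext => u; exact: schwarz_mx oA sf Ay.
    apply: derive_linear; apply: smooth_on_differentiable Ay.
    exact: smooth_on_derive.
  apply: le_trans (linear_norm_le lin2 _ hv w) _; first by rewrite !mulr_ge0.
  rewrite (_ : n%:R * (n%:R * K2 * `|v|) = n%:R * (n%:R * K2) * `|v|); last by rewrite !mulrA.
  apply: ler_wpM2r => //; apply: ler_wpM2r => //.
  by rewrite lerDr addr_ge0 ?mulr_ge0.
Qed.

Lemma contraction_fixpoint (T : 'cV[R]_n -> 'cV[R]_n) x0 r : 0 <= r ->
  (forall x, `|x - x0| <= r -> `|T x - x0| <= r) ->
  (forall x y, `|x - x0| <= r -> `|y - x0| <= r -> `|T x - T y| <= 2^-1 * `|x - y|) ->
  exists2 x, `|x - x0| <= r & T x = x.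
Proof.
move=> r0 Tst Tct; pose U := [set x : 'cV[R]_n | `|x - x0| <= r].
have TU : {homo T : x / U x >-> U x} by move=> x; exact: Tst.
have cT : is_contraction (mkfun TU).
  have h : 0 <= 2^-1 :> R by [].
  exists (NngNum h); split; first by rewrite /= invf_lt1// ltr1n.
  by move=> [x y] [/= Ux Uy]; exact: Tct.
have clU : closed U by exact: closed_norm_ball.
have [|p Up pE] := banach_fixed_point cT clU; last by exists p.
by exists x0; rewrite /U /= subrr normr0.
Qed.

End FiniteDim.

(** * Linear differential equations *)

Section GeometricLimit.
Context {R : realType}.

Lemma geometric_small (C e : R) : 0 < e -> exists k, C / 2 ^+ k < e.
Proof.
move=> e0; exists (Num.Def.archi_bound (C / e)).
rewrite ltr_pdivrMr ?exprn_gt0// mulrC -ltr_pdivrMr//.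
exact: upper_nthrootP.
Qed.

Lemma geometric_eq0 (V : normedModType R) (x : V) (C : R) :
  (forall k, `|x| <= C / 2 ^+ k) -> x = 0.
Proof.
move=> H; apply/eqP; rewrite -normr_eq0; apply/negPn/negP => N.
have x0 : 0 < `|x| by rewrite lt_def N normr_ge0.
have [k] := geometric_small C x0.
by rewrite ltNge H.
Qed.

(** Keeping the distance to the k-th term, and not mere convergence, makes pointwise limits of
    functions uniform, since one [C] serves all points. *)
Lemma geometric_limit (V : completeNormedModType R) (a : nat -> V) (C : R) :
  (forall k, `|a k.+1 - a k| <= C / 2 ^+ k.+1) ->
  exists l, forall k, `|l - a k| <= C / 2 ^+ k.
Proof.
move=> H.
have tail m k : `|a (m + k)%N - a k| <= C / 2 ^+ k - C / 2 ^+ (m + k).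
  elim: m => [|m IH]; first by rewrite !subrr normr0.
  rewrite addSn -(subrKA (a (m + k)%N)) (le_trans (ler_normD _ _))//.
  rewrite (le_trans (lerD (H _) IH))// exprS invfM.
  have -> : 2^-1 = 1 - 2^-1 :> R by lra.
  by lra.
have C0 : 0 <= C.
  by have := le_trans (normr_ge0 _) (H 0%N); rewrite expr1; lra.
have tail' n k : (k <= n)%N -> `|a n - a k| <= C / 2 ^+ k.
  move=> /subnK <-; rewrite (le_trans (tail _ _))// gerBl.
  by rewrite divr_ge0// exprn_ge0.
have cva : cvgn a.
  apply/cauchy_cvgP; apply/cauchy_ballP => e e0; near_simpl.
  have [k ke] := geometric_small (C + C) e0.
  exists ([set n | (k <= n)%N], [set n | (k <= n)%N]); first by split; exists k.
  move=> [n m] [/= kn km]; rewrite -ball_normE /=.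
  rewrite (le_lt_trans _ ke)// -(subrKA (a k)) (le_trans (ler_normD _ _))//.
  by rewrite mulrDl lerD// ?tail'// distrC tail'.
exists (limn a) => k.
apply: (closed_cvg _ (@closed_norm_ball R _ (a k) (C / 2 ^+ k)) _ _ cva).
by exists k => // n /= kn; exact: tail'.
Qed.

End GeometricLimit.

(** * Antiderivatives of continuous matrix-valued functions *)

Section Antiderivative.
Context {R : realType}.

Lemma is_derive_derive1 (V : normedModType R) (G : R^o -> V) (x : R^o) d :
  derivable G x 1 -> derive1 G x = d -> is_derive x 1 G d.
Proof. by move=> dG <-; apply: DeriveDef => //; rewrite derive1E. Qed.

Lemma antiderivative (f : R^o -> R^o) : continuous f ->
  exists F : R^o -> R^o, F 0 = 0 /\ forall t : R^o, 0 <= t <= 1 -> is_derive t 1 F (f t).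
Proof.
move=> cf; pose mu := @lebesgue_measure R.
(* Integrating over [-1, 2] makes 0 and 1 interior points, so that the derivatives there are
   two-sided. *)
have fi : mu.-integrable `[-1, 2] (EFin \o f).
  apply: continuous_compact_integrable; first exact: segment_compact.
  exact: continuous_subspaceT.
pose F0 (x : R) : R := (\int[mu]_(t in [set` `[-1, x]]) (f t))%R.
have DF0 (x : R) : 0 <= x <= 1 -> is_derive (x : R^o) 1 (F0 : R^o -> R^o) (f x).
  move=> /andP[x0 x1].
  have x2 : x < 2 by lra.
  have x1' : -1 < x by lra.
  have [dF dFE] := @continuous_FTC1_closed R f (-1) x 2 x2 fi x1' (cf x).
  exact: is_derive_derive1 dF dFE.
exists (fun x => F0 x - F0 0); split; first by rewrite subrr.
move=> t Ht; rewrite -[f t]subr0.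
have := DF0 t Ht => DF0t.
by apply: (@is_deriveB _ _ _ F0 (cst (F0 0))).
Qed.

Lemma is_derive_mx m n (F dF : R^o -> 'M[R]_(m, n)) (t : R^o) :
  (forall i j, is_derive t 1 (fun s => F s i j : R^o) (dF t i j)) ->
  is_derive t 1 F (dF t).
Proof.
move=> H; have D : derivable F t 1 by apply/derivable_mxP => i j; have [] := H i j.
apply: DeriveDef => //; rewrite derive_mx//; apply/matrixP => i j; rewrite mxE.
by have [] := H i j.
Qed.

Lemma antiderivative_mx m n (f : R^o -> 'M[R]_(m, n)) : continuous f ->
  exists F : R^o -> 'M[R]_(m, n),
    F 0 = 0 /\ forall t : R^o, 0 <= t <= 1 -> is_derive t 1 F (f t).
Proof.
move=> cf.
have cfe i j : continuous (fun t => f t i j : R^o).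
  by move=> t; apply: continuous_entry; exact: cf.
have [F HF] := choice (fun ij : 'I_m * 'I_n => antiderivative (cfe ij.1 ij.2)).
exists (fun t => \matrix_(i, j) F (i, j) t); split.
  by apply/matrixP => i j; rewrite !mxE; have [] := HF (i, j).
move=> t Ht; apply: is_derive_mx => i j; have [_ /(_ t Ht)] := HF (i, j).
by rewrite (_ : (fun s => _) = F (i, j))//; apply/funext => s; rewrite mxE.
Qed.

End Antiderivative.

(** * Picard iteration for a linear equation on [0,1] *)

Section LinearODE.
Context {R : realType} {k m : nat}.
Implicit Types (u v w : R^o -> 'M[R]_(k, m)) (t : R^o).

(** The coefficient is controlled on [0,1] only. Precomposing with this retraction gives integrands
    continuous on the whole line, as [antiderivative] requires, and leaves them unchanged on
    [0,1]. *)
Let clamp t : R^o := Num.max 0 (Num.min 1 t).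

Lemma clamp_itv t : 0 <= clamp t <= 1.
Proof.
rewrite /clamp le_max lexx /= ge_max ler01 /=.
by rewrite ge_min lexx.
Qed.

Lemma clamp_id t : 0 <= t <= 1 -> clamp t = t.
Proof.
by move=> /andP[t0 t1]; rewrite /clamp (min_idPr t1) (max_idPr t0).
Qed.

Lemma clamp_continuous : continuous clamp.
Proof.
move=> t; apply: continuous_max; first exact: cst_continuous.
by apply: continuous_min => //; exact: cst_continuous.
Qed.

Variables (B : R^o -> 'M[R]_m) (u0 : 'M[R]_(k, m)).
Hypothesis cB : forall t, 0 <= t <= 1 -> {for t, continuous B}.
Hypothesis bB : forall t, 0 <= t <= 1 -> m%:R * `|B t| <= 2^-1.

Lemma norm_mulB (w : 'M[R]_(k, m)) t : 0 <= t <= 1 -> `|w *m B t| <= `|w| / 2.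
Proof.
move=> Ht; rewrite (le_trans (mx_norm_mulmx _ _))// mulrCA.
by apply: ler_wpM2l => //; exact: bB.
Qed.

(** One Picard step, as a relation. The integral [v] has two-sided derivatives at 0 and 1; its
    clamped copy [w'] may fail to, but is continuous and takes its values from [0,1], so estimates
    on [0,1] hold everywhere. *)
Let picard w w' := exists v, [/\ v 0 = u0,
  forall t, 0 <= t <= 1 -> is_derive t 1 v (w t *m B t) &
  forall t, w' t = v (clamp t)].

Lemma picard_ex w : continuous w -> exists2 w', continuous w' & picard w w'.
Proof.
move=> cw; pose f t := w (clamp t) *m B (clamp t).
have cf : continuous f.
  have cwc : Ck 0 setT (w \o clamp).
    move=> t _; apply: continuous_comp; first exact: clamp_continuous.
    exact: cw.
  have cBc : Ck 0 setT (B \o clamp).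
    move=> t _; apply: continuous_comp; first exact: clamp_continuous.
    by apply: cB; exact: clamp_itv.
  by move=> t; exact: (Ck_mulmx openT cwc cBc).
have [F [F0 DF]] := antiderivative_mx cf.
pose v t := u0 + F t.
have Dv t : 0 <= t <= 1 -> is_derive t 1 v (w t *m B t).
  move=> Ht; have := DF t Ht; rewrite /f clamp_id// => DFt.
  rewrite -[_ *m _]add0r.
  by apply: (@is_deriveD _ _ _ (cst u0) F).
exists (v \o clamp); last first.
  by exists v; split => //; rewrite /v F0 addr0.
move=> t; apply: continuous_comp; first exact: clamp_continuous.
have [+ _] := Dv _ (clamp_itv t).
by move=> /derivable1_diffP/differentiable_continuous.
Qed.

(** By [bB] the derivatives of the two integrals differ by at most D/2, and they are integrated over
    a length of at most 1. *)
Lemma picard_contract w1 w2 w1' w2' D : picard w1 w1' -> picard w2 w2' ->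
  (forall t, 0 <= t <= 1 -> `|w1 t - w2 t| <= D) ->
  forall t, `|w1' t - w2' t| <= D / 2.
Proof.
move=> [v1 [v10 Dv1 E1]] [v2 [v20 Dv2 E2]] HD t; rewrite E1 E2.
have D0 : 0 <= D by apply: (le_trans _ (HD 0 _)); rewrite ?lexx/=.
have /andP[c0 c1] := clamp_itv t.
have := @mean_value_mx R _ _ (fun s => v1 s - v2 s)
   (fun s => w1 s *m B s - w2 s *m B s) 0 (clamp t) (D / 2) c0.
rewrite v10 v20 subrr !subr0 => H.
apply: (le_trans (H _ _)); last by rewrite ler_piMr// divr_ge0.
- move=> s /andP[s0 s1].
  have Hs : 0 <= s <= 1 by rewrite s0 (le_trans s1).
  have := Dv1 s Hs; have := Dv2 s Hs => h1 h2.
  by apply: (@is_deriveB _ _ _ v1 v2).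
- move=> s /andP[s0 s1].
  have Hs : 0 <= s <= 1 by rewrite s0 (le_trans s1).
  rewrite -mulmxBl (le_trans (norm_mulB _ Hs))//.
  by apply: ler_wpM2r => //; exact: HD.
Qed.

Lemma linear_ode : exists u, u 0 = u0 /\
  forall t, 0 <= t <= 1 -> is_derive t 1 u (u t *m B t).
Proof.
(* Continuity is carried by the type, so that [choice] yields a step that can be iterated. *)
pose S := {w : R^o -> 'M[R]_(k, m) | continuous w}.
have step_ex (w : S) : exists w' : S, picard (sval w) (sval w').
  have [w' cw' Hw'] := picard_ex (svalP w).
  by exists (exist _ w' cw').
have [step Hstep] := choice step_ex.
pose W0 : S := exist _ (fun=> u0) (@cst_continuous _ _ u0).
pose W n : R^o -> _ := sval (iter n step W0).
have HW n : picard (W n) (W n.+1) by exact: Hstep.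
pose C := `|u0|.
have HC n t : `|W n.+1 t - W n t| <= C / 2 ^+ n.+1.
  elim: n t => [|n IH] t; last first.
    rewrite exprSr invfM mulrA.
    by apply: (picard_contract (HW n.+1) (HW n)) => s _; exact: IH.
  (* The constant [u0] is the Picard image of the zero function, which lies at distance [C] from it;
     the first difference is thus an instance of the contraction too. *)
  rewrite expr1; have P0 : picard (fun=> 0) (W 0%N).
    exists (fun=> u0); split => // s _; rewrite mul0mx.
    exact: is_derive_cst.
  by apply: (picard_contract (HW 0%N) P0) => s _; rewrite subr0.
have [w Hw] := choice (fun t => geometric_limit (fun n => HC n t)).
have cw : continuous w.
  move=> t; apply/cvgrPdist_lt => e e0.
  have e3 : 0 < e / 3 by rewrite divr_gt0.
  have [n ne] := geometric_small C e3.
  have /cvgrPdist_lt/(_ _ e3) := svalP (iter n step W0) t.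
  apply: filterS => s Hs.
  have := Hw t n; have := Hw s n; rewrite -/(W n) in Hs *.
  move=> h1 h2.
  have -> : w t - w s = (w t - W n t) + (W n t - W n s) + (W n s - w s).
    by rewrite !addrA !subrK.
  rewrite (le_lt_trans (ler_normD _ _))// (_ : e = e / 3 + e / 3 + e / 3); last by field.
  rewrite ltrD//; last by rewrite distrC (le_lt_trans h1).
  rewrite (le_lt_trans (ler_normD _ _))// ltrD// (le_lt_trans h2)//.
have [w' _ Pw'] := picard_ex cw.
(* The limit is a fixed point: both [w'] and [w] are within a constant times 2^-n of the iterate
   [W n.+1]. *)
have E t : w' t = w t.
  apply/eqP; rewrite -subr_eq0; apply/eqP/(@geometric_eq0 _ _ _ (C + C)) => n.
  have Cn : 0 <= C / 2 ^+ n by apply: divr_ge0; [exact: normr_ge0|exact: exprn_ge0].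
  rewrite -(subrKA (W n.+1 t)) (le_trans (ler_normD _ _))// mulrDl lerD//.
    by apply: (le_trans (picard_contract Pw' (HW n) (fun s _ => Hw s n) t)); lra.
  rewrite distrC; apply: (le_trans (Hw t n.+1)).
  by rewrite exprSr invfM mulrA; lra.
case: Pw' => v [v0 Dv Ev]; exists v; split => // t Ht.
by rewrite -{2}(clamp_id Ht) -Ev E; exact: Dv.
Qed.

End LinearODE.

(* The maximum of |w| on [0,1] is at most half of itself plus e. *)
Lemma gronwall_half (R : realType) k m (w dw : R^o -> 'M[R]_(k, m)) (e : R) :
  w 0 = 0 -> (forall t : R^o, 0 <= t <= 1 -> is_derive t 1 w (dw t)) ->
  (forall t, 0 <= t <= 1 -> `|dw t| <= `|w t| / 2 + e) ->
  forall t, 0 <= t <= 1 -> `|w t| <= 2 * e.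
Proof.
move=> w0 Dw Hw.
have cw : {within `[0, 1], continuous (fun t => `|w t|) : R -> R}.
  apply: continuous_in_subspaceT => t; rewrite inE/= in_itv/= => Ht.
  apply: (@continuous_comp _ _ _ w (@Num.norm _ _)); last exact: norm_continuous.
  have [+ _] := Dw _ Ht.
  by move=> /derivable1_diffP/differentiable_continuous.
have [c Hc Hmax] := EVT_max ler01 cw.
rewrite in_itv/= in Hc; have /andP[c0 c1] := Hc.
have HD t : 0 <= t <= c -> 0 <= t <= 1.
  by move=> /andP[-> tc]; rewrite (le_trans tc).
have K0 : 0 <= `|w c| / 2 + e.
  by apply: (le_trans (normr_ge0 _)); exact: Hw.
have := @mean_value_mx R _ _ w dw 0 c (`|w c| / 2 + e) c0
  (fun t Ht => Dw t (HD t Ht)).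
rewrite w0 !subr0 => H.
have {}H : `|w c| <= `|w c| / 2 + e.
  apply: (le_trans (H _)); last by rewrite ler_piMr.
  move=> t /HD Ht; rewrite (le_trans (Hw t Ht))// lerD2r ler_wpM2r//.
  by apply: Hmax; rewrite in_itv.
move=> t Ht; rewrite (le_trans (Hmax t _)) ?in_itv//.
lra.
Qed.

(** * Flat linear systems *)

Section CurveCalculus.
Context {R : realType}.

Lemma is_derive_mulmx m n p (F : R^o -> 'M[R]_(m, n)) (G : R^o -> 'M[R]_(n, p)) (t : R^o) dF dG :
  is_derive t 1 F dF -> is_derive t 1 G dG ->
  is_derive t 1 (fun s => F s *m G s) (dF *m G t + F t *m dG).
Proof.
move=> [/derivable1_diffP DF <-] [/derivable1_diffP DG <-].
apply: DeriveDef; last exact: derive_mulmx.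
by apply/derivable1_diffP; exact: differentiable_mulmx.
Qed.

Lemma is_derive_scale_id m n (F : R^o -> 'M[R]_(m, n)) (t : R^o) dF :
  is_derive t 1 F dF -> is_derive t 1 (fun s => (s : R) *: F s) (F t + (t : R) *: dF).
Proof.
move=> [DF <-].
apply: (@is_derive_mx _ _ _ _ (fun=> F t + (t : R) *: 'D_1 F t)) => i j.
have DFij : is_derive t 1 (fun s => F s i j : R^o) (('D_1 F t) i j).
  by split; [move/derivable_mxP : DF; exact | rewrite derive_entry].
have -> : (fun s => ((s : R) *: F s) i j : R^o) = (id : R^o -> R^o) * (fun s => F s i j : R^o).
  by apply/funext => s; rewrite mxE.
apply: is_derive_eq (is_deriveM _ DFij) _.
by rewrite !mxE /= addrC; congr (_ + _); rewrite /GRing.scale/= mulr1.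
Qed.

(** The mean value inequality is used twice along the segment; the factor 1/2 of Taylor's formula is
    given up. *)
Lemma taylor2 (V : normedModType R) m n (f : V -> 'M[R]_(m, n)) A p k K : open A ->
  smooth_on A f -> (forall s, 0 <= s <= 1 -> A (p + s *: k)) ->
  (forall s, 0 <= s <= 1 -> `|'D_k ('D_k f) (p + s *: k)| <= K) ->
  `|f (p + k) - f p - 'D_k f p| <= K.
Proof.
move=> oA sf HA HK.
have K0 : 0 <= K by apply: (le_trans _ (HK 0 _)); rewrite ?lexx/=.
have Dl (s : R^o) : 0 <= s <= 1 ->
    is_derive s 1 (fun s : R^o => f (p + s *: k) - (s : R) *: 'D_k f p)
      ('D_k f (p + s *: k) - 'D_k f p).
  move=> Hs; have h1 := is_derive_line (smooth_on_differentiable sf (HA s Hs)).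
  have h2 := is_derive_scale_id (is_derive_cst ('D_k f p) s 1).
  rewrite scaler0 addr0 in h2.
  exact: (@is_deriveB _ _ _ (fun s : R^o => f (p + s *: k)) (fun s : R^o => (s : R) *: 'D_k f p)).
have Dk (s : R^o) : 0 <= s <= 1 -> `|'D_k f (p + s *: k) - 'D_k f p| <= K.
  move=> /andP[s0 s1].
  have Hst t : 0 <= t <= s -> 0 <= t <= 1 by move=> /andP[-> ts]; rewrite (le_trans ts).
  have Dk2 (t : R^o) : 0 <= t <= s ->
      is_derive t 1 (fun t : R^o => 'D_k f (p + t *: k)) ('D_k ('D_k f) (p + t *: k)).
    move=> /Hst Ht; apply: is_derive_line; apply: smooth_on_differentiable (HA t Ht).
    exact: smooth_on_derive.
  have := mean_value_mx s0 Dk2 (fun t Ht => HK t (Hst t Ht)).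
  rewrite scale0r addr0 subr0 => /le_trans; apply.
  by rewrite ler_piMr.
have := mean_value_mx ler01 Dl Dk.
by rewrite !scale1r !scale0r addr0 !subr0 mulr1 addrAC.
Qed.

End CurveCalculus.

(** * Matrix-valued one-forms: derivatives and bounds linear in the direction *)

Section LinearParam.
Context {R : realType} {n p q : nat}.

(** Linearity in the argument is an identity on the open set [A], so it may be differentiated in the
    base point. *)
Lemma derive_linear_param (Om : 'cV[R]_n -> 'cV[R]_n -> 'M[R]_(p, q)) (A : set 'cV[R]_n)
    (k : 'cV[R]_n) : open A ->
  (forall x, A x -> linear (Om x)) -> (forall v, smooth_on A (Om^~ v)) ->
  forall x : 'cV[R]_n, A x -> linear (fun v => 'D_k (Om^~ v) x).
Proof.
move=> oA lO sO x Ax a u v.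
have Du : derivable (Om^~ u) x k.
  by apply: diff_derivable; exact: smooth_on_differentiable (sO u) Ax.
have Dv : derivable (Om^~ v) x k.
  by apply: diff_derivable; exact: smooth_on_differentiable (sO v) Ax.
have E : \near x, Om x (a *: u + v) = (a *: (Om^~ u) + Om^~ v) x.
  by apply: filterS (open_near oA Ax) => y Ay; rewrite lO.
apply: (etrans (near_eq_derive _ E)).
have [_ H] := @is_deriveD _ _ _ _ _ _ _ _ _
  (@is_deriveZ _ _ _ _ a _ _ _ (derivableP Du)) (derivableP Dv).
exact: H.
Qed.

Lemma near_forall (V : normedModType R) (I : finType) (x : V) (P : I -> V -> Prop) :
  (forall i, \forall y \near x, P i y) -> \forall y \near x, forall i, P i y.
Proof. by move=> H; apply: filter_forall => i; exact: H. Qed.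

Lemma linear_param_bound (Om : 'cV[R]_n -> 'cV[R]_n -> 'M[R]_(p, q)) (A : set 'cV[R]_n)
    (x0 : 'cV[R]_n) : open A -> A x0 ->
  (forall x, A x -> linear (Om x)) -> (forall v, smooth_on A (Om^~ v)) ->
  exists r K : R, [/\ 0 < r, 0 <= K & forall y, `|y - x0| < r ->
    [/\ A y, forall v, `|Om y v| <= K * `|v|,
        forall k v, `|'D_k (Om^~ v) y| <= K * `|k| * `|v| &
        forall k l v, `|'D_k ('D_l (Om^~ v)) y| <= K * `|k| * `|l| * `|v|]].
Proof.
move=> oA Ax0 lO sO.
have H (i : 'I_n) : exists rK : R * R, [/\ 0 < rK.1, 0 <= rK.2 & forall y, `|y - x0| < rK.1 ->
    [/\ A y, `|Om y (delta_mx i 0)| <= rK.2, (forall v, `|'D_v (Om^~ (delta_mx i 0)) y| <= rK.2 * `|v|) &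
        (forall v w, `|'D_v ('D_w (Om^~ (delta_mx i 0))) y| <= rK.2 * `|v| * `|w|)]].
  by have [r [K ?]] := smooth_bound oA (sO (delta_mx i 0)) Ax0; exists (r, K).
have [rK HrK] := choice H.
pose K := \sum_i (rK i).2.
have K0 : 0 <= K by apply: sumr_ge0 => i _; have [] := HrK i.
have leK i : (rK i).2 <= K.
  rewrite /K (bigD1 i)//= lerDl; apply: sumr_ge0 => j _; by have [] := HrK j.
have near_all : \forall y \near x0, A y /\ forall i : 'I_n, `|y - x0| < (rK i).1.
  apply: filterI; first exact: (open_near oA Ax0).
  apply: (near_forall (P := fun (i : 'I_n) y => `|y - x0| < (rK i).1)) => i.
  by apply: norm_near; have [] := HrK i.
have [r r0 Hr] := near_normP near_all.
exists r, (n%:R * K); split => //; first by rewrite mulr_ge0.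
move=> y /Hr[Ay Hy]; split => // [v|k v|k l v].
- apply: linear_norm_le => //; first exact: lO.
  by move=> i; have [_ _ /(_ y (Hy i))[_ + _ _]] := HrK i; move=> /le_trans; exact.
- rewrite -[n%:R * K * `|k|]mulrA.
  apply: (@linear_norm_le _ _ _ (fun v => 'D_k (Om^~ v) y)).
    exact: (@derive_linear_param Om A k oA lO sO y Ay).
    by rewrite mulr_ge0.
  move=> i; have [_ _ /(_ y (Hy i))[_ _ + _]] := HrK i; move=> /(_ k)/le_trans; apply.
  exact: ler_wpM2r.
- have -> : n%:R * K * `|k| * `|l| = n%:R * (K * `|k| * `|l|) by rewrite !mulrA.
  apply: (@linear_norm_le _ _ _ (fun v => 'D_k ('D_l (Om^~ v)) y)).
  + apply: (@derive_linear_param (fun y v => 'D_l (Om^~ v) y) A k oA _ _ y Ay).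
      exact: (@derive_linear_param Om A l oA lO sO).
    by move=> u; exact: smooth_on_derive.
  + by rewrite !mulr_ge0.
  + move=> i; have [_ _ /(_ y (Hy i))[_ _ _ +]] := HrK i; move=> /(_ k l)/le_trans; apply.
    by apply: ler_wpM2r => //; exact: ler_wpM2r.
Qed.

End LinearParam.

(* The value at x0 + h of the solution is obtained by integrating along the
   segment from x0, as u_h(1) with u_h' = u_h (Om (x0 + t h) h).  By flatness,
   w = u_(h+k) - u_h - t u_h (Om (x0 + t h) k) satisfies w' = w X + O(|k|^2) with
   X small, so that w(1) = O(|k|^2): no regularity of u_h in h is needed. *)
Section FlatSystem.
Context {R : realType} {n k m : nat}.
Variables (Om : 'cV[R]_n -> 'cV[R]_n -> 'M[R]_m) (A : set 'cV[R]_n).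
Variables (x0 : 'cV[R]_n) (Z0 : 'M[R]_(k, m)).
Hypotheses (oA : open A) (Ax0 : A x0).
Hypothesis lO : forall x, A x -> linear (Om x).
Hypothesis sO : forall v, smooth_on A (Om^~ v).
Hypothesis flat : forall x v w, A x ->
  'D_w (Om^~ v) x - 'D_v (Om^~ w) x + (Om x w *m Om x v - Om x v *m Om x w) = 0.
Variables (r K : R).
Hypotheses (r0 : 0 < r) (r1 : r <= 1) (K0 : 0 <= K) (mKr : m%:R * (K * r) <= 2^-1).
Hypothesis HK : forall y, `|y - x0| < r ->
    [/\ A y, forall v, `|Om y v| <= K * `|v|,
        forall k v, `|'D_k (Om^~ v) y| <= K * `|k| * `|v| &
        forall k l v, `|'D_k ('D_l (Om^~ v)) y| <= K * `|k| * `|l| * `|v|].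

Let ray (h : 'cV[R]_n) (u : R^o -> 'M[R]_(k, m)) := u 0 = Z0 /\
  forall t : R^o, 0 <= t <= 1 -> is_derive t 1 u (u t *m Om (x0 + t *: h) h).

Lemma scaled_norm (h : 'cV[R]_n) (t : R) : 0 <= t <= 1 -> `|t *: h| <= `|h|.
Proof.
move=> /andP[t0 t1]; rewrite normrZ ger0_norm//; exact: ler_piMl.
Qed.

Lemma ray_ball h (t : R) : `|h| < r -> 0 <= t <= 1 -> `|x0 + t *: h - x0| < r.
Proof.
move=> hr Ht; rewrite addrAC subrr add0r; apply: le_lt_trans hr.
exact: scaled_norm.
Qed.

Lemma ray_coef_le h (t : R) : `|h| < r -> 0 <= t <= 1 ->
  m%:R * `|Om (x0 + t *: h) h| <= 2^-1.
Proof.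
move=> hr Ht; apply: le_trans mKr; apply: ler_wpM2l => //.
have [_ H _ _] := HK (ray_ball hr Ht); apply: (le_trans (H h)).
by apply: ler_wpM2l => //; exact: ltW.
Qed.

Lemma ray_ex h : `|h| < r -> exists u, ray h u.
Proof.
move=> hr; apply: linear_ode => t Ht; last exact: ray_coef_le.
have [At _ _ _] := HK (ray_ball hr Ht).
have := @is_derive_line _ _ _ (Om^~ h) x0 h t (smooth_on_differentiable (sO h) At).
by move=> [/derivable1_diffP/differentiable_continuous].
Qed.

(** Gronwall for u - Z0, which vanishes at 0: its derivative is at most |u|/2, hence at most |u -
    Z0|/2 + |Z0|/2. *)
Lemma ray_bound h u : `|h| < r -> ray h u ->
  forall t, 0 <= t <= 1 -> `|u t| <= 2 * `|Z0|.
Proof.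
move=> hr [u0 Du] t Ht.
have Dw (s : R^o) : 0 <= s <= 1 ->
    is_derive s 1 (fun s => u s - Z0) (u s *m Om (x0 + s *: h) h).
  move=> Hs; have := Du s Hs => DS; rewrite -[_ *m _]subr0.
  by apply: (@is_deriveB _ _ _ u (cst Z0)).
have := @gronwall_half R k m _ _ (`|Z0| / 2) _ Dw _ t Ht.
rewrite u0 subrr => /(_ erefl) H.
have {}H : `|u t - Z0| <= `|Z0|.
  rewrite -[leRHS](divfK (_ : 2 != 0 :> R))// mulrC; apply: H => s Hs.
  have le2 : `|u s *m Om (x0 + s *: h) h| <= `|u s| / 2.
    rewrite (le_trans (mx_norm_mulmx _ _))// mulrCA.
    by apply: ler_wpM2l => //; exact: ray_coef_le.
  apply: (le_trans le2); rewrite -mulrDl; apply: ler_wpM2r => //.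
  by rewrite -{1}(subrK Z0 (u s)); exact: ler_normD.
rewrite -(subrK Z0 (u t)) (le_trans (ler_normD _ _))//; lra.
Qed.

Lemma ray0 u : ray 0 u -> u 1 = Z0.
Proof.
move=> [u0 Du].
have Dw (s : R^o) : 0 <= s <= 1 -> is_derive s 1 (fun s => u s - Z0) 0.
  move=> Hs; have := Du s Hs.
  have -> : Om (x0 + s *: 0) 0 = 0.
    have Ay : A (x0 + s *: 0) by rewrite scaler0 addr0.
    by have := lO Ay (-1) 0 0; rewrite !scaleN1r oppr0 addr0 addNr.
  rewrite mulmx0 => DS; rewrite -[X in is_derive _ _ _ X]subr0.
  by apply: (@is_deriveB _ _ _ u (cst Z0)).
have := @gronwall_half R k m _ _ 0 _ Dw _ 1 _.
rewrite u0 subrr ler01 lexx mulr0 => /(_ erefl _ isT) H.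
apply/eqP; rewrite -subr_eq0 -normr_le0; apply: H => t _.
by rewrite normr0 addr0 divr_ge0.
Qed.

(** [L] is the bound of [ray_bound]. The two terms of [C] bound the contributions u rem and t u
    Om(l) Y to w' in [ray_quadratic], up to the factor |l|^2; each [m%:R] comes from
    [mx_norm_mulmx]. *)
Let L : R := 2 * `|Z0|.
Let C : R := m%:R * L * (2 * K) + m%:R * (m%:R * L * K) * (2 * K).

(** Both differences split into a change of base point from p to p + t l at fixed argument, and a
    term with argument [l]. The hypothesis [r1] enters as |h| <= 1. *)
Lemma ray_remainder h l (t : R) : `|h| < r -> `|h + l| < r -> 0 <= t <= 1 ->
  `|Om (x0 + t *: (h + l)) (h + l) - Om (x0 + t *: h) h - Om (x0 + t *: h) l
    - t *: 'D_l (Om^~ h) (x0 + t *: h)| <= 2 * K * `|l| ^+ 2 /\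
  `|Om (x0 + t *: (h + l)) (h + l) - Om (x0 + t *: h) h| <= 2 * K * `|l|.
Proof.
move=> hr hlr Ht; set p := x0 + t *: h.
have tl := scaled_norm l Ht.
have h1 : `|h| <= 1 by apply: (le_trans (ltW hr)).
have seg s : 0 <= s <= 1 -> `|p + s *: (t *: l) - x0| < r.
  move=> Hs; have -> : t *: l = x0 + t *: (h + l) - p.
    by apply/matrixP => i j; rewrite /p !mxE; ring.
  by apply: segment_ball => //; exact: ray_ball.
have E : x0 + t *: (h + l) = p + t *: l by rewrite scalerDr addrA.
have Ap := HK (seg 0 _); rewrite scale0r addr0 lexx ler01 in Ap.
have {Ap} [Ap bp _ _] := Ap isT.
have At1 : A (p + t *: l) by have := HK (seg 1 _); rewrite scale1r lexx ler01 => /(_ isT)[].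
have bt1 v : `|Om (p + t *: l) v| <= K * `|v|.
  by have := HK (seg 1 _); rewrite scale1r lexx ler01 => /(_ isT)[].
have linOmD : Om (p + t *: l) (h + l) = Om (p + t *: l) h + Om (p + t *: l) l.
  by have := lO At1 1 h l; rewrite !scale1r.
have diffO v : `|Om (p + t *: l) v - Om p v| <= K * `|l| * `|v|.
  apply: (@mean_value_line _ _ _ _ (Om^~ v)) => s Hs; have [As _ D1 _] := HK (seg s Hs).
    exact: smooth_on_differentiable (sO v) As.
  apply: (le_trans (D1 _ _)); apply: ler_wpM2r => //; exact: ler_wpM2l.
have tay : `|Om (p + t *: l) h - Om p h - t *: 'D_l (Om^~ h) p| <= K * `|l| ^+ 2.
  have -> : t *: 'D_l (Om^~ h) p = 'D_(t *: l) (Om^~ h) p.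
    by rewrite !deriveE ?linearZ//; exact: smooth_on_differentiable (sO h) Ap.
  apply: (@taylor2 _ _ _ _ (Om^~ h) A) => // s Hs; have [As _ _ D2] := HK (seg s Hs) => //.
  apply: (le_trans (D2 _ _ _)); rewrite -[leRHS]mulr1.
  apply: ler_pM => //; first by rewrite !mulr_ge0.
  by rewrite expr2 mulrA; apply: ler_pM => //; [rewrite mulr_ge0|exact: ler_wpM2l].
have kl : 0 <= K * `|l| by rewrite mulr_ge0.
rewrite E linOmD; split.
- have -> : Om (p + t *: l) h + Om (p + t *: l) l - Om p h - Om p l - t *: 'D_l (Om^~ h) p =
      (Om (p + t *: l) h - Om p h - t *: 'D_l (Om^~ h) p) + (Om (p + t *: l) l - Om p l).
    rewrite [in RHS]addrAC; congr (_ - _).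
    by rewrite -!addrA; congr (_ + _); rewrite addrCA.
  rewrite (le_trans (ler_normD _ _))//.
  have := diffO l; rewrite -mulrA -expr2; lra.
- rewrite addrAC (le_trans (ler_normD _ _))//.
  have := diffO h; have := bt1 l; have := ler_wpM2l kl h1; lra.
Qed.

Lemma ray_quadratic h l u v : `|h| < r -> `|h + l| < r -> ray h u -> ray (h + l) v ->
  `|v 1 - u 1 - u 1 *m Om (x0 + h) l| <= 2 * C * `|l| ^+ 2.
Proof.
move=> hr hlr Ru Rv; have [u0 Du] := Ru; have [v0 Dv] := Rv.
pose q t : 'M[R]_(k, m) := u t *m Om (x0 + t *: h) l.
pose w (t : R^o) := v t - u t - (t : R) *: q t.
pose dq (t : R) := u t *m Om (x0 + t *: h) h *m Om (x0 + t *: h) l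
  + u t *m 'D_h (Om^~ l) (x0 + t *: h).
pose dw (t : R) := v t *m Om (x0 + t *: (h + l)) (h + l)
  - u t *m Om (x0 + t *: h) h - (q t + t *: dq t).
have Dw (t : R^o) : 0 <= t <= 1 -> is_derive t 1 w (dw t).
  move=> Ht; have := Du t Ht; have := Dv t Ht => h1 h2.
  have [At _ _ _] := HK (ray_ball hr Ht).
  have h3 := is_derive_mulmx h2
    (@is_derive_line _ _ _ (Om^~ l) x0 h t (smooth_on_differentiable (sO l) At)).
  have h4 := is_derive_scale_id h3.
  exact: (@is_deriveB _ _ _ _ _ _ _ _ _ (@is_deriveB _ _ _ _ _ _ _ _ _ h1 h2) h4).
have w0 : w 0 = 0 by rewrite /w u0 v0 scale0r subr0 subrr.
have bw (t : R^o) : 0 <= t <= 1 -> `|dw t| <= `|w t| / 2 + C * `|l| ^+ 2.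
  move=> Ht; have /andP[t0 t1] := Ht.
  have [At bt _ _] := HK (ray_ball hr Ht).
  have [] := ray_remainder hr hlr Ht.
  set X := Om (x0 + t *: (h + l)) (h + l); set p := x0 + t *: h.
  set rem := X - _ - _ - _; set Y := X - _ => brem bY.
  have F := flat h l At; rewrite -/p in F.
  have -> : dw t = w t *m X + u t *m rem + t *: (u t *m Om p l *m Y).
    rewrite /dw /w /dq /q -/X -/p /rem /Y.
    (* Differentiating [q] along the ray produces the derivative of Om(l) in the direction h.
       Flatness exchanges it for the derivative of Om(h) in the direction l, the one subtracted in
       [rem], and a commutator that cancels the other terms of first order in l. *)
    have -> : 'D_h (Om^~ l) p = 'D_l (Om^~ h) p + (Om p l *m Om p h - Om p h *m Om p l).
      by apply/eqP; rewrite eq_sym -subr_eq0 addrAC; apply/eqP.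
    move: ('D_l _ p) => D.
    rewrite !(mulmxDr, mulmxDl, mulNmx, mulmxN) -!scalemxAl -!scalemxAr !mulmxA.
    rewrite !(scalerDr, scalerN).
    move: (v t *m X) (u t *m X) (u t *m Om p l *m X) (u t *m D) (u t *m Om p h)
      (u t *m Om p l) (u t *m Om p l *m Om p h) (u t *m Om p h *m Om p l) => a b c d e f g j.
    move: (t *: c) (t *: d) (t *: g) (t *: j) => c' d' g' j'.
    apply/matrixP => i i'; rewrite !mxE; ring.
  have bu := ray_bound hr Ru Ht; rewrite -/L in bu.
  have b1 : `|w t *m X| <= `|w t| / 2.
    rewrite (le_trans (mx_norm_mulmx _ _))// mulrCA.
    by apply: ler_wpM2l => //; exact: ray_coef_le.
  have b2 : `|u t *m rem| <= m%:R * L * (2 * K) * `|l| ^+ 2.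
    rewrite (le_trans (mx_norm_mulmx _ _))//.
    have -> : m%:R * L * (2 * K) * `|l| ^+ 2 = m%:R * (L * (2 * K * `|l| ^+ 2)) by ring.
    by apply: ler_wpM2l => //; exact: ler_pM.
  have b3 : `|u t *m Om p l| <= m%:R * L * K * `|l|.
    rewrite (le_trans (mx_norm_mulmx _ _))//.
    have -> : m%:R * L * K * `|l| = m%:R * (L * (K * `|l|)) by ring.
    by apply: ler_wpM2l => //; exact: ler_pM.
  have b4 : `|t *: (u t *m Om p l *m Y)| <= m%:R * (m%:R * L * K) * (2 * K) * `|l| ^+ 2.
    rewrite normrZ ger0_norm// (le_trans (ler_piMl _ t1))//.
    rewrite (le_trans (mx_norm_mulmx _ _))//.
    have -> : m%:R * (m%:R * L * K) * (2 * K) * `|l| ^+ 2 =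
      m%:R * ((m%:R * L * K * `|l|) * (2 * K * `|l|)) by ring.
    by apply: ler_wpM2l => //; exact: ler_pM.
  rewrite (le_trans (ler_normD _ _))// /C mulrDl addrA lerD//.
  by rewrite (le_trans (ler_normD _ _))// lerD.
have := gronwall_half w0 Dw bw (t := 1); rewrite lexx ler01 => /(_ isT).
by rewrite /w /q !scale1r mulrA.
Qed.

Lemma flat_system_ball : exists Z : 'cV[R]_n -> 'M[R]_(k, m),
  [/\ Z x0 = Z0, smooth_on [set x | `|x - x0| < r] Z &
      forall x v, `|x - x0| < r -> 'D_v Z x = Z x *m Om x v].
Proof.
have uex h : exists u, `|h| < r -> ray h u.
  have [hr|hr] := ltP `|h| r; last by exists (fun=> Z0).
  by have [u Hu] := ray_ex hr; exists u.
have [u Hu] := choice uex.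
pose Z x := u (x - x0) 1; exists Z.
have DZ x : `|x - x0| < r -> differentiable Z x /\ forall v, 'D_v Z x = Z x *m Om x v.
  move=> xr; have Ax : A x by have [] := HK xr.
  apply: (@differentiable_quadratic _ _ _ _ _ _ (2 * C) (r - `|x - x0|)).
  - by move=> a v w /=; rewrite lO// mulmxDr -scalemxAr.
  - by rewrite /C /L !(mulr_ge0, addr_ge0).
  - by rewrite subr_gt0.
  - move=> l lr; have E : x0 + (x - x0) = x by rewrite addrC subrK.
    have hl : `|x - x0 + l| < r.
      by rewrite (le_lt_trans (ler_normD _ _))// -ltrBrDl.
    have := ray_quadratic xr hl (Hu _ xr) (Hu _ hl); rewrite E.
    by rewrite /Z (addrAC x l).
split.
- by rewrite /Z subrr; apply: ray0; apply: Hu; rewrite normr0.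
(* Bootstrapping: if Z is C^j then so is its derivative Z Om(v), hence Z is C^(j+1). *)
- move=> j; elim: j => [|j IH].
    by move=> x /DZ[dZ _]; exact: differentiable_continuous.
  split=> [x /DZ[] //|v].
  apply: (@Ck_eq _ _ _ _ _ (fun x => Z x *m Om x v)).
  + exact: open_norm_ball.
  + by move=> x /DZ[_ ->].
  + apply: Ck_mulmx => //; first exact: open_norm_ball.
    by apply: Ck_sub (sO v j) => x /HK[].
- by move=> x v /DZ[_].
Qed.

End FlatSystem.

Theorem flat_system (R : realType) (n k m : nat) (Om : 'cV[R]_n -> 'cV[R]_n -> 'M[R]_m)
    (A : set 'cV[R]_n) x0 (Z0 : 'M[R]_(k, m)) : open A -> A x0 ->
  (forall x, A x -> linear (Om x)) -> (forall v, smooth_on A (Om^~ v)) ->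
  (forall x v w, A x ->
    'D_w (Om^~ v) x - 'D_v (Om^~ w) x + (Om x w *m Om x v - Om x v *m Om x w) = 0) ->
  exists (r : R) (Z : 'cV[R]_n -> 'M[R]_(k, m)),
  [/\ 0 < r, forall x, `|x - x0| < r -> A x, Z x0 = Z0,
      smooth_on [set x | `|x - x0| < r] Z &
      forall x v, `|x - x0| < r -> 'D_v Z x = Z x *m Om x v].
Proof.
move=> oA Ax0 lO sO flat.
have [r [K [r0 K0 HK]]] := linear_param_bound oA Ax0 lO sO.
(* A radius of at most 1/M gives m K s <= 1/2; the added 1 makes [M] positive when m K = 0. *)
pose M : R := 2 * (m%:R * K) + 1.
have M0 : 0 < M by rewrite /M ltr_wpDl// !mulr_ge0.
pose s := Num.min r (Num.min 1 M^-1).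
have s0 : 0 < s by rewrite !lt_min r0 ltr01 invr_gt0.
have sr : s <= r by rewrite ge_min lexx.
have s1 : s <= 1 by rewrite !ge_min lexx /= orbT.
have sM : s <= M^-1 by rewrite !ge_min lexx !orbT.
have mKs : m%:R * (K * s) <= 2^-1.
  have mK0 : 0 <= m%:R * K by rewrite mulr_ge0.
  rewrite mulrA (le_trans (ler_wpM2l mK0 sM))// ler_pdivrMr// /M; lra.
have HK' y : `|y - x0| < s -> _ := fun h => HK y (lt_le_trans h sr).
have [Z [Zx0 sZ DZ]] := flat_system_ball Z0 oA Ax0 lO sO flat s0 s1 K0 mKs HK'.
by exists s, Z; split => // x /HK'[].
Qed.

(** * The inverse function theorem *)

Lemma injective_unitmx (F : fieldType) n (M : 'M[F]_n) :
  (forall v : 'cV_n, M *m v = 0 -> v = 0) -> M \in unitmx.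
Proof.
move=> H; rewrite -unitmx_tr -row_free_unit -kermx_eq0; apply/eqP/row_matrixP => i.
rewrite row0; apply: trmx_inj; rewrite trmx0; apply: H.
have : row i (kermx M^T) *m M^T = 0.
  by apply/sub_kermxP; exact: row_sub.
by move/(congr1 trmx); rewrite trmx_mul trmxK trmx0.
Qed.

Section SmoothMore.
Context {R : realType} {V : normedModType R}.

Lemma differentiable_idfun (x : V) : differentiable id x.
Proof. by have [] := is_diff_id x. Qed.

Lemma Ck_id k (A : set V) : Ck k A id.
Proof.
case: k => [|k]; first by move=> x _; exact: cvg_id.
split=> [x _|v]; first exact: differentiable_idfun.
rewrite (_ : (fun x => _) = fun=> v); first exact: Ck_cst.
by apply/funext => x; exact: derive_id.
Qed.

Lemma smooth_on_id (A : set V) : smooth_on A id.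
Proof. by move=> k; exact: Ck_id. Qed.

Lemma derive_mulmx_const m n p (C : 'M[R]_(m, n)) (F : V -> 'M[R]_(n, p)) x v :
  differentiable F x -> 'D_v (fun y => C *m F y) x = C *m 'D_v F x.
Proof.
move=> dF.
apply: (etrans (@derive_mulmx R V _ _ _ (fun=> C) F x v (differentiable_cst C x) dF)).
by rewrite (_ : 'D_v (fun=> C) x = 0) ?mul0mx ?add0r//; exact: derive_cst.
Qed.

End SmoothMore.

Section InverseFunction.
Context {R : realType} {n : nat}.
Variables (h : 'cV[R]_n -> 'cV[R]_n) (A : set 'cV[R]_n) (x0 : 'cV[R]_n).
Hypotheses (oA : open A) (sh : smooth_on A h) (J : 'M[R]_n) (uJ : J \in unitmx).
(** The deviation of J^-1 h from the identity; by [Hr] and the mean value inequality it is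
    1/2-Lipschitz on the ball. *)
Let f x := invmx J *m h x - x.
Variable r : R.
Hypothesis Hr : forall x, `|x - x0| < r -> A x /\ forall v, `|'D_v f x| <= 2^-1 * `|v|.

Lemma displacement_derive x v : A x -> 'D_v f x = invmx J *m 'D_v h x - v.
Proof.
move=> Ax; have dh := smooth_on_differentiable sh Ax.
have dJ : differentiable (fun y => invmx J *m h y) x.
  by apply: differentiable_mulmx => //; exact: differentiable_cst.
have dJ' : derivable (fun y => invmx J *m h y) x v by exact: diff_derivable.
apply: (etrans (@deriveB _ _ _ (fun y => invmx J *m h y) id x v dJ' (@derivable_id _ _ x v))).
by rewrite derive_id derive_mulmx_const.
Qed.

Lemma displacement_differentiable x : A x -> differentiable f x.
Proof.
move=> Ax; have dh := smooth_on_differentiable sh Ax.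
apply: (@differentiableB _ _ _ (fun y => invmx J *m h y) id); last exact: differentiable_idfun.
by apply: differentiable_mulmx => //; exact: differentiable_cst.
Qed.

Lemma displacement_lipschitz x y : `|x - x0| < r -> `|y - x0| < r ->
  `|f y - f x| <= 2^-1 * `|y - x|.
Proof.
move=> xr yr; have -> : f y = f (x + (y - x)) by rewrite addrC subrK.
apply: mean_value_line => s Hs; have [As D] := Hr (segment_ball xr yr Hs).
  exact: displacement_differentiable.
exact: D.
Qed.

(** Since y - x = J^-1 (h y - h x) - (f y - f x), the last term is absorbed at the cost of a factor
    2. This gives injectivity of [h] and a Lipschitz bound for its inverse. *)
Lemma expansive x y : `|x - x0| < r -> `|y - x0| < r ->
  `|y - x| <= 2 * n%:R * `|invmx J| * `|h y - h x|.
Proof.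
move=> xr yr; have L := displacement_lipschitz xr yr.
have E : y - x = invmx J *m (h y - h x) - (f y - f x).
  by rewrite /f mulmxBr; apply/matrixP => i j; rewrite !mxE; ring.
have : `|y - x| <= `|invmx J *m (h y - h x)| + `|f y - f x|.
  by rewrite {1}E ler_normB.
have := mx_norm_mulmx (invmx J) (h y - h x); rewrite -!mulrA; lra.
Qed.

(** If D_v h = 0 then D_v f = -v, so that |v| <= |v|/2. *)
Lemma jac_unit x : `|x - x0| < r -> jac h x \in unitmx.
Proof.
move=> xr; have [Ax D] := Hr xr; apply: injective_unitmx => v.
rewrite -derive_jac; last exact: smooth_on_differentiable sh Ax.
move=> Dh; have := D v; rewrite displacement_derive// Dh mulmx0 sub0r normrN => H.
by apply/eqP; rewrite -normr_le0; lra.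
Qed.

(** The fixed points of T x = J^-1 y - f x are the solutions of h x = y. On the closed ball of
    radius [s] about [x1], T contracts by 1/2 and displaces the centre by J^-1 (y - h x1), at most
    s/2 when |y - h x1| < s/N; it therefore preserves that ball. *)
Lemma local_surjection x1 : `|x1 - x0| < r ->
  exists2 d : R, 0 < d & forall y, `|y - h x1| < d ->
    exists2 x, `|x - x0| < r & h x = y.
Proof.
move=> xr; pose s := (r - `|x1 - x0|) / 2.
have s0 : 0 < s by rewrite /s divr_gt0// subr_gt0.
pose N : R := 2 * (n%:R * `|invmx J|) + 1.
have N0 : 0 < N by rewrite /N ltr_wpDl// !mulr_ge0.
have inb x : `|x - x1| <= s -> `|x - x0| < r.
  move=> xs; rewrite -(subrKA x1) (le_lt_trans (ler_normD _ _))//.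
  by move: xs s0; rewrite /s; lra.
exists (s / N); first by rewrite divr_gt0.
move=> y yd; pose T x := invmx J *m y - f x.
have T1 x : T x - x1 = invmx J *m (y - h x1) - (f x - f x1).
  by rewrite /T /f mulmxBr; apply/matrixP => i j; rewrite !mxE; ring.
have [||x xs Tx] := @contraction_fixpoint R n T x1 s (ltW s0).
- move=> x xs; rewrite T1 (le_trans (ler_normB _ _))//.
  have := displacement_lipschitz xr (inb x xs).
  have : `|invmx J *m (y - h x1)| <= s / 2.
    rewrite (le_trans (mx_norm_mulmx _ _))// mulrA.
    rewrite ltr_pdivlMr// in yd.
    have : 0 <= `|y - h x1| by [].
    move: yd; rewrite /N; set a := `|y - _|; set b := n%:R * _; nra.
  by lra.
- move=> x x' xs xs'; rewrite /T.
  have -> : invmx J *m y - f x - (invmx J *m y - f x') = f x' - f x.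
    by move: (f x) (f x') => a b; apply/matrixP => i j; rewrite !mxE; ring.
  by rewrite [`|x - x'|]distrC; apply: displacement_lipschitz; exact: inb.
exists x; first exact: inb.
have : invmx J *m y = invmx J *m h x.
  by move: Tx; rewrite /T /f opprB addrCA => /eqP; rewrite -subr_eq0 addrAC subrr add0r subr_eq0 => /eqP.
by move/(congr1 (mulmx J)); rewrite !mulKVmx.
Qed.

Lemma inverse_function_ball : exists g : 'cV[R]_n -> 'cV[R]_n,
  let B := [set x | `|x - x0| < r] in
  [/\ open (h @` B), (forall x, B x -> g (h x) = x) & smooth_on (h @` B) g].
Proof.
have gex y : exists x, (h @` [set x | `|x - x0| < r]) y -> `|x - x0| < r /\ h x = y.
  have [[x xr <-]|N] := pselect ((h @` [set x | `|x - x0| < r]) y).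
    by exists x.
  by exists 0 => /N.
have [g Hg] := choice gex; exists g => B.
have oB : open B by exact: open_norm_ball.
have gK x : B x -> g (h x) = x.
  move=> Bx; have [gr gE] := Hg (h x) (ex_intro2 _ _ x Bx erefl).
  have := expansive Bx gr; rewrite gE subrr normr0 mulr0 normr_le0 subr_eq0.
  by move=> /eqP.
have ohB : open (h @` B).
  rewrite openE => _ [x1 Bx1 <-]; have [d d0 Hd] := local_surjection Bx1.
  apply: filterS (norm_near (h x1) d0) => y /Hd[x Bx <-].
  by exists x.
have gB y : (h @` B) y -> B (g y) by move=> /Hg[].
have hg y : (h @` B) y -> h (g y) = y by move=> /Hg[].
have Dg y : (h @` B) y -> differentiable g y /\
    forall v, 'D_v g y = invmx (jac h (g y)) *m v.
  move=> [x1 Bx1 <-]; rewrite gK//.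
  have [Ax1 _] := Hr Bx1; have ux1 := jac_unit Bx1.
  set G := invmx (jac h x1).
  have [r1 [K [r10 K0 HK]]] := smooth_bound oA sh Ax1.
  have [d d0 Hd] := local_surjection Bx1.
  pose N : R := 2 * n%:R * `|invmx J|.
  have N0 : 0 <= N by rewrite !mulr_ge0.
  have N1 : 0 < N + 1 by rewrite ltr_wpDl.
  (* The remainder of [g] at [h x1] is -G times the Taylor remainder of [h] at [x1], of order |x -
     x1|^2, and |x - x1| <= N |k| by [expansive]. The radius [d] puts h x1 + k in the image, and r1
     / (N + 1) puts x where the Taylor bound holds, the 1 covering N = 0. *)
  apply: (@differentiable_quadratic _ _ _ _ _ _ (n%:R * (`|G| * (K * N ^+ 2)))
     (Num.min d (r1 / (N + 1)))).
  - by move=> a v w /=; rewrite mulmxDr -scalemxAr.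
  - by rewrite !mulr_ge0// exprn_ge0.
  - by rewrite lt_min d0 divr_gt0.
  - move=> k; rewrite lt_min => /andP[kd kr].
    have [x Bx hx] : exists2 x, B x & h x = h x1 + k.
      by apply: Hd; rewrite addrAC subrr add0r.
    rewrite -hx !gK//.
    have kE : k = h x - h x1 by rewrite hx addrAC subrr add0r.
    have xx1 : `|x - x1| <= N * `|k| by rewrite kE; exact: expansive.
    have xr1 : `|x - x1| < r1.
      move: kr; rewrite ltr_pdivlMr// => kr; apply: (le_lt_trans xx1).
      by have := normr_ge0 k; move: kr; set a := `|k|; nra.
    have seg (s : R) : 0 <= s <= 1 -> `|x1 + s *: (x - x1) - x1| < r1.
      by move=> Hs; apply: segment_ball => //; rewrite subrr normr0.
    have tay : `|h (x1 + (x - x1)) - h x1 - 'D_(x - x1) h x1| <= K * `|x - x1| ^+ 2.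
      apply: (taylor2 oA sh) => s Hs; have [As _ _ D2] := HK _ (seg s Hs) => //.
      by rewrite expr2 mulrA; exact: D2.
    rewrite (addrC x1) subrK in tay.
    have -> : x - x1 - G *m k = - (G *m (h x - h x1 - 'D_(x - x1) h x1)).
      rewrite derive_jac; last exact: smooth_on_differentiable sh Ax1.
      by rewrite mulmxBr /G mulKmx// kE opprB.
    rewrite normrN (le_trans (mx_norm_mulmx _ _))//.
    have -> : n%:R * (`|G| * (K * N ^+ 2)) * `|k| ^+ 2 = n%:R * (`|G| * (K * (N * `|k|) ^+ 2)).
      have H (a b c p q : R) : a * (b * (c * p ^+ 2)) * q ^+ 2 = a * (b * (c * (p * q) ^+ 2)) by ring.
      exact: H.
    apply: ler_wpM2l => //; apply: ler_wpM2l => //.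
    apply: (le_trans tay); apply: ler_wpM2l => //.
    by apply: lerXn2r => //; rewrite nnegrE ?mulr_ge0.
split => //.
(* Bootstrapping again, through D_v g = (jac h o g)^-1 v. *)
elim=> [|k IH]; first by move=> y /Dg[dg _]; exact: differentiable_continuous.
split=> [y /Dg[]//|v].
apply: (@Ck_eq _ _ _ _ _ (fun y => invmx (jac h (g y)) *m v)) => //.
  by move=> y /Dg[_ ->].
apply: Ck_mulmx => //; last exact: Ck_cst.
apply: Ck_invmx => //; first by move=> y /gB By; exact: jac_unit.
apply: (@Ck_comp _ _ _ _ _ _ _ B g (jac h)) => //.
apply: Ck_sub (smooth_on_jac oA sh k).
by move=> x Bx; have [] := Hr Bx.
Qed.

End InverseFunction.

Theorem inverse_function (R : realType) n (h : 'cV[R]_n -> 'cV[R]_n) (A : set 'cV[R]_n) x0 :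
  open A -> A x0 -> smooth_on A h -> jac h x0 \in unitmx ->
  exists (r : R) (g : 'cV[R]_n -> 'cV[R]_n),
  let B := [set x | `|x - x0| < r] in
  [/\ 0 < r, B `<=` A, forall x, B x -> jac h x \in unitmx &
      [/\ open (h @` B), (forall x, B x -> g (h x) = x) & smooth_on (h @` B) g]].
Proof.
move=> oA Ax0 sh uJ; set J := jac h x0 in uJ.
pose f x := invmx J *m h x - x.
have Df x v : A x -> 'D_v f x = invmx J *m 'D_v h x - v.
  by move=> Ax; apply: displacement_derive.
have lf x : A x -> linear (fun v => 'D_v f x).
  by move=> Ax; apply: derive_linear; exact: displacement_differentiable sh J x Ax.
(* [linear_norm_le] multiplies a bound on basis directions by n, and n e <= 1/2. *)
pose e : R := (2 * (n%:R + 1))^-1.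
have n1 : 0 < n%:R + 1 :> R by rewrite ltr_wpDl.
have e0 : 0 < e by rewrite invr_gt0 mulr_gt0.
have near_small : \forall x \near x0, forall i : 'I_n, `|'D_(delta_mx i 0) f x| <= e.
  apply: near_forall => i.
  have sDh := smooth_on_derive (delta_mx i 0) sh.
  have sC : smooth_on A (fun x => invmx J *m 'D_(delta_mx i 0) h x).
    by apply: smooth_on_mulmx => //; exact: smooth_on_cst.
  have /cvgrPdist_le/(_ _ e0) := smooth_on_continuous sC Ax0.
  move=> /(filterI (open_near oA Ax0)); apply: filterS => x [Ax].
  (* As J is the Jacobian at [x0], the derivative of [f] vanishes there; continuity makes it small
     nearby. *)
  have E : 'D_(delta_mx i 0) h x0 = J *m delta_mx i 0.
    by apply: derive_jac; exact: smooth_on_differentiable sh Ax0.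
  by rewrite Df// E mulKmx// distrC.
have [r r0 Hr] := near_normP (filterI (open_near oA Ax0) near_small).
have Hr' x : `|x - x0| < r -> A x /\ forall v, `|'D_v f x| <= 2^-1 * `|v|.
  move=> /Hr[Ax Hx]; split => // v.
  apply: (le_trans (linear_norm_le (lf x Ax) (ltW e0) Hx v)); apply: ler_wpM2r => //.
  by rewrite /e invfM mulrCA ler_piMr// ler_pdivrMr// mul1r lerDl.
have [g [ohB gK sg]] := inverse_function_ball oA sh uJ Hr'.
exists r, g => B; split; [exact: r0 | by move=> x /Hr'[] | | by split].
by move=> x; exact: (jac_unit sh Hr').
Qed.

(** * Smooth charts *)

Section SmoothAt.
Context {R : realType} {V : normedModType R}.

Lemma near_open (T : topologicalType) (x : T) (P : T -> Prop) :
  (\forall y \near x, P y) -> exists2 B, open_nbhs x B & forall y, B y -> P y.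
Proof. by move=> H; have : nbhs x P by []; rewrite nbhsE. Qed.

Lemma Ck_local (W : normedModType R) k (A : set V) (f : V -> W) :
  (forall x, A x -> exists2 B, open_nbhs x B & Ck k B f) -> Ck k A f.
Proof.
elim: k f => [|k IH] f H.
  by move=> x /H[B [_ Bx]]; apply.
split=> [x /H[B [_ Bx] [df _]]|v]; first exact: df.
by apply: IH => x /H[B oB [_ Df]]; exists B => //; exact: Df.
Qed.

Lemma smooth_on_at (W : normedModType R) (A : set V) (f : V -> W) :
  (forall x, A x -> smooth_at f x) -> smooth_on A f.
Proof.
by move=> H k; apply: Ck_local => x /H[B oB sB]; exists B.
Qed.

Lemma smooth_at_on (W : normedModType R) (A : set V) (f : V -> W) x :
  open A -> smooth_on A f -> A x -> smooth_at f x.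
Proof. by move=> oA sf Ax; exists A. Qed.

Lemma smooth_at_eq (W : normedModType R) (f g : V -> W) x :
  (\forall y \near x, f y = g y) -> smooth_at f x -> smooth_at g x.
Proof.
move=> /near_open[B [oB Bx] BE] [A [oA Ax] sf].
exists (A `&` B); first by split; [exact: openI|].
apply: smooth_on_eq (smooth_on_sub _ sf); [exact: openI|by move=> y [_ /BE]|by move=> y []].
Qed.

Lemma smooth_at_differentiable (W : normedModType R) (f : V -> W) x :
  smooth_at f x -> differentiable f x.
Proof. by move=> [A [oA Ax] sf]; exact: smooth_on_differentiable sf Ax. Qed.

Lemma smooth_at_continuous (W : normedModType R) (f : V -> W) x :
  smooth_at f x -> {for x, continuous f}.
Proof. by move=> [A [oA Ax] sf]; exact: smooth_on_continuous sf Ax. Qed.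

Lemma smooth_at_near (W : normedModType R) (f : V -> W) x :
  smooth_at f x -> \forall y \near x, smooth_at f y.
Proof.
move=> [A [oA Ax] sf]; apply: filterS (open_near oA Ax) => y Ay.
by exists A.
Qed.

Lemma smooth_at_cst (W : normedModType R) (c : W) (x : V) : smooth_at (fun=> c) x.
Proof. by exists setT; [split => //; exact: openT|exact: smooth_on_cst]. Qed.

Lemma smooth_at_add (W : normedModType R) (f g : V -> W) x :
  smooth_at f x -> smooth_at g x -> smooth_at (fun y => f y + g y) x.
Proof.
move=> [A [oA Ax] sf] [B [oB Bx] sg].
have oAB := openI oA oB; exists (A `&` B); first by split.
by apply: smooth_on_add => //; [apply: smooth_on_sub sf|apply: smooth_on_sub sg] => y [].
Qed.

Lemma smooth_at_mulmx m n p (f : V -> 'M[R]_(m, n)) (g : V -> 'M[R]_(n, p)) x :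
  smooth_at f x -> smooth_at g x -> smooth_at (fun y => f y *m g y) x.
Proof.
move=> [A [oA Ax] sf] [B [oB Bx] sg].
have oAB := openI oA oB; exists (A `&` B); first by split.
by apply: smooth_on_mulmx => //; [apply: smooth_on_sub sf|apply: smooth_on_sub sg] => y [].
Qed.

Lemma smooth_at_entry m n (f : V -> 'M[R]_(m, n)) x i j :
  smooth_at f x -> smooth_at (fun y => f y i j : R^o) x.
Proof.
by move=> [A [oA Ax] sf]; exists A => // k; exact: Ck_entry (sf k).
Qed.

Lemma smooth_at_mx m n (f : V -> 'M[R]_(m, n)) x :
  (forall i j, smooth_at (fun y => f y i j : R^o) x) -> smooth_at f x.
Proof.
move=> H.
have /choice[A HA] : forall ij : 'I_m * 'I_n, exists A : set V,
    open_nbhs x A /\ smooth_on A (fun y => f y ij.1 ij.2 : R^o).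
  by move=> ij; have [A ? ?] := H ij.1 ij.2; exists A.
have : \forall y \near x, forall ij, A ij y.
  by apply: near_forall => ij; have [/open_nbhs_nbhs] := HA ij.
move=> /near_open[B [oB Bx] BA]; exists B => // k; apply: Ck_mx => // i j.
have [_ /(_ k)] := HA (i, j); apply: Ck_sub => y /BA; exact.
Qed.

Lemma near_unitmx n (f : V -> 'M[R]_n) x : f x \in unitmx -> smooth_at f x ->
  \forall y \near x, f y \in unitmx.
Proof.
move=> ux [A [oA Ax] sf].
have cd : Ck 0 A (fun y => \det (f y) : R^o) by exact: Ck_det (sf 0%N).
have /cvgrPdist_lt := cd x Ax.
have d0 : 0 < `|\det (f x)| by rewrite normr_gt0 -unitfE -unitmxE.
move=> /(_ _ d0); apply: filterS => y; rewrite unitmxE unitfE.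
by apply: contraTneq => ->; rewrite subr0 ltxx.
Qed.

Lemma smooth_at_invmx n (f : V -> 'M[R]_n) x :
  f x \in unitmx -> smooth_at f x -> smooth_at (fun y => invmx (f y)) x.
Proof.
move=> ux sx; have [B [oB Bx] BU] := near_open (near_unitmx ux sx).
have [A [oA Ax] sf] := sx.
have oAB := openI oA oB; exists (A `&` B); first by split.
apply: smooth_on_invmx => //; first by move=> y [_ /BU].
by apply: smooth_on_sub sf => y [].
Qed.

End SmoothAt.

Section SmoothAtComp.
Context {R : realType} {V : normedModType R} {n : nat}.

Lemma smooth_at_comp p q (f : V -> 'cV[R]_n) (g : 'cV[R]_n -> 'M[R]_(p, q)) x :
  smooth_at f x -> smooth_at g (f x) -> smooth_at (g \o f) x.
Proof.
move=> [A [oA Ax] sf] [B [oB Bx] sg].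
have : \forall y \near x, B (f y).
  exact: (smooth_on_continuous sf Ax (open_near oB Bx)).
move=> /near_open[C [oC Cx] CB].
have oAC := openI oA oC; exists (A `&` C); first by split.
apply: (smooth_on_comp oAC oB) => //; first by move=> y [_ /CB].
by apply: smooth_on_sub sf => y [].
Qed.

Lemma smooth_at_comp_scal (f : V -> 'cV[R]_n) (g : 'cV[R]_n -> R^o) x :
  smooth_at f x -> smooth_at g (f x) -> smooth_at (g \o f) x.
Proof.
move=> [A [oA Ax] sf] [B [oB Bx] sg].
have : \forall y \near x, B (f y).
  exact: (smooth_on_continuous sf Ax (open_near oB Bx)).
move=> /near_open[C [oC Cx] CB].
have oAC := openI oA oC; exists (A `&` C); first by split.
move=> k; apply: (@Ck_comp_scal _ _ _ k _ B) => //; first by move=> y [_ /CB].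
by apply: Ck_sub (sf k) => y [].
Qed.

Lemma smooth_at_jac m (f : 'cV[R]_n -> 'cV[R]_m) x :
  smooth_at f x -> smooth_at (jac f) x.
Proof. by move=> [A [oA Ax] sf]; exists A => //; exact: smooth_on_jac. Qed.

Lemma derive_jac_mul m (f : 'cV[R]_n -> 'cV[R]_m) x u w : smooth_at f x ->
  'D_u (jac f) x *m w = 'D_u ('D_w f) x.
Proof.
move=> sf; have dj := smooth_at_differentiable (smooth_at_jac sf).
have E : \forall y \near x, 'D_w f y = jac f y *m w.
  apply: filterS (smooth_at_near sf) => y /smooth_at_differentiable.
  exact: derive_jac.
have dw : differentiable (fun _ : 'cV[R]_n => w) x by exact: differentiable_cst.
apply/esym; apply: (etrans (near_eq_derive u E)).
apply: (etrans (derive_mulmx u dj dw)).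
have -> : 'D_u (fun=> w) x = 0 by exact: derive_cst.
by rewrite mulmx0 addr0.
Qed.

(** Symmetry of second derivatives in the form needed for brackets and curvature, where the Jacobian
    is differentiated before it is applied to a vector. *)
Lemma derive_jac_sym m (f : 'cV[R]_n -> 'cV[R]_m) x u w : smooth_at f x ->
  'D_u (jac f) x *m w = 'D_w (jac f) x *m u.
Proof.
move=> sf; have [A [oA Ax] sA] := sf.
apply: (etrans (derive_jac_mul u w sf)); apply: (etrans _ (esym (derive_jac_mul w u sf))).
exact: schwarz_mx oA sA Ax.
Qed.

End SmoothAtComp.

(** * Charts and their transition maps *)

Section Charts.
Context {R : realType} {n : nat} {T : topologicalType}.
Implicit Types (a b : chart R n T) (p : T) (y : 'cV[R]_n).

Lemma chart_near a p : dom a p -> \forall q \near p, dom a q.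
Proof. by move=> ap; apply: open_nbhs_nbhs; split => //; exact: dom_open. Qed.

Lemma cod_near a p : dom a p ->
  \forall y \near to_coord a p, dom a (of_coord a y) /\ to_coord a (of_coord a y) = y.
Proof.
move=> ap; have : (to_coord a @` dom a) (to_coord a p) by exists p.
move=> /(open_near (@cod_open _ _ _ a)); apply: filterS => _ [q aq <-].
by rewrite to_coordK.
Qed.

Lemma of_coord_near a p (Q : set T) : dom a p -> (\forall q \near p, Q q) ->
  \forall y \near to_coord a p, Q (of_coord a y).
Proof.
move=> ap HQ; have := @of_coord_continuous _ _ _ a (to_coord a p).
move=> /(_ (ex_intro2 _ _ p ap erefl)); apply.
by rewrite to_coordK.
Qed.

Lemma coord_image_open a (Q : set T) : open Q -> open (to_coord a @` (dom a `&` Q)).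
Proof.
move=> oQ; rewrite openE => _ [p [ap Qp] <-].
have nQ : \forall q \near p, Q q by apply: open_nbhs_nbhs; split.
apply: filterS (filterI (cod_near ap) (of_coord_near ap nQ)) => y [[aq yE] Qy].
by exists (of_coord a y).
Qed.

Lemma transition_id a p : dom a p -> \forall y \near to_coord a p, transition a a y = y.
Proof. by move=> ap; apply: filterS (cod_near ap) => y []. Qed.

Lemma transitionE a b p : dom a p -> transition a b (to_coord a p) = to_coord b p.
Proof. by move=> ap; rewrite /transition /= to_coordK. Qed.

Lemma transition_comp a b c p : dom a p -> dom b p ->
  \forall y \near to_coord a p, transition a c y = (transition b c \o transition a b) y.
Proof.
move=> ap bp; apply: filterS (of_coord_near ap (chart_near bp)) => y bq.
by rewrite /transition /= to_coordK.
Qed.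

End Charts.

(** * Change of components between smooth charts *)

Section ManifoldCharts.
Context {R : realType} {n : nat} {M : manifold R n}.
Implicit Types (a b c : chart R n M) (p q : M) (y : 'cV[R]_n).

Lemma smooth_chart_at p : smooth_chart (chart_at p : chart R n M).
Proof. by move=> q; exact: chart_at_compatible. Qed.

(** Smooth charts are by definition compatible with the charts [chart_at] only, so the transition is
    factored through [chart_at p]. *)
Lemma transition_smooth a b p : smooth_chart a -> smooth_chart b ->
  dom a p -> dom b p -> smooth_at (transition a b) (to_coord a p).
Proof.
move=> sa sb ap bp; pose c : chart R n M := chart_at p.
have cp : dom c p by exact: chart_at_dom.
have E := transition_comp b ap cp.
apply: smooth_at_eq (filterS _ E) _ => [y ->//|].
apply: smooth_at_comp.
  apply: (@smooth_at_on _ _ _ (to_coord a @` (dom a `&` dom c))).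
  - exact/coord_image_open/dom_open.
  - by have [] := sa p.
  - by exists p.
rewrite transitionE//.
apply: (@smooth_at_on _ _ _ (to_coord c @` (dom b `&` dom c))).
- by rewrite setIC; exact/coord_image_open/dom_open.
- by have [] := sb p.
- by exists p.
Qed.

(** [tcoord] and [coord_frame] are both instances of it, one with [chart_at p] as source and the
    other with it as target; their relations are then cases of the chain rule. *)
Definition chart_jac a b p : 'M[R]_n := jac (transition a b) (to_coord a p).

Lemma tcoordE a p : tcoord a p = chart_jac (chart_at p) a p.
Proof. by []. Qed.

Lemma coord_frameE a p : coord_frame a p = chart_jac a (chart_at p) p.
Proof. by []. Qed.

Lemma chart_jac_id a p : dom a p -> chart_jac a a p = 1%:M.
Proof.
by move=> ap; rewrite /chart_jac (near_eq_jac (transition_id ap)) jac_id.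
Qed.

Lemma chart_jac_comp a b c p : smooth_chart a -> smooth_chart b -> smooth_chart c ->
  dom a p -> dom b p -> dom c p ->
  chart_jac b c p *m chart_jac a b p = chart_jac a c p.
Proof.
move=> sa sb sc ap bp cp; rewrite /chart_jac (near_eq_jac (transition_comp c ap bp)).
rewrite jac_comp ?transitionE//.
- exact/smooth_at_differentiable/transition_smooth.
- exact/smooth_at_differentiable/transition_smooth.
Qed.

Lemma chart_jacK a b p : smooth_chart a -> smooth_chart b -> dom a p -> dom b p ->
  chart_jac b a p *m chart_jac a b p = 1%:M.
Proof. by move=> sa sb ap bp; rewrite chart_jac_comp// chart_jac_id. Qed.

Lemma chart_jac_near a b p : dom a p -> \forall y \near to_coord a p,
  chart_jac a b (of_coord a y) = jac (transition a b) y.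
Proof.
by move=> ap; apply: filterS (cod_near ap) => y [_ yE]; rewrite /chart_jac yE.
Qed.

Lemma chart_jac_smooth a b p : smooth_chart a -> smooth_chart b -> dom a p -> dom b p ->
  smooth_at (fun y => chart_jac a b (of_coord a y)) (to_coord a p).
Proof.
move=> sa sb ap bp.
apply: (@smooth_at_eq _ _ _ (jac (transition a b))).
  by apply: filterS (chart_jac_near b ap) => y ->.
by apply: smooth_at_jac; exact: transition_smooth.
Qed.

Lemma tcoord_frameK a p : smooth_chart a -> dom a p ->
  tcoord a p *m coord_frame a p = 1%:M.
Proof.
move=> sa ap; rewrite tcoordE coord_frameE chart_jacK//; [exact: smooth_chart_at|exact: chart_at_dom].
Qed.

Lemma frame_tcoordK a p : smooth_chart a -> dom a p ->
  coord_frame a p *m tcoord a p = 1%:M.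
Proof.
move=> sa ap; rewrite tcoordE coord_frameE chart_jacK//; [exact: smooth_chart_at|exact: chart_at_dom].
Qed.

Lemma tcoord_at p : tcoord (chart_at p) p = 1%:M.
Proof. by rewrite tcoordE chart_jac_id//; exact: chart_at_dom. Qed.

Lemma tcoord_change a b p : smooth_chart a -> smooth_chart b -> dom a p -> dom b p ->
  chart_jac a b p *m tcoord a p = tcoord b p.
Proof.
move=> sa sb ap bp; rewrite !tcoordE chart_jac_comp//; [exact: smooth_chart_at|exact: chart_at_dom].
Qed.

Lemma tcoord_frame_change a b p : smooth_chart a -> smooth_chart b -> dom a p -> dom b p ->
  tcoord b p *m coord_frame a p = chart_jac a b p.
Proof.
move=> sa sb ap bp.
by rewrite -(tcoord_change sa sb ap bp) -mulmxA tcoord_frameK// mulmx1.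
Qed.

Lemma tcoord_inj m a p (X Y : 'M[R]_(n, m)) : smooth_chart a -> dom a p ->
  tcoord a p *m X = tcoord a p *m Y -> X = Y.
Proof.
move=> sa ap /(congr1 (mulmx (coord_frame a p))).
by rewrite !mulmxA frame_tcoordK// !mul1mx.
Qed.

Lemma read_in_at m (X : M -> 'M[R]_(n, m)) a p : dom a p ->
  read_in a X (to_coord a p) = tcoord a p *m X p.
Proof. by move=> ap; rewrite /read_in to_coordK. Qed.

Lemma read_in_coord_at m (X : M -> 'M[R]_(n, m)) p :
  read_in (chart_at p) X (coord_at p) = X p.
Proof.
by rewrite /coord_at read_in_at ?tcoord_at ?mul1mx//; exact: chart_at_dom.
Qed.

Lemma read_in_change m (X : M -> 'M[R]_(n, m)) a b p : smooth_chart a -> smooth_chart b ->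
  dom a p -> dom b p -> \forall y \near to_coord a p,
  read_in b X (transition a b y) = chart_jac a b (of_coord a y) *m read_in a X y.
Proof.
move=> sa sb ap bp.
apply: filterS (filterI (cod_near ap) (of_coord_near ap (chart_near bp))) => y [[aq yE] bq].
by rewrite /read_in /transition /= to_coordK// mulmxA tcoord_change.
Qed.

Lemma read_in_smooth_change m (X : M -> 'M[R]_(n, m)) a b p :
  smooth_chart a -> smooth_chart b -> dom a p -> dom b p ->
  smooth_at (read_in a X) (to_coord a p) -> smooth_at (read_in b X) (to_coord b p).
Proof.
move=> sa sb ap bp sX.
have sT := transition_smooth sb sa bp ap.
apply: (@smooth_at_eq _ _ _
  ((fun y => chart_jac a b (of_coord a y) *m read_in a X y) \o transition b a)).
  apply: filterS (filterI (cod_near bp) (of_coord_near bp (chart_near ap))) => y [[bq yE] aq].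
  by rewrite /read_in /transition /= to_coordK// mulmxA tcoord_change.
apply: smooth_at_comp => //; rewrite transitionE//; apply: smooth_at_mulmx => //.
exact: chart_jac_smooth.
Qed.

Lemma smooth_field_chart m (X : M -> 'M[R]_(n, m)) a p : smooth_chart a -> dom a p ->
  smooth_field_at X p <-> smooth_at (read_in a X) (to_coord a p).
Proof.
move=> sa ap; have sc := @smooth_chart_at p; have cp : dom (chart_at p) p by exact: chart_at_dom.
by split; exact: read_in_smooth_change.
Qed.

Lemma smooth_fun_chart (f : M -> R^o) a p : smooth_chart a -> dom a p ->
  smooth_fun_at f p <-> smooth_at (f \o of_coord a) (to_coord a p).
Proof.
move=> sa ap; have sc := @smooth_chart_at p; have cp : dom (chart_at p) p by exact: chart_at_dom.
have H (b c : chart R n M) : smooth_chart b -> smooth_chart c -> dom b p -> dom c p ->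
    smooth_at (f \o of_coord b) (to_coord b p) -> smooth_at (f \o of_coord c) (to_coord c p).
  move=> sb sc' bp cp' sf.
  apply: (@smooth_at_eq _ _ _ ((f \o of_coord b) \o transition c b)).
    apply: filterS (of_coord_near cp' (chart_near bp)) => y bq.
    by rewrite /transition /= to_coordK.
  apply: smooth_at_comp_scal; first exact: transition_smooth.
  by rewrite transitionE.
by split; exact: H.
Qed.

Lemma dir_deriv_chart (f : M -> R^o) a p v : smooth_chart a -> dom a p ->
  smooth_fun_at f p ->
  dir_deriv p v f = 'D_(tcoord a p *m v) (f \o of_coord a) (to_coord a p).
Proof.
move=> sa ap sf; pose c : chart R n M := chart_at p.
have cp : dom c p by exact: chart_at_dom.
have sT := transition_smooth (@smooth_chart_at p) sa cp ap.
have E : \forall y \near to_coord c p, (f \o of_coord c) y = ((f \o of_coord a) \o transition c a) y.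
  apply: filterS (of_coord_near cp (chart_near ap)) => y aq.
  by rewrite /transition /= to_coordK.
rewrite /dir_deriv (near_eq_derive _ E) derive_comp.
- rewrite transitionE// derive_jac//; exact: smooth_at_differentiable.
- exact: smooth_at_differentiable.
- rewrite transitionE//; apply: smooth_at_differentiable; exact/smooth_fun_chart.
Qed.

Definition coord_bracket (X Y : 'cV[R]_n -> 'cV[R]_n) y : 'cV[R]_n :=
  'D_(X y) Y y - 'D_(Y y) X y.

(** The product rule on the transformation law of a field. The term with the differentiated Jacobian
    is the obstruction to componentwise differentiation being independent of the chart. *)
Lemma derive_read_in_change (W : M -> 'cV[R]_n) a p u : smooth_chart a -> dom a p ->
  smooth_field_at W p ->
  'D_(tcoord a p *m u) (read_in a W) (to_coord a p) =
  'D_u (jac (transition (chart_at p) a)) (coord_at p) *m W p +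
  tcoord a p *m 'D_u (read_in (chart_at p) W) (coord_at p).
Proof.
move=> sa ap sW; pose c : chart R n M := chart_at p.
have sc : smooth_chart c by exact: smooth_chart_at.
have cp : dom c p by exact: chart_at_dom.
have sT := transition_smooth sc sa cp ap.
have dT := smooth_at_differentiable sT.
have dJ := smooth_at_differentiable (smooth_at_jac sT).
have sWa : smooth_at (read_in a W) (to_coord a p) by apply/smooth_field_chart.
rewrite tcoordE -/c -(transitionE a cp) -derive_jac//.
rewrite -derive_comp//; last by rewrite transitionE//; exact: smooth_at_differentiable.
have E : \forall y \near to_coord c p, (read_in a W \o transition c a) y =
    jac (transition c a) y *m read_in c W y.
  apply: filterS (filterI (chart_jac_near a cp) (read_in_change W sc sa cp ap)) => y [<-].
  by [].
rewrite (near_eq_derive _ E) derive_mulmx//; last exact: smooth_at_differentiable.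
by rewrite (read_in_coord_at W p).
Qed.

(* The extra terms in which the Jacobian of the transition map is differentiated
   are second derivatives, and cancel by symmetry. *)
Lemma lie_bracket_chart (X Y : M -> 'cV[R]_n) a p : smooth_chart a -> dom a p ->
  smooth_field_at X p -> smooth_field_at Y p ->
  tcoord a p *m lie_bracket X Y p =
  coord_bracket (read_in a X) (read_in a Y) (to_coord a p).
Proof.
move=> sa ap sX sY.
have sT := transition_smooth (@smooth_chart_at p) sa (@chart_at_dom _ _ M p) ap.
have gen (A B C D : 'cV[R]_n) : A = B -> C - D = (A + C) - (B + D).
  by move=> ->; rewrite opprD addrACA subrr add0r.
rewrite /coord_bracket !(read_in_at _ ap).
rewrite (derive_read_in_change (X p) sa ap sY) (derive_read_in_change (Y p) sa ap sX).
by rewrite /lie_bracket mulmxBr; apply: gen; exact: derive_jac_sym.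
Qed.

End ManifoldCharts.

(** * Connections in a chart *)

Section ScaleCalculus.
Context {R : realType} {V : normedModType R}.

Lemma smooth_at_scale m n (f : V -> R^o) (F : V -> 'M[R]_(m, n)) x :
  smooth_at f x -> smooth_at F x -> smooth_at (fun y => (f y : R) *: F y) x.
Proof.
move=> [A [oA Ax] sf] [B [oB Bx] sF].
have oAB := openI oA oB; exists (A `&` B); first by split.
move=> k; apply: Ck_mx => // i j.
rewrite (_ : (fun y => _) = fun y => f y * F y i j : R^o); last first.
  by apply/funext => y; rewrite mxE.
apply: Ck_mul => //; first by apply: Ck_sub (sf k) => y [].
by apply: Ck_sub (Ck_entry i j oB (sF k)) => y [].
Qed.

Lemma derive_scale m n (f : V -> R^o) (F : V -> 'M[R]_(m, n)) x v :
  differentiable f x -> differentiable F x ->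
  'D_v (fun y => (f y : R) *: F y) x = ('D_v f x : R) *: F x + (f x : R) *: 'D_v F x.
Proof.
move=> df dF; have dFe i j := @differentiable_entry _ _ _ _ F x i j dF.
have E i j : (fun y => ((f y : R) *: F y) i j : R^o) = (f * (fun y => F y i j : R^o)).
  by apply/funext => y; rewrite mxE.
have dfF : differentiable (fun y => (f y : R) *: F y) x.
  apply: differentiable_mx => i j; rewrite E.
  by apply: (@differentiableM _ _ f (fun y => F y i j)).
apply/matrixP => i j; rewrite derive_entry; last exact: diff_derivable.
rewrite E (@deriveM _ _ f (fun y => F y i j : R)); try exact: diff_derivable.
rewrite !mxE derive_entry; last exact: diff_derivable.
by rewrite addrC; congr (_ + _); exact: mulrC.
Qed.

End ScaleCalculus.

Lemma mulmx_sum_cols (R : comRingType) m n (A : 'M[R]_(m, n)) (u : 'cV[R]_n) :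
  A *m u = \sum_j u j 0 *: col j A.
Proof.
apply/colP => i; rewrite mxE summxE; apply: eq_bigr => j _.
by rewrite !mxE mulrC.
Qed.

(** * Vector fields and their components in a chart *)

Section Fields.
Context {R : realType} {n : nat} {M : manifold R n}.
Implicit Types (a b : chart R n M) (p q : M) (X Y Z : M -> 'cV[R]_n) (f : M -> R^o).

Lemma smooth_field_add X Y p : smooth_field_at X p -> smooth_field_at Y p ->
  smooth_field_at (fun q => X q + Y q) p.
Proof.
move=> sX sY; rewrite /smooth_field_at.
rewrite (_ : read_in _ _ = fun y => read_in (chart_at p) X y + read_in (chart_at p) Y y).
  exact: smooth_at_add.
by apply/funext => y; rewrite /read_in mulmxDr.
Qed.

Lemma smooth_field_scale f X p : smooth_fun_at f p -> smooth_field_at X p ->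
  smooth_field_at (fun q => (f q : R) *: X q) p.
Proof.
move=> sf sX; rewrite /smooth_field_at.
rewrite (_ : read_in _ _ = fun y => ((f \o of_coord (chart_at p)) y : R) *: read_in (chart_at p) X y).
  exact: smooth_at_scale.
by apply/funext => y; rewrite /read_in -scalemxAr.
Qed.

Lemma smooth_field0 p : smooth_field_at (fun _ : M => 0 : 'cV[R]_n) p.
Proof.
rewrite /smooth_field_at (_ : read_in _ _ = fun=> 0); first exact: smooth_at_cst.
by apply/funext => y; rewrite /read_in mulmx0.
Qed.

Lemma smooth_field_sum (I : Type) (r : seq I) (f : I -> M -> R^o) (X : I -> M -> 'cV[R]_n) p :
  (forall i, smooth_fun_at (f i) p) -> (forall i, smooth_field_at (X i) p) ->
  smooth_field_at (fun q => \sum_(i <- r) (f i q : R) *: X i q) p.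
Proof.
move=> sf sX; elim: r => [|i r IH].
  rewrite (_ : (fun q => _) = fun=> 0); first exact: smooth_field0.
  by apply/funext => q; rewrite big_nil.
rewrite (_ : (fun q => _) = fun q => (f i q : R) *: X i q + \sum_(j <- r) (f j q : R) *: X j q).
  by apply: smooth_field_add => //; exact: smooth_field_scale.
by apply/funext => q; rewrite big_cons.
Qed.

Definition const_field a (w : 'cV[R]_n) q : 'cV[R]_n := coord_frame a q *m w.

Lemma coord_field_const a j : coord_field a j = const_field a (delta_mx j 0).
Proof. by apply/funext => q; rewrite /coord_field colE. Qed.

Lemma read_in_const a w p : smooth_chart a -> dom a p ->
  \forall y \near to_coord a p, read_in a (const_field a w) y = w.
Proof.
move=> sa ap; apply: filterS (cod_near ap) => y [aq _].
by rewrite /read_in /const_field mulmxA tcoord_frameK// mul1mx.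
Qed.

Lemma smooth_const_field a w p : smooth_chart a -> dom a p ->
  smooth_field_at (const_field a w) p.
Proof.
move=> sa ap; apply/(smooth_field_chart _ sa ap).
apply: (@smooth_at_eq _ _ _ (fun=> w)); last exact: smooth_at_cst.
by apply: filterS (read_in_const w sa ap) => y ->.
Qed.

Lemma smooth_coord_field a j p : smooth_chart a -> dom a p ->
  smooth_field_at (coord_field a j) p.
Proof. by move=> sa ap; rewrite coord_field_const; exact: smooth_const_field. Qed.

Lemma tcoord_coord_field a j p : smooth_chart a -> dom a p ->
  tcoord a p *m coord_field a j p = delta_mx j 0.
Proof.
by move=> sa ap; rewrite /coord_field colE mulmxA tcoord_frameK// mul1mx.
Qed.

Definition component a X j q : R^o := read_in a X (to_coord a q) j 0.

Lemma smooth_component a X j p : smooth_chart a -> dom a p -> smooth_field_at X p ->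
  smooth_fun_at (component a X j) p.
Proof.
move=> sa ap sX; apply/(smooth_fun_chart _ sa ap).
apply: (@smooth_at_eq _ _ _ (fun y => read_in a X y j 0 : R^o)).
  by apply: filterS (cod_near ap) => y [_ yE]; rewrite /component /= yE.
by apply: smooth_at_entry; apply/smooth_field_chart.
Qed.

Lemma dir_deriv_component a X j p v : smooth_chart a -> dom a p -> smooth_field_at X p ->
  dir_deriv p v (component a X j) =
  ('D_(tcoord a p *m v) (read_in a X) (to_coord a p)) j 0.
Proof.
move=> sa ap sX; rewrite (dir_deriv_chart v sa ap (smooth_component j sa ap sX)).
have sXa : smooth_at (read_in a X) (to_coord a p) by apply/smooth_field_chart.
rewrite derive_entry; last by apply: diff_derivable; exact: smooth_at_differentiable.
apply: near_eq_derive; apply: filterS (cod_near ap) => y [_ yE].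
by rewrite /component /= yE.
Qed.

Lemma field_expand a X p : smooth_chart a -> dom a p ->
  \forall q \near p, X q = \sum_j (component a X j q : R) *: coord_field a j q.
Proof.
move=> sa ap; apply: filterS (chart_near ap) => q aq.
by rewrite -mulmx_sum_cols read_in_at// mulmxA frame_tcoordK// mul1mx.
Qed.

End Fields.

(** * Local formula of a connection, and parallel fields in a flat chart *)

Section Connections.
Context {R : realType} {n : nat} {M : manifold R n} {U : set M} (D : linear_connection U).
Implicit Types (a b : chart R n M) (p q : M) (X Y Z : M -> 'cV[R]_n) (f : M -> R^o).

Lemma nabla0 p v : U p -> D p v (fun=> 0) = 0.
Proof.
move=> Up; have := nabla_add D v Up (smooth_field0 p) (smooth_field0 p).
rewrite (_ : (fun q => 0 + 0) = fun=> 0); last by apply/funext => q; rewrite addr0.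
by move=> E; apply: (addrI (D p v (fun=> 0))); rewrite addr0 -E.
Qed.

Lemma nabla_dir0 p Y : U p -> smooth_field_at Y p -> D p 0 Y = 0.
Proof.
move=> Up sY; have := nabla_linear D 1 0 0 Up sY.
by rewrite !scale1r addr0 => E; apply: (addrI (D p 0 Y)); rewrite addr0 -E.
Qed.

Lemma nabla_sum (I : Type) (r : seq I) (f : I -> M -> R^o) (X : I -> M -> 'cV[R]_n) p v :
  U p -> (forall i, smooth_fun_at (f i) p) -> (forall i, smooth_field_at (X i) p) ->
  D p v (fun q => \sum_(i <- r) (f i q : R) *: X i q) =
  \sum_(i <- r) (dir_deriv p v (f i) *: X i p + (f i p : R) *: D p v (X i)).
Proof.
move=> Up sf sX; elim: r => [|i r IH].
  rewrite (_ : (fun q => _) = fun=> 0); first by rewrite nabla0// big_nil.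
  by apply/funext => q; rewrite big_nil.
rewrite (_ : (fun q => _) = fun q => (f i q : R) *: X i q + \sum_(j <- r) (f j q : R) *: X j q).
  rewrite nabla_add//; [|exact: smooth_field_scale|exact: smooth_field_sum].
  by rewrite nabla_leibniz// IH big_cons.
by apply/funext => q; rewrite big_cons.
Qed.

(** The Leibniz rule on the expansion of Y in coordinate fields. The expansion holds only near [p],
    whence the use of [nabla_local]. *)
Lemma nabla_chart a p v Y : smooth_chart a -> dom a p -> U p -> smooth_field_at Y p ->
  tcoord a p *m D p v Y = 'D_(tcoord a p *m v) (read_in a Y) (to_coord a p) +
  \sum_j read_in a Y (to_coord a p) j 0 *: (tcoord a p *m D p v (coord_field a j)).
Proof.
move=> sa ap Up sY.
have sc j := smooth_component j sa ap sY.
have sF j := smooth_coord_field j sa ap.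
rewrite (nabla_local D v Up sY (smooth_field_sum _ sc sF) (field_expand Y sa ap)).
rewrite nabla_sum// big_split/= mulmxDr !mulmx_sumr; congr (_ + _).
  rewrite [RHS]cV_sum_delta; apply: eq_bigr => j _.
  by rewrite -scalemxAr tcoord_coord_field// dir_deriv_component.
by apply: eq_bigr => j _; rewrite -scalemxAr.
Qed.

(** Vanishing of the Christoffel symbols of [D] in [a] at [p]. *)
Definition flat_chart_at a p := forall v j, D p v (coord_field a j) = 0.

Lemma nabla_flat_chart a p v Y : smooth_chart a -> dom a p -> U p -> flat_chart_at a p ->
  smooth_field_at Y p ->
  tcoord a p *m D p v Y = 'D_(tcoord a p *m v) (read_in a Y) (to_coord a p).
Proof.
move=> sa ap Up fa sY; rewrite nabla_chart// big1 ?addr0// => j _.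
by rewrite fa mulmx0 scaler0.
Qed.

(** [cov_along] is computed in the chart b chosen at c t. Passing to [a] multiplies the components
    by the Jacobian of the transition, and the derivative of this Jacobian along [c] is exactly the
    Christoffel term of b, because those of [a] vanish. *)
Lemma cov_along_flat_chart a (c : R -> M) (V : R -> 'cV[R]_n) (t : R) :
  smooth_chart a -> dom a (c t) -> U (c t) -> smooth_into_at (c : R^o -> M) t ->
  flat_chart_at a (c t) ->
  derivable (read_along (chart_at (c t)) c V : R^o -> 'cV[R]_n) t 1 ->
  is_derive (t : R^o) 1 (read_along a c V : R^o -> 'cV[R]_n)
    (tcoord a (c t) *m cov_along D c V t).
Proof.
move=> sa at_ Ut [cc sc] fa dV.
set p := c t in at_ Ut sc fa dV *; pose b : chart R n M := chart_at p.
have sb : smooth_chart b by exact: smooth_chart_at.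
have bp : dom b p by exact: chart_at_dom.
have sT := transition_smooth sb sa bp at_.
pose T := transition b a; pose g : R^o -> 'cV[R]_n := to_coord b \o c.
have dg : differentiable g (t : R^o) by exact: smooth_at_differentiable sc.
have dJ : differentiable (jac T) (g t) by exact/smooth_at_differentiable/smooth_at_jac.
have vE : 'D_1 g (t : R^o) = velocity c t by rewrite -derive1E.
have DK : is_derive (t : R^o) 1 (jac T \o g) ('D_(velocity c t) (jac T) (g t)).
  apply: DeriveDef; first by apply/diff_derivable/differentiable_comp.
  by rewrite -vE; exact: derive_comp.
have DV : is_derive (t : R^o) 1 (read_along b c V : R^o -> 'cV[R]_n)
    (derive1 (read_along b c V) t).
  by apply: is_derive_derive1.
have near_dom : \forall s \near (t : R^o), dom b (c s) /\ dom a (c s).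
  exact: (cc _ (filterI (chart_near bp) (chart_near at_))).
have E : \forall s \near (t : R^o), (jac T \o g) s *m read_along b c V s = read_along a c V s.
  apply: filterS near_dom => s [bs as_].
  by rewrite /read_along mulmxA; congr (_ *m _); exact: tcoord_change.
apply: (near_eq_is_derive E); apply: is_derive_eq (is_derive_mulmx DK DV) _.
have -> : read_along b c V t = V t by rewrite /read_along tcoord_at mul1mx.
rewrite /cov_along mulmxDr [RHS]addrC; congr (_ + _).
rewrite mulmx_sum_cols mulmx_sumr; apply: eq_bigr => j _.
rewrite -scalemxAr; congr (_ *: _).
have sj := smooth_coord_field j sb bp.
rewrite nabla_flat_chart// derive_read_in_change//.
have -> : 'D_(velocity c t) (read_in b (coord_field b j)) (coord_at p) = 0.
  rewrite coord_field_const.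
  apply: (etrans (near_eq_derive _ (read_in_const (delta_mx j 0) sb bp))).
  exact: derive_cst.
rewrite mulmx0 addr0 [LHS]colE; congr (_ *m _).
by rewrite -(tcoord_coord_field j sb bp) tcoord_at mul1mx.
Qed.

(** The components in [a] have zero derivative along [c], so the mean value inequality with bound 0
    makes them constant. *)
Lemma parallel_flat_chart a (s t : R) (c : R -> M) (V : R -> 'cV[R]_n) :
  smooth_chart a -> s <= t -> curve_in (U `&` dom a) s t c ->
  (forall q, (U `&` dom a) q -> flat_chart_at a q) -> parallel_along D s t c V ->
  tcoord a (c t) *m V t = tcoord a (c s) *m V s.
Proof.
move=> sa st Hc fa Vp; apply/eqP; rewrite -subr_eq0 -normr_le0.
have Dr (x : R^o) : s <= x <= t ->
    is_derive x 1 (read_along a c V : R^o -> 'cV[R]_n) (0 : 'cV[R]_n).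
  move=> Hx; have [[Ux ax] sx] := Hc x Hx; have [dV Dx] := Vp x Hx.
  rewrite (_ : 0 = tcoord a (c x) *m cov_along D c V x); last by rewrite Dx mulmx0.
  by apply: cov_along_flat_chart => //; exact: fa.
have /= := mean_value_mx (K := 0) st Dr.
by rewrite mul0r; apply => x _; rewrite normr0.
Qed.

(** Exhibits the parallel fields that [G_connection] asks for, in place of an existence theorem for
    parallel transport. *)
Lemma parallel_coord_field a j (s t : R) (c : R -> M) :
  smooth_chart a -> curve_in (U `&` dom a) s t c ->
  (forall q, (U `&` dom a) q -> flat_chart_at a q) ->
  parallel_along D s t c (fun x => coord_field a j (c x)).
Proof.
move=> sa Hc fa x Hx; have [Uax sx] := Hc x Hx; have [Ux ax] := Uax.
set V := fun x => coord_field a j (c x); have [cc sg] := sx.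
have near_dom : \forall y \near (x : R^o), dom (chart_at (c x)) (c y) /\ dom a (c y).
  exact: (cc _ (filterI (chart_near (chart_at_dom (c x))) (chart_near ax))).
have dV : derivable (read_along (chart_at (c x)) c V : R^o -> 'cV[R]_n) (x : R^o) 1.
  set b : chart R n M := chart_at (c x) in sg near_dom *.
  have bx : dom b (c x) by exact: chart_at_dom.
  have E : \forall y \near (x : R^o),
      (read_in b (coord_field a j) \o (to_coord b \o c)) y = read_along b c V y.
    by apply: filterS near_dom => y [by_ _]; rewrite /= read_in_at.
  apply: (near_eq_derivable E); apply: diff_derivable; apply: differentiable_comp.
    exact: smooth_at_differentiable sg.
  by apply: smooth_at_differentiable; exact: smooth_coord_field.
split => //.
(* The covariant derivative, read in [a], is the derivative of the components in [a], which are
   locally constant. *)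
have [_ DV] := cov_along_flat_chart sa ax Ux sx (fa _ Uax) dV.
apply: (tcoord_inj sa ax); rewrite mulmx0 -DV.
have E : \forall y \near (x : R^o), read_along a c V y = cst (delta_mx j 0) y.
  by apply: filterS near_dom => y [_ ay]; rewrite /read_along tcoord_coord_field.
by apply: (etrans (near_eq_derive _ E)); exact: derive_cst.
Qed.

End Connections.

(** * The flat connection of a chart *)

Section ChartConnection.
Context {R : realType} {n : nat} {M : manifold R n}.
Variable a : chart R n M.
Hypothesis sa : smooth_chart a.
Implicit Types (p q : M) (v : 'cV[R]_n) (X Y Z : M -> 'cV[R]_n).

Definition chart_nabla q v Y : 'cV[R]_n :=
  coord_frame a q *m 'D_(tcoord a q *m v) (read_in a Y) (to_coord a q).

Lemma tcoord_chart_nabla q v Y : dom a q ->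
  tcoord a q *m chart_nabla q v Y = 'D_(tcoord a q *m v) (read_in a Y) (to_coord a q).
Proof. by move=> aq; rewrite /chart_nabla mulmxA tcoord_frameK// mul1mx. Qed.

Let read_in_diff Y q : dom a q -> smooth_field_at Y q ->
  differentiable (read_in a Y) (to_coord a q).
Proof.
by move=> aq sY; apply: smooth_at_differentiable; apply/smooth_field_chart.
Qed.

Lemma chart_nabla_local p v Y Z : dom a p ->
  smooth_field_at Y p -> smooth_field_at Z p ->
  (\forall q \near p, Y q = Z q) -> chart_nabla p v Y = chart_nabla p v Z.
Proof.
move=> ap _ _ YZ; congr (_ *m _); apply: near_eq_derive.
by apply: filterS (of_coord_near ap YZ) => y E; rewrite /read_in E.
Qed.

Lemma chart_nabla_linear p (r : R) u v Y : dom a p -> smooth_field_at Y p ->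
  chart_nabla p (r *: u + v) Y = r *: chart_nabla p u Y + chart_nabla p v Y.
Proof.
move=> ap sY; have dY := read_in_diff ap sY.
have lin (A : 'M[R]_n) (x y : 'cV[R]_n) : A *m (r *: x + y) = r *: (A *m x) + A *m y.
  by rewrite mulmxDr -scalemxAr.
rewrite /chart_nabla lin.
apply: (etrans (congr1 (mulmx _) (derive_linear dY r (tcoord a p *m u) (tcoord a p *m v)))).
exact: lin.
Qed.

Lemma chart_nabla_add p v Y Z : dom a p -> smooth_field_at Y p -> smooth_field_at Z p ->
  chart_nabla p v (fun q => Y q + Z q) = chart_nabla p v Y + chart_nabla p v Z.
Proof.
move=> ap sY sZ; rewrite /chart_nabla -mulmxDr; congr (_ *m _).
rewrite (_ : read_in a (fun q => Y q + Z q) = read_in a Y + read_in a Z); last first.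
  by apply/funext => y; exact: mulmxDr.
by apply: deriveD; apply: diff_derivable; exact: read_in_diff.
Qed.

Lemma chart_nabla_leibniz p v (f : M -> R) Y : dom a p ->
  smooth_fun_at (f : M -> R^o) p -> smooth_field_at Y p ->
  chart_nabla p v (fun q => f q *: Y q) = dir_deriv p v f *: Y p + f p *: chart_nabla p v Y.
Proof.
move=> ap sf sY; apply: (tcoord_inj sa ap).
rewrite tcoord_chart_nabla// mulmxDr -!scalemxAr tcoord_chart_nabla//.
rewrite (_ : read_in a (fun q => f q *: Y q) =
    fun y => ((f : M -> R^o) \o of_coord a) y *: read_in a Y y); last first.
  by apply/funext => y; rewrite /read_in -scalemxAr.
have sfa := (smooth_fun_chart (f : M -> R^o) sa ap).1 sf.
rewrite (derive_scale _ (smooth_at_differentiable sfa) (read_in_diff ap sY)).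
by rewrite (dir_deriv_chart v sa ap sf) read_in_at//= to_coordK.
Qed.

Lemma read_in_chart_nabla X Y p : dom a p ->
  \forall y \near to_coord a p, read_in a (fun q => chart_nabla q (X q) Y) y =
    'D_(read_in a X y) (read_in a Y) y.
Proof.
move=> ap; apply: filterS (cod_near ap) => y [aq yE].
by apply: (etrans (tcoord_chart_nabla (X (of_coord a y)) Y aq)); rewrite yE.
Qed.

(** The direction of differentiation varies with the point; as a matrix product, the expression can
    be differentiated again. *)
Lemma read_in_chart_nabla_jac X Y p : dom a p -> smooth_field_at Y p ->
  \forall y \near to_coord a p, read_in a (fun q => chart_nabla q (X q) Y) y =
    jac (read_in a Y) y *m read_in a X y.
Proof.
move=> ap sY; have sYa := (smooth_field_chart Y sa ap).1 sY.
apply: filterS (filterI (read_in_chart_nabla X Y ap) (smooth_at_near sYa)) => y [-> sy].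
by rewrite derive_jac//; exact: smooth_at_differentiable.
Qed.

Lemma chart_nabla_smooth (W : set M) X Y : open W -> W `<=` dom a ->
  smooth_field_on W X -> smooth_field_on W Y ->
  smooth_field_on W (fun q => chart_nabla q (X q) Y).
Proof.
move=> _ Wa sX sY p Wp; have ap := Wa p Wp.
apply/(smooth_field_chart _ sa ap).
apply: (@smooth_at_eq _ _ _ (fun y => jac (read_in a Y) y *m read_in a X y)).
  by apply: filterS (read_in_chart_nabla_jac X ap (sY p Wp)) => y ->.
apply: smooth_at_mulmx; first apply: smooth_at_jac.
- by apply/(smooth_field_chart _ sa ap); exact: sY.
- by apply/(smooth_field_chart _ sa ap); exact: sX.
Qed.

Definition chart_connection : linear_connection (dom a) :=
  LinearConnection chart_nabla_local chart_nabla_linear chart_nabla_add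
    chart_nabla_leibniz chart_nabla_smooth.

Lemma chart_connection_flat_chart q : dom a q -> flat_chart_at chart_connection a q.
Proof.
move=> aq v j; rewrite /= /chart_nabla coord_field_const.
rewrite (near_eq_derive _ (read_in_const (delta_mx j 0) sa aq)).
by rewrite (_ : 'D__ _ _ = 0) ?mulmx0//; exact: derive_cst.
Qed.

(** Torsion vanishes by the coordinate formula of the bracket. For curvature, differentiating jac(Z)
    Y along X gives a second derivative of Z, symmetric in X and Y, plus jac(Z) applied to the
    derivative of Y along X; the antisymmetric part of the latter is jac(Z) [X, Y], the third term
    of the curvature. *)
Lemma chart_connection_locally_flat : locally_flat chart_connection.
Proof.
split=> [W X Y _ Wa sX sY p Wp|W X Y Z _ Wa sX sY sZ p Wp]; have ap := Wa p Wp;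
  apply: (tcoord_inj sa ap); rewrite mulmx0.
- have L := lie_bracket_chart sa ap (sX p Wp) (sY p Wp).
  rewrite /coord_bracket !(read_in_at _ ap) in L.
  have gen (A B C b c : 'cV[R]_n) : A = b -> B = c -> C = b - c -> A - B - C = 0.
    by move=> -> -> ->; exact: subrr.
  rewrite /torsion /cov 2!mulmxBr.
  exact: (gen _ _ _ _ _ (tcoord_chart_nabla (X p) Y ap) (tcoord_chart_nabla (Y p) X ap) L).
- have sXa := (smooth_field_chart X sa ap).1 (sX p Wp).
  have sYa := (smooth_field_chart Y sa ap).1 (sY p Wp).
  have sZa := (smooth_field_chart Z sa ap).1 (sZ p Wp).
  have key (A B : M -> 'cV[R]_n) : smooth_at (read_in a B) (to_coord a p) ->
      tcoord a p *m chart_nabla p (A p) (fun q => chart_nabla q (B q) Z) =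
      'D_(tcoord a p *m A p) (jac (read_in a Z)) (to_coord a p) *m (tcoord a p *m B p) +
      jac (read_in a Z) (to_coord a p) *m 'D_(tcoord a p *m A p) (read_in a B) (to_coord a p).
    move=> sB; rewrite tcoord_chart_nabla//.
    rewrite (near_eq_derive _ (read_in_chart_nabla_jac B ap (sZ p Wp))).
    rewrite derive_mulmx ?read_in_at//; apply: smooth_at_differentiable => //.
    exact: smooth_at_jac.
  have L := lie_bracket_chart sa ap (sX p Wp) (sY p Wp).
  rewrite /coord_bracket !(read_in_at _ ap) in L.
  have dZ : differentiable (read_in a Z) (to_coord a p) by exact: smooth_at_differentiable.
  have gen (A B C S S' b c l : 'cV[R]_n) : A = S + b -> B = S' + c -> C = l ->
      S = S' -> b - c = l -> A - B - C = 0.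
    by move=> -> -> -> -> <-; rewrite opprD addrACA subrr add0r subrr.
  rewrite /curvature /cov 2!mulmxBr.
  apply: (gen _ _ _ _ _ _ _ _ (key X Y sYa) (key Y X sXa)
    (tcoord_chart_nabla (lie_bracket X Y p) Z ap)).
    exact: derive_jac_sym.
  apply: (etrans (esym (mulmxBr _ _ _))); apply: (etrans _ (esym (derive_jac _ dZ))).
  by rewrite L.
Qed.

End ChartConnection.

Lemma col_inj (T : Type) m n (A B : 'M[T]_(m, n)) : (forall j, col j A = col j B) -> A = B.
Proof.
by move=> H; apply/matrixP => i j; have /colP/(_ i) := H j; rewrite !mxE.
Qed.

Lemma integrable_flat_connection (R : realType) (n : nat) (G : lie_subgroup R n)
    (M : manifold R n) (P : M -> set 'M[R]_n) : G_structure G P ->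
  integrable_G_structure P ->
  forall p : M, exists (U : set M) (D : linear_connection U),
     [/\ open U, U p, G_connection P D & locally_flat D].
Proof.
move=> [_ PG Ptrans _] integ p; have [a [sa ap Pa]] := integ p.
exists (dom a), (chart_connection sa); split => //.
- exact: dom_open.
- move=> s t c st Hc F F' par PF.
  have Hc' : curve_in (dom a `&` dom a) s t c.
    by move=> x /Hc[ax ?].
  have [acs _] : dom a (c s) /\ smooth_into_at (c : R^o -> M) s by apply: Hc; rewrite lexx st.
  have [act _] : dom a (c t) /\ smooth_into_at (c : R^o -> M) t by apply: Hc; rewrite lexx st.
  have E : tcoord a (c t) *m F' = tcoord a (c s) *m F.
    apply: col_inj => j; have [V [HV Vs Vt]] := par j.
    rewrite !colE -!mulmxA -!colE -Vs -Vt.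
    apply: (parallel_flat_chart sa st Hc' _ HV) => q [aq _].
    exact: chart_connection_flat_chart.
  (* Adapted frames at a point form one orbit of [G]: the components of [F] in the coordinate frame
     are an element [g] of [G], and [F'] has the same components at the other end. *)
  have [g Fg] := Ptrans _ _ _ (Pa _ acs) PF.
  have -> : F' = coord_frame a (c t) *m incl g.
    apply: (tcoord_inj sa act); rewrite E Fg.
    apply: (etrans (mulmxA _ _ _)); apply: (etrans _ (esym (mulmxA _ _ _))).
    by rewrite (tcoord_frameK sa acs) (tcoord_frameK sa act).
  by apply: PG; exact: Pa.
- exact: chart_connection_locally_flat.
Qed.

(** * Affine coordinates of a flat connection *)

Section Christoffel.
Context {R : realType} {n : nat} {M : manifold R n} {U : set M} (D : linear_connection U).
Hypotheses (oU : open U) (flatD : locally_flat D).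
Variable a : chart R n M.
Hypothesis sa : smooth_chart a.
Implicit Types (p q : M) (v w : 'cV[R]_n) (X Y Z : M -> 'cV[R]_n).

Let W : set M := U `&` dom a.
Definition coord_domain : set 'cV[R]_n := to_coord a @` (dom a `&` U).
Let A := coord_domain.

(** The connection form of [D] in the frame of [a], evaluated at [v]. *)
Definition christoffel (y v : 'cV[R]_n) : 'M[R]_n := let q := of_coord a y in
  \matrix_(i, j) (tcoord a q *m D q (const_field a v q) (coord_field a j)) i 0.

Lemma coord_domain_open : open A.
Proof. exact: coord_image_open. Qed.

Let oW : open W.
Proof. by apply: openI => //; exact: dom_open. Qed.

Lemma coord_domainP q : U q -> dom a q -> A (to_coord a q).
Proof. by move=> Uq aq; exists q. Qed.

Lemma christoffel_col y v j : let q := of_coord a y in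
  col j (christoffel y v) = tcoord a q *m D q (const_field a v q) (coord_field a j).
Proof. by apply/colP => i; rewrite !mxE. Qed.

Lemma nabla_christoffel p v Y : U p -> dom a p -> smooth_field_at Y p ->
  tcoord a p *m D p v Y = 'D_(tcoord a p *m v) (read_in a Y) (to_coord a p) +
  christoffel (to_coord a p) (tcoord a p *m v) *m read_in a Y (to_coord a p).
Proof.
move=> Up ap sY; rewrite nabla_chart//; congr (_ + _).
rewrite mulmx_sum_cols; apply: eq_bigr => j _.
by rewrite christoffel_col to_coordK// /const_field mulmxA frame_tcoordK// mul1mx.
Qed.

Lemma christoffel_linear y : A y -> linear (christoffel y).
Proof.
move=> [q [aq Uq] <-] r u v; apply: col_inj => j.
rewrite linearP /= !christoffel_col to_coordK//.
have -> : const_field a (r *: u + v) q = r *: const_field a u q + const_field a v q.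
  by rewrite /const_field mulmxDr -scalemxAr.
rewrite (nabla_linear D)//; last exact: smooth_coord_field.
by rewrite mulmxDr -scalemxAr.
Qed.

Lemma christoffel_smooth v : smooth_on A (christoffel^~ v).
Proof.
apply: smooth_on_at => _ [q [aq Uq] <-]; apply: smooth_at_mx => i j.
have s1 : smooth_field_on W (const_field a v) by move=> p [_ ap]; exact: smooth_const_field.
have s2 : smooth_field_on W (coord_field a j) by move=> p [_ ap]; exact: smooth_coord_field.
have WU : W `<=` U by move=> p [].
have := nabla_smooth D oW WU s1 s2 (conj Uq aq).
move=> /(smooth_field_chart _ sa aq)/(smooth_at_entry i 0).
rewrite (_ : (fun y => christoffel y v i j : R^o) =
  fun y => read_in a (fun q => D q (const_field a v q) (coord_field a j)) y i 0) //.
by apply/funext => y; rewrite mxE.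
Qed.

Lemma tcoord_const_field v p : dom a p -> tcoord a p *m const_field a v p = v.
Proof. by move=> ap; rewrite /const_field mulmxA tcoord_frameK// mul1mx. Qed.

Lemma const_lie_bracket v w p : dom a p -> lie_bracket (const_field a v) (const_field a w) p = 0.
Proof.
move=> ap; apply: (tcoord_inj sa ap); rewrite mulmx0.
have L := lie_bracket_chart sa ap (smooth_const_field v sa ap) (smooth_const_field w sa ap).
apply: (etrans L); rewrite /coord_bracket.
have z (u u' : 'cV[R]_n) : 'D_u (read_in a (const_field a u')) (to_coord a p) = 0.
  apply: (etrans (near_eq_derive _ (read_in_const u' sa ap))); exact: derive_cst.
by rewrite !z subrr.
Qed.

Lemma cov_const v w p : U p -> dom a p ->
  tcoord a p *m cov D (const_field a v) (const_field a w) p = christoffel (to_coord a p) v *m w.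
Proof.
move=> Up ap; rewrite /cov nabla_christoffel//; last exact: smooth_const_field.
rewrite tcoord_const_field// (nbhs_singleton (read_in_const w sa ap)).
rewrite (_ : 'D__ _ _ = 0) ?add0r//.
apply: (etrans (near_eq_derive _ (read_in_const w sa ap))); exact: derive_cst.
Qed.

(** Torsion of two fields with constant components, whose bracket is zero. *)
Lemma christoffel_sym y v w : A y -> christoffel y v *m w = christoffel y w *m v.
Proof.
move=> [p [ap Up] <-].
have WU : W `<=` U by move=> q [].
have sc u : smooth_field_on W (const_field a u) by move=> q [_ aq]; exact: smooth_const_field.
have [tor _] := flatD; have := tor W _ _ oW WU (sc v) (sc w) p (conj Up ap).
rewrite /torsion const_lie_bracket// subr0 => /eqP; rewrite subr_eq0 => /eqP E.
by rewrite -!cov_const// E.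
Qed.

(** Curvature of the constant fields [w], [v], [u]: the bracket term drops out, and letting [u] run
    over the standard basis gives the matrix identity column by column. *)
Lemma christoffel_flat y v w : A y ->
  'D_w (christoffel^~ v) y - 'D_v (christoffel^~ w) y +
  (christoffel y w *m christoffel y v - christoffel y v *m christoffel y w) = 0.
Proof.
move=> [p [ap Up] <-]; set y0 := to_coord a p.
have WU : W `<=` U by move=> q [].
have sc u : smooth_field_on W (const_field a u) by move=> q [_ aq]; exact: smooth_const_field.
have Ay0 : A y0 by exact: coord_domainP.
have dC u : differentiable (christoffel^~ u) y0.
  exact: smooth_on_differentiable (christoffel_smooth u) Ay0.
have key v1 w1 u : tcoord a p *m cov D (const_field a v1) (cov D (const_field a w1) (const_field a u)) p =
    'D_v1 (christoffel^~ w1) y0 *m u + christoffel y0 v1 *m (christoffel y0 w1 *m u).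
  have sC := nabla_smooth D oW WU (sc w1) (sc u) (conj Up ap).
  have E : \forall y \near y0, read_in a (cov D (const_field a w1) (const_field a u)) y =
      christoffel y w1 *m u.
    apply: filterS (filterI (cod_near ap) (of_coord_near ap (open_nbhs_nbhs (conj oU Up)))) => z [[aq zE] Uq].
    by rewrite /read_in (cov_const w1 u Uq aq) zE.
  rewrite {1}/cov nabla_christoffel// tcoord_const_field// (nbhs_singleton E).
  congr (_ + _); apply: (etrans (near_eq_derive _ E)).
  have du : differentiable (fun _ : 'cV[R]_n => u) y0 by exact: differentiable_cst.
  apply: (etrans (derive_mulmx v1 (dC w1) du)).
  by rewrite (_ : 'D_v1 (fun=> u) y0 = 0) ?mulmx0 ?addr0//; exact: derive_cst.
apply: col_inj => j; rewrite [RHS]colE mul0mx colE; move: (delta_mx j 0) => u.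
have [_ curv] := flatD.
have := curv W _ _ _ oW WU (sc w) (sc v) (sc u) p (conj Up ap).
rewrite /curvature (_ : cov D (lie_bracket _ _) _ p = 0); last first.
  by rewrite /cov const_lie_bracket// nabla_dir0//; exact: smooth_const_field.
rewrite subr0 => /eqP; rewrite subr_eq0 => /eqP E.
have := congr1 (mulmx (tcoord a p)) E; rewrite !key !mulmxA.
move: ('D_w _ _) ('D_v _ _) => B C H.
rewrite mulmxDl !mulmxBl addrACA -opprD H subrr //.
Qed.

Lemma flat_coordinates p (F0 : 'M[R]_n) : U p -> dom a p -> F0 \in unitmx ->
  exists (r : R) (theta : 'cV[R]_n -> 'M[R]_n) (h : 'cV[R]_n -> 'cV[R]_n),
  let B := [set y | `|y - to_coord a p| < r] in
  [/\ 0 < r, B `<=` A, theta (to_coord a p) = F0,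
      smooth_on B theta /\ smooth_on B h &
      forall y v, B y -> 'D_v h y = theta y *m v /\ 'D_v theta y = theta y *m christoffel y v].
Proof.
move=> Up ap uF; set x0 := to_coord a p.
have Ax0 : A x0 by exact: coord_domainP.
(* [Om v] is the block matrix ((christoffel v, v), (0, 0)), and Z = (theta | h). *)
pose E1 : 'M[R]_(n + 1, n) := col_mx 1%:M 0.
pose E1' : 'M[R]_(n + 1, 1) := col_mx 0 1%:M.
pose E2 : 'M[R]_(n, n + 1) := row_mx 1%:M 0.
pose E3 : 'M[R]_(1, n + 1) := row_mx 0 1%:M.
(* Blocks are inserted and extracted by multiplying with constant matrices, so that smoothness and
   derivatives of [Om] and Z come from those of products. *)
have E21 : E2 *m E1 = 1%:M by rewrite mul_row_col mul1mx mul0mx addr0.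
have E31 : E3 *m E1 = 0 by rewrite mul_row_col mul0mx mulmx0 addr0.
have E21' : E2 *m E1' = 0 by rewrite mul_row_col mul0mx mulmx0 addr0.
have E31' : E3 *m E1' = 1%:M by rewrite mul_row_col mul0mx mul1mx add0r.
pose Om y v : 'M[R]_(n + 1) := E1 *m (christoffel y v *m E2 + v *m E3).
have lO y : A y -> linear (Om y).
  move=> Ay r u v; rewrite /Om (christoffel_linear Ay).
  rewrite !(mulmxDl, mulmxDr) -!(scalemxAl, scalemxAr) scalerDr.
  by rewrite addrACA.
have dC v y : A y -> differentiable (christoffel^~ v) y.
  by move=> Ay; exact: smooth_on_differentiable (christoffel_smooth v) Ay.
have sO v : smooth_on A (Om^~ v).
  apply: smooth_on_mulmx; [exact: coord_domain_open|exact: smooth_on_cst|].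
  apply: smooth_on_add; [exact: coord_domain_open| |exact: smooth_on_cst].
  apply: smooth_on_mulmx; [exact: coord_domain_open| |exact: smooth_on_cst].
  exact: christoffel_smooth.
have DO y v w : A y -> 'D_w (Om^~ v) y = E1 *m ('D_w (christoffel^~ v) y *m E2).
  move=> Ay; have dE2 : differentiable (fun _ : 'cV[R]_n => E2) y by exact: differentiable_cst.
  have dG := differentiable_mulmx (dC v y Ay) dE2.
  have dc : differentiable (fun _ : 'cV[R]_n => v *m E3) y by exact: differentiable_cst.
  have d3 : differentiable (fun y => christoffel y v *m E2 + v *m E3) y.
    exact: (differentiableD dG dc).
  apply: (etrans (derive_mulmx_const E1 w d3)); congr (_ *m _).
  apply: (etrans (deriveD (diff_derivable dG) (diff_derivable dc))).
  apply: (etrans (congr2 +%R (derive_mulmx w (dC v y Ay) dE2) (derive_cst _ _ _))).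
  rewrite addr0 (_ : 'D_w (fun=> E2) y = 0) ?mulmx0 ?addr0//; exact: derive_cst.
have OmM y v w : Om y w *m Om y v = E1 *m (christoffel y w *m (christoffel y v *m E2 + v *m E3)).
  rewrite /Om -!mulmxA; congr (_ *m _); rewrite mulmxA mulmxDl -!mulmxA.
  by rewrite E21 E31 mulmx1 mulmx0 addr0.
(* Only the upper blocks can be nonzero: the left one is the curvature identity, and the right one
   is Gamma(w) v - Gamma(v) w, zero by torsion. *)
have fO y v w : A y -> 'D_w (Om^~ v) y - 'D_v (Om^~ w) y + (Om y w *m Om y v - Om y v *m Om y w) = 0.
  move=> Ay.
  have gen (S T N N' : 'M[R]_(n + 1)) (B C Gv Gw : 'M[R]_n) :
      S = E1 *m (B *m E2) -> T = E1 *m (C *m E2) ->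
      N = E1 *m (Gw *m (Gv *m E2 + v *m E3)) -> N' = E1 *m (Gv *m (Gw *m E2 + w *m E3)) ->
      Gv *m w = Gw *m v -> B - C + (Gw *m Gv - Gv *m Gw) = 0 -> S - T + (N - N') = 0.
    move=> -> -> -> -> Sy F; rewrite -!mulmxBr -mulmxDr (_ : _ + _ = 0) ?mulmx0//.
    rewrite !mulmxDr !mulmxA Sy opprD [X in _ + X]addrACA subrr addr0.
    by rewrite -!mulmxBl -mulmxDl F mul0mx.
  exact: (gen _ _ _ _ _ _ _ _ (DO y v w Ay) (DO y w v Ay) (OmM y v w) (OmM y w v)
    (christoffel_sym v w Ay) (christoffel_flat v w Ay)).
(* The initial value is (F0 | 0): theta starts at [F0], and h sends the centre to 0. *)
have [r [Z [r0 rA Zx0 sZ DZ]]] := flat_system (F0 *m E2) coord_domain_open Ax0 lO sO fO.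
pose B := [set y | `|y - x0| < r]; have oB : open B by exact: open_norm_ball.
exists r, (fun y => Z y *m E1), (fun y => Z y *m E1') => B'; split => //.
- by rewrite Zx0 -mulmxA E21 mulmx1.
- by split; apply: smooth_on_mulmx => //; exact: smooth_on_cst.
- move=> y v By; have dZ := smooth_on_differentiable sZ By.
  have DZc l (E : 'M[R]_(n + 1, l)) : 'D_v (fun y => Z y *m E) y = Z y *m Om y v *m E.
    have dE : differentiable (fun _ : 'cV[R]_n => E) y by exact: differentiable_cst.
    apply: (etrans (derive_mulmx v dZ dE)).
    by rewrite DZ// (_ : 'D_v (fun=> E) y = 0) ?mulmx0 ?addr0//; exact: derive_cst.
  rewrite !DZc /Om -!mulmxA; split; congr (_ *m (_ *m _)); rewrite mulmxDl -!mulmxA.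
    by rewrite E21' E31' mulmx0 mulmx1 add0r.
  by rewrite E21 E31 mulmx0 mulmx1 addr0.
Qed.

End Christoffel.

(** * A chart followed by a local diffeomorphism *)

Section NewChart.
Context {R : realType} {n : nat} {M : manifold R n}.
Variables (a : chart R n M) (B : set 'cV[R]_n) (h g : 'cV[R]_n -> 'cV[R]_n).
Hypotheses (oB : open B) (Ba : B `<=` to_coord a @` dom a) (sa : smooth_chart a).
Hypotheses (sh : smooth_on B h) (oh : open (h @` B)) (gK : forall y, B y -> g (h y) = y)
  (sg : smooth_on (h @` B) g).

Let dom' : set M := [set q | dom a q /\ B (to_coord a q)].

Lemma new_dom_open : open dom'.
Proof.
rewrite openE => q [aq Bq]; apply: filterI; first exact: chart_near.
exact: (to_coord_continuous aq (open_near oB Bq)).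
Qed.

Lemma new_image : (h \o to_coord a) @` dom' = h @` B.
Proof.
apply/seteqP; split=> [_ [q [aq Bq] <-]|_ [y By <-]]; first by exists (to_coord a q).
have [q aq yE] := Ba By; exists q; last by rewrite /= yE.
by split => //; rewrite yE.
Qed.

Lemma new_cod_open : open ((h \o to_coord a) @` dom').
Proof. by rewrite new_image. Qed.

Lemma new_coordK q : dom' q -> (of_coord a \o g) ((h \o to_coord a) q) = q.
Proof. by move=> [aq Bq]; rewrite /= gK// to_coordK. Qed.

Lemma new_to_coord_continuous q : dom' q -> {for q, continuous (h \o to_coord a)}.
Proof.
move=> [aq Bq]; apply: continuous_comp; first exact: to_coord_continuous.
exact: smooth_on_continuous sh Bq.
Qed.

Lemma new_of_coord_continuous y : ((h \o to_coord a) @` dom') y ->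
  {for y, continuous (of_coord a \o g)}.
Proof.
rewrite new_image => -[x Bx <-]; apply: continuous_comp.
  by apply: smooth_on_continuous sg _; exists x.
by rewrite gK//; apply: of_coord_continuous; exact: Ba.
Qed.

Definition new_chart : chart R n M :=
  Chart new_dom_open new_cod_open new_coordK new_to_coord_continuous new_of_coord_continuous.

Lemma new_chart_smooth : smooth_chart new_chart.
Proof.
move=> p; set c : chart R n M := chart_at p.
have sc : smooth_chart c by exact: smooth_chart_at.
split; apply: smooth_on_at => _ [q [[aq Bq] cq] <-].
- have E : transition new_chart c = transition a c \o g by [].
  rewrite E; apply: smooth_at_comp => /=; first by exists (h @` B) => //; split => //; exists (to_coord a q).
  by rewrite gK//; exact: transition_smooth.
- have E : transition c new_chart = h \o transition c a by [].
  rewrite E; apply: smooth_at_comp; first exact: transition_smooth.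
  by rewrite transitionE//; exists B.
Qed.

Lemma chart_jac_new q : dom new_chart q -> chart_jac a new_chart q = jac h (to_coord a q).
Proof.
move=> [aq Bq]; apply: near_eq_jac.
by apply: filterS (transition_id aq) => y E; rewrite /transition /=; congr h.
Qed.

End NewChart.

(** F F^-1 = 1 holds near [x], where [F] stays invertible, and may be differentiated there. *)
Lemma derive_invmx (R : realType) (V : normedModType R) n (F : V -> 'M[R]_n) x v :
  smooth_at F x -> F x \in unitmx ->
  'D_v (fun y => invmx (F y)) x = - (invmx (F x) *m 'D_v F x *m invmx (F x)).
Proof.
move=> sF uF; have sI := smooth_at_invmx uF sF.
have dF := smooth_at_differentiable sF; have dI := smooth_at_differentiable sI.
have near_unit : \forall y \near x, F y *m invmx (F y) = 1%:M.
  by apply: filterS (near_unitmx uF sF) => y; exact: mulmxV.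
have E : 'D_v F x *m invmx (F x) + F x *m 'D_v (fun y => invmx (F y)) x = 0.
  rewrite -derive_mulmx//; apply: (etrans (near_eq_derive _ near_unit)); exact: derive_cst.
move/(congr1 (mulmx (invmx (F x)))): E; rewrite mulmx0 mulmxDr mulKmx// mulmxA.
by move=> /eqP; rewrite addrC addr_eq0 => /eqP.
Qed.

Lemma segment_smooth (R : realType) (n : nat) (M : manifold R n) (a : chart R n M)
    (x k : 'cV[R]_n) (t : R) (p := of_coord a (x + t *: k)) : smooth_chart a ->
  (to_coord a @` dom a) (x + t *: k) ->
  smooth_into_at ((fun s => of_coord a (x + s *: k)) : R^o -> M) t.
Proof.
move=> sa [q aq qE].
have pq : p = q by rewrite /p -qE to_coordK.
pose l : R^o -> 'cV[R]_n := fun s => x + s *: k.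
have sl : smooth_at l (t : R^o).
  apply: smooth_at_add; first exact: smooth_at_cst.
  apply: (@smooth_at_scale _ _ _ _ (id : R^o -> R^o) (fun=> k)); last exact: smooth_at_cst.
  by exists setT; [split => //; exact: openT|exact: smooth_on_id].
have lt : l t = to_coord a q by rewrite /l -qE.
split.
- apply: (@continuous_comp _ _ _ l (of_coord a)); first exact: smooth_at_continuous sl.
  by rewrite lt; apply: of_coord_continuous; exists q.
- have -> : to_coord (chart_at (of_coord a (x + t *: k))) \o (fun s : R^o => of_coord a (x + s *: k)) =
      transition a (chart_at p) \o l by [].
  apply: smooth_at_comp => //; rewrite lt pq; apply: transition_smooth => //.
    exact: smooth_chart_at.
  exact: chart_at_dom.
Qed.

(** * From a flat connection to adapted coordinates *)

Lemma flat_connection_integrable (R : realType) (n : nat) (G : lie_subgroup R n)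
    (M : manifold R n) (P : M -> set 'M[R]_n) : G_structure G P ->
  (forall p : M, exists (U : set M) (D : linear_connection U),
     [/\ open U, U p, G_connection P D & locally_flat D]) ->
  integrable_G_structure P.
Proof.
move=> [Punit _ _ [V [sec [Vp _ Psec _]]]] H p.
have [U [D [oU Up GD flatD]]] := H p.
(* Frames at [p] are given by components in [chart_at p]; with this choice of [a], the frame of the
   new chart at [p] is a Jacobian from it to [a], without further conversion. *)
pose a : chart R n M := chart_at p.
have sa : smooth_chart a by exact: smooth_chart_at.
have ap : dom a p by exact: chart_at_dom.
pose F0 := sec p p.
have PF0 : P p F0 by apply: Psec; have [] := Vp p.
have uF0 := Punit _ _ PF0.
have uF0' : invmx F0 \in unitmx by rewrite unitmx_inv.
have [r [theta [h [r0 rA th0 [sth sh] Dh]]]] := flat_coordinates oU flatD sa Up ap uF0'.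
set x0 := to_coord a p in rA th0 sth sh Dh.
pose A := [set y | `|y - x0| < r] : set 'cV[R]_n.
have oA : open A by exact: open_norm_ball.
have Ax0 : A x0 by rewrite /A /= subrr normr0.
have jacE y : A y -> jac h y = theta y.
  by move=> Ay; apply: jac_eqP => v; have [] := Dh y v Ay.
have uj : jac h x0 \in unitmx by rewrite jacE// th0.
have [s [g [s0 BA uB [ohB gK sg]]]] := inverse_function oA Ax0 sh uj.
set B := [set x | `|x - x0| < s] in BA uB ohB gK sg.
have oB : open B by exact: open_norm_ball.
have Bx0 : B x0 by rewrite /B /= subrr normr0.
have Bcod : B `<=` to_coord a @` dom a.
  by move=> y /BA/rA[q [aq _] <-]; exists q.
have shB : smooth_on B h := smooth_on_sub BA sh.
pose b : chart R n M := new_chart oB Bcod shB ohB gK sg.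
have sb : smooth_chart b by exact: new_chart_smooth.
have bp : dom b p by split.
have BU q : dom b q -> U q.
  by move=> [aq Bq]; have [q' [aq' Uq'] E] := rA _ (BA _ Bq); rewrite -(to_coordK aq) -E to_coordK.
have uth q : dom b q -> theta (to_coord a q) \in unitmx.
  by move=> [_ Bq]; rewrite -jacE; [exact: uB|exact: BA].
have jacba q : dom b q -> chart_jac b a q = invmx (theta (to_coord a q)).
  move=> bq; have [aq Bq] := bq; have ut := uth q bq.
  have := chart_jacK sa sb aq bq.
  rewrite (chart_jac_new bq) jacE; last exact: BA.
  by move=> E; rewrite -[LHS]mulmx1 -(mulmxV ut) mulmxA E mul1mx.
have flatb q : (U `&` dom b) q -> flat_chart_at D b q.
  move=> [Uq bq] v j; have [aq Bq] := bq; have ut := uth q bq.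
  have sj := smooth_coord_field j sb bq.
  apply: (tcoord_inj sa aq); rewrite mulmx0 nabla_christoffel//.
  set y := to_coord a q in ut *; set w := tcoord a q *m v.
  have E : \forall z \near y, read_in a (coord_field b j) z = invmx (theta z) *m delta_mx j 0.
    apply: filterS (filterI (cod_near aq) (of_coord_near aq (chart_near bq))) => z [[az zE] bz].
    by rewrite /read_in /coord_field colE mulmxA tcoord_frame_change// jacba// zE.
  have sty : smooth_at theta y by apply: smooth_at_on oA sth _; exact: BA.
  have dI := smooth_at_differentiable (smooth_at_invmx ut sty).
  have de : differentiable (fun _ : 'cV[R]_n => delta_mx j 0 : 'cV[R]_n) y by exact: differentiable_cst.
  rewrite (nbhs_singleton E).
  (* From D_w theta = theta Gamma(w) one gets D_w (theta^-1) = -Gamma(w) theta^-1, which cancels the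
     Christoffel term. *)
  have -> : 'D_w (read_in a (coord_field b j)) y = - (christoffel D a y w *m invmx (theta y)) *m delta_mx j 0.
    apply: (etrans (near_eq_derive _ E)); apply: (etrans (derive_mulmx w dI de)).
    rewrite (_ : 'D_w (fun=> delta_mx j 0) y = 0) ?mulmx0 ?addr0; last exact: derive_cst.
    rewrite derive_invmx//; have [_ ->] := Dh y w (BA _ Bq).
    by rewrite mulKmx.
  by rewrite mulNmx mulmxA addNr.
exists b; split => // q bq; have [aq Bq] := bq.
set y := to_coord a q in Bq.
(* The segment is taken in the coordinates of [a], where [B] is a ball and so convex; its image
   under [h], the range of the new chart, need not be. *)
pose c (t : R) : M := of_coord a (x0 + t *: (y - x0)).
have segB (t : R) : 0 <= t <= 1 -> B (x0 + t *: (y - x0)).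
  by move=> Ht; apply: segment_ball => //; rewrite subrr normr0.
have c0 : c 0 = p by rewrite /c scale0r addr0 to_coordK.
have c1 : c 1 = q by rewrite /c scale1r addrC subrK to_coordK.
have Hc : curve_in (U `&` dom b) 0 1 c.
  move=> t Ht; have By := segB t Ht.
  have bct : dom b (c t).
    have [q' aq' E] := Bcod _ By; rewrite /c -E to_coordK//.
    by split => //; rewrite E.
  split; first by split => //; exact: BU.
  by apply: segment_smooth => //; exact: (Bcod _ By).
have Hc' : curve_in U 0 1 c by move=> t /Hc[[]].
(* The columns of the coordinate frame of [b] are parallel along [c] and join [F0] at [p] to the
   coordinate frame at [q]. *)
have := GD 0 1 c ler01 Hc' F0 (coord_frame b q); rewrite c0 c1; apply => // j.
exists (fun t => coord_field b j (c t)); split.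
- exact: parallel_coord_field.
- rewrite c0 /coord_field; congr col.
  by rewrite coord_frameE jacba// -/x0 th0 invmxK.
- by rewrite c1.
Qed.

Theorem proposition3p3 (R : realType) (n : nat) (G : lie_subgroup R n)
    (M : manifold R n) (P : M -> set 'M[R]_n) (hP : G_structure G P) :
  integrable_G_structure P <->
  (forall p : M, exists (U : set M) (D : linear_connection U),
     [/\ open U, U p, G_connection P D & locally_flat D]).
Proof.
by split; [exact: integrable_flat_connection hP|exact: flat_connection_integrable hP].
Qed.
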